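(* Let $E$ be an elliptic curve with origin $\mathcal O$ over a number field $k$, let $p$ be an odd prime, let $v$ be a finite place of $k$ and let $K$ be a finite extension of $k_v$. Let $P\in E[p](K)$ and $Q\in E[p](\overline K)$ be such that $P$ and $Q$ generate $E[p](\overline K)$. Let $[\xi]\in\mathrm{H}^1(K,E[p])$ and let $\alpha\in R_K^\times$, $\rho\in(R_K\otimes_K R_K)^\times$ be compatible representatives for $[\xi]$, with associated $\gamma\in\overline{R_K}^\times$ (see context). Then, computing in $\overline{R_K}$ with the multiplication $*=*_\rho$, $$\Delta_{P,Q}^{*p}=\sum_{\substack{i_1,\ldots,i_p\in\mathbb Z/p\mathbb Z\\ p\mid \sum_\ell i_\ell}} e_p(Q,P)^{\sum_{\ell=1}^p \ell\, i_\ell}\prod_{\ell=1}^p\gamma(Q+i_\ell P)\;\delta_{\mathcal O},$$ where $\Delta_{P,Q}=\delta_Q+\delta_{Q+P}+\cdots+\delta_{Q+(p-1)P}$ and $\Delta_{P,Q}^{*p}$ is its $p$-fold $*$-product with itself.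
   Context: $e_p$ is the Weil pairing on $E[p](\overline K)$ with values in $\mu_p$, and $\varepsilon_p(S,T):=e_p(S,T)^{(p+1)/2}$ is the unique square root of $e_p(S,T)$ in $\mu_p$. $\overline{R_K}$ is the set of all maps $E[p](\overline K)\to\overline K$ with $G_K=\mathrm{Gal}(\overline K/K)$ acting by $(\sigma f)(S)=\sigma(f(\sigma^{-1}S))$; $R_K$ is the set of $G_K$-invariant maps. Elements of $\overline{R_K}\otimes\overline{R_K}$ are maps $E[p](\overline K)^2\to\overline K$, $R_K\otimes_K R_K$ the $G_K$-invariant ones. $w(S):=e_p(S,-)\in\overline{R_K}^\times$ and $(\partial\gamma)(T_1,T_2):=\gamma(T_1)\gamma(T_2)/\gamma(T_1+T_2)$. For $[\xi]$ represented by a cocycle $\xi$, $\alpha,\rho$ are compatible representatives if there is $\gamma\in\overline{R_K}^\times$ with $w(\xi(\sigma))=\sigma(\gamma)/\gamma$ for all $\sigma\in G_K$, $\gamma(\mathcal O)=1$, $\gamma^p=\alpha$, $\partial\gamma=\rho$. $\delta_T$ is the indicator function of $T\in E[p](\overline K)$. The multiplication is $(f*_\rho g)(T)=\sum_{T_1+T_2=T}\varepsilon_p(T_1,T_2)\rho(T_1,T_2)f(T_1)g(T_2)$ over $T_1,T_2\in E[p](\overline K)$. *)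

(* Defs.v *)
From HB Require Import structures.
From mathcomp Require Import all_boot all_order all_algebra all_field.
From mathcomp Require Import mpoly.
From mathcomp Require Import classical_sets fsbigop.

Set Implicit Arguments.
Unset Strict Implicit.
Unset Printing Implicit Defensive.

Import Order.TTheory GRing.Theory Num.Theory.

Local Open Scope ring_scope.

(* Finite places of a number field are represented by their normalised
   discrete valuations.  A valuation takes values in [int]; its value at 0 is
   irrelevant, and 0 is treated as having valuation +oo. *)

Definition val_ge (F : fieldType) (v : F -> int) (n : int) (x : F) : Prop :=
  x = 0 \/ n <= v x.

Definition discrete_valuation (F : fieldType) (v : F -> int) : Prop :=
  [/\ forall x y, x != 0 -> y != 0 -> v (x * y) = v x + v y,
      forall n x y, val_ge v n x -> val_ge v n y -> val_ge v n (x + y)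
    & exists2 x, x != 0 & v x = 1].

Definition val_complete (F : fieldType) (v : F -> int) : Prop :=
  forall u : nat -> F,
    (forall n : int, exists N : nat, forall a b : nat,
       (N <= a)%N -> (N <= b)%N -> val_ge v n (u a - u b)) ->
    exists l : F, forall n : int, exists N : nat, forall a : nat,
       (N <= a)%N -> val_ge v n (u a - l).

(* [(kv, vh)], with the embedding [i], is the completion of [(k, v)]. *)
Definition is_completion (k kv : fieldType) (v : k -> int)
    (i : {rmorphism k -> kv}) (vh : kv -> int) : Prop :=
  [/\ discrete_valuation vh,
      forall x, x != 0 -> vh (i x) = v x,
      forall (y : kv) (n : int), exists x : k, val_ge vh n (y - i x)
    & val_complete vh].

(* Kbar is closed by its type, so this makes it an algebraic closure of K. *)
Definition is_algebraic_closure (K : fieldType) (Kbar : closedFieldType)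
    (j : {rmorphism K -> Kbar}) : Prop :=
  forall z : Kbar, algebraicOver j z.

Record weierstrass (F : Type) := Weierstrass { a1 : F; a2 : F; a3 : F; a4 : F; a6 : F }.

Definition map_weierstrass (F L : Type) (f : F -> L) (E : weierstrass F) :=
  Weierstrass (f (a1 E)) (f (a2 E)) (f (a3 E)) (f (a4 E)) (f (a6 E)).

Section Curve.
Variables (F : fieldType) (E : weierstrass F).

Definition discriminant : F :=
  let b2 := a1 E ^+ 2 + 4 * a2 E in
  let b4 := 2 * a4 E + a1 E * a3 E in
  let b6 := a3 E ^+ 2 + 4 * a6 E in
  let b8 := a1 E ^+ 2 * a6 E + 4 * a2 E * a6 E - a1 E * a3 E * a4 E
            + a2 E * a3 E ^+ 2 - a4 E ^+ 2 in
  - b2 ^+ 2 * b8 - 8 * b4 ^+ 3 - 27 * b6 ^+ 2 + 9 * b2 * b4 * b6.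

Definition elliptic : Prop := discriminant != 0.

(* [None] is the origin (the point at infinity). *)
Definition point := option (F * F).

Definition on_curve (X : point) : bool :=
  if X is Some (x, y) then
    y ^+ 2 + a1 E * x * y + a3 E * y
      == x ^+ 3 + a2 E * x ^+ 2 + a4 E * x + a6 E
  else true.

Definition addp (X Y : point) : point :=
  match X, Y with
  | None, _ => Y
  | _, None => X
  | Some (x1, y1), Some (x2, y2) =>
    if (x1 == x2) && (y1 + y2 + a1 E * x2 + a3 E == 0) then None else
    let lam :=
      if x1 == x2 then
        (3 * x1 ^+ 2 + 2 * a2 E * x1 + a4 E - a1 E * y1)
          / (2 * y1 + a1 E * x1 + a3 E)
      else (y2 - y1) / (x2 - x1) in
    let nu := y1 - lam * x1 in
    let x3 := lam ^+ 2 + a1 E * lam - a2 E - x1 - x2 in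
    Some (x3, - (lam + a1 E) * x3 - nu - a3 E)
  end.

Definition mulp (n : nat) (X : point) : point := iter n (addp X) None.

(* A rational function on the projective curve is a pair (numerator,
   denominator) of forms of the same degree in X, Y, Z, the denominator not
   vanishing identically on the curve; [same_fun] is equality in F(E). *)

Definition weierstrass_form : {mpoly F[3]} :=
  let X := 'X_0 in let Y := 'X_1 in let Z := 'X_2 in
  Y ^+ 2 * Z + a1 E *: (X * Y * Z) + a3 E *: (Y * Z ^+ 2)
  - X ^+ 3 - a2 E *: (X ^+ 2 * Z) - a4 E *: (X * Z ^+ 2) - a6 E *: Z ^+ 3.

Definition zero_on_curve (G : {mpoly F[3]}) : Prop :=
  exists H, G = H * weierstrass_form.

Definition fraction := ({mpoly F[3]} * {mpoly F[3]})%type.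

Definition rational_fun (f : fraction) : Prop :=
  (exists d : nat, f.1 \is d.-homog /\ f.2 \is d.-homog) /\ ~ zero_on_curve f.2.

Definition same_fun (f g : fraction) : Prop :=
  zero_on_curve (f.1 * g.2 - g.1 * f.2).

Definition mulf (f g : fraction) : fraction := (f.1 * g.1, f.2 * g.2).

Definition expf (f : fraction) (n : int) : fraction :=
  match n with
  | Posz m => (f.1 ^+ m, f.2 ^+ m)
  | Negz m => (f.2 ^+ m.+1, f.1 ^+ m.+1)
  end.

Definition homog_coord (T : point) : 'I_3 -> F :=
  if T is Some (x, y) then tnth [tuple x; y; 1] else tnth [tuple 0; 1; 0].

Definition evalp (G : {mpoly F[3]}) (T : point) : F := G.@[homog_coord T].

Definition regular_at (f : fraction) (T : point) : Prop :=
  exists h, [/\ rational_fun h, same_fun f h & evalp h.2 T != 0].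

Definition vanishes_at (f : fraction) (T : point) : Prop :=
  exists h, [/\ rational_fun h, same_fun f h, evalp h.2 T != 0 & evalp h.1 T = 0].

Definition unit_at (f : fraction) (T : point) : Prop :=
  exists h, [/\ rational_fun h, same_fun f h, evalp h.2 T != 0 & evalp h.1 T != 0].

(* [t] generates the maximal ideal of the local ring at [T]. *)
Definition uniformizer_at (t : fraction) (T : point) : Prop :=
  [/\ rational_fun t, vanishes_at t T
    & forall h, rational_fun h -> vanishes_at h T ->
        exists u, [/\ rational_fun u, regular_at u T & same_fun h (mulf u t)]].

(* ord_T(f) = n *)
Definition order_at (f : fraction) (T : point) (n : int) : Prop :=
  exists t u, [/\ uniformizer_at t T, rational_fun u, unit_at u T
                & same_fun f (mulf u (expf t n))].

(* These two refer to the given representation of [f], which can only exclude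
   finitely many further points of the curve. *)
Definition defined_at (f : fraction) (T : point) : bool := evalp f.2 T != 0.
Definition value_at (f : fraction) (T : point) : F := evalp f.1 T / evalp f.2 T.

Variable p : nat.

Definition is_torsion (X : point) : bool := on_curve X && (mulp p X == None).

Definition torsion := {X : point | is_torsion X}.

Lemma is_torsion0 : is_torsion None.
Proof.
by rewrite /is_torsion /mulp; elim: p => //= n /eqP ->.
Qed.

Definition tors0 : torsion := exist _ None is_torsion0.

(* E[p] is a subgroup of E(F), so the default value of [insubd] is never
   used. *)
Definition addt (S T : torsion) : torsion := insubd tors0 (addp (val S) (val T)).

Definition mulnt (n : nat) (T : torsion) : torsion := iter n (addt T) tors0.

Definition generate (S T : torsion) : Prop :=
  forall U : torsion, exists a b : nat, U = addt (mulnt a S) (mulnt b T).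

(* The divisor of [f] is p(T) - p(O), [f] composed with [p] is [g ^ p], and
   e_p(S, T) = g(X + S) / g(X) wherever both values are defined. *)
Definition is_weil_pairing (e : torsion -> torsion -> F) : Prop :=
  forall T : torsion, exists f g : fraction,
    [/\ rational_fun f, rational_fun g,
        forall X, on_curve X ->
          order_at f X (p%:Z * (X == val T)%:Z - p%:Z * (X == None)%:Z),
        forall X, on_curve X -> defined_at f (mulp p X) -> defined_at g X ->
          value_at f (mulp p X) = value_at g X ^+ p
      & forall (S : torsion) X, on_curve X ->
          defined_at g X -> defined_at g (addp X (val S)) ->
          value_at g (addp X (val S)) = e S T * value_at g X].

End Curve.

(* G_K, as the automorphisms of Kbar fixing the image of K. *)
Record galois_group (K L : fieldType) (j : {rmorphism K -> L}) := Galois {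
  gal_fun :> {rmorphism L -> L};
  gal_inv : L -> L;
  gal_funK : cancel gal_fun gal_inv;
  gal_invK : cancel gal_inv gal_fun;
  gal_fix : forall a : K, gal_fun (j a) = j a
}.

Lemma gal_mul_fix (K L : fieldType) (j : {rmorphism K -> L})
    (s t : galois_group j) (a : K) : (s \o t) (j a) = j a.
Proof. by rewrite /= !gal_fix. Qed.

Definition gal_mul (K L : fieldType) (j : {rmorphism K -> L})
    (s t : galois_group j) : galois_group j :=
  @Galois K L j (s \o t) (gal_inv t \o gal_inv s)
    (can_comp (gal_funK s) (gal_funK t))
    (can_comp (gal_invK t) (gal_invK s))
    (gal_mul_fix s t).

Section Torsion.
Variables (K L : fieldType) (j : {rmorphism K -> L}) (E : weierstrass L) (p : nat).
Local Notation G := (galois_group j).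
Local Notation tors := (torsion E p).

Definition map_point (s : L -> L) (X : point L) : point L :=
  omap (fun xy => (s xy.1, s xy.2)) X.

(* As for [addt], the default value is not used when [s] is a field
   automorphism fixing the coefficients of E. *)
Definition actt (s : L -> L) (T : tors) : tors :=
  insubd (tors0 E p) (map_point s (val T)).

Definition rational_point (X : point L) : Prop :=
  if X is Some (x, y) then (exists a, x = j a) /\ (exists b, y = j b) else True.

(* Continuity is for the Krull topology on G_K and the discrete topology on
   E[p]. *)
Definition continuous_map (xi : G -> tors) : Prop :=
  forall s : G, exists A : seq L,
    forall t : G, {in A, t =1 s} -> xi t = xi s.

Definition cocycle (xi : G -> tors) : Prop :=
  continuous_map xi /\
  forall s t : G, xi (gal_mul s t) = addt (xi s) (actt s (xi t)).

(* eta(s) = xi(s) + (s(T) - T) *)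
Definition cohomologous (xi eta : G -> tors) : Prop :=
  exists T : tors, forall s : G, addt (eta s) T = addt (xi s) (actt s T).

(* The elements of H^1(K, E[p]), as classes of cocycles. *)
Definition H1_class (c : (G -> tors) -> Prop) : Prop :=
  exists2 xi, cocycle xi &
    forall eta, c eta <-> cocycle eta /\ cohomologous xi eta.

Definition act1 (s : G) (f : tors -> L) : tors -> L :=
  fun S => s (f (actt (gal_inv s) S)).

Definition act2 (s : G) (f : tors -> tors -> L) : tors -> tors -> L :=
  fun S T => s (f (actt (gal_inv s) S) (actt (gal_inv s) T)).

(* The units of Rbar_K, of R_K and of R_K (x)_K R_K. *)
Definition Rbar_unit (f : tors -> L) : Prop := forall S, f S != 0.

Definition R_unit (f : tors -> L) : Prop :=
  Rbar_unit f /\ forall s S, act1 s f S = f S.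

Definition RR_unit (f : tors -> tors -> L) : Prop :=
  (forall S T, f S T != 0) /\ forall s S T, act2 s f S T = f S T.

Definition partial (g : tors -> L) (T1 T2 : tors) : L :=
  g T1 * g T2 / g (addt T1 T2).

Variable e : tors -> tors -> L.

(* [alpha], [rho] are compatible representatives of the class [c], and [g] is
   the associated map gamma. *)
Definition compatible (c : (G -> tors) -> Prop)
    (alpha : tors -> L) (rho : tors -> tors -> L) (g : tors -> L) : Prop :=
  exists2 xi, c xi &
  [/\ forall (s : G) (T : tors), e (xi s) T = act1 s g T / g T,
      g (tors0 E p) = 1,
      forall T, g T ^+ p = alpha T
    & forall T1 T2, partial g T1 T2 = rho T1 T2].

Definition eps (S T : tors) : L := e S T ^+ (p.+1)./2.

(* The sum is over the set of pairs with T1 + T2 = T, finite since E[p] is. *)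
Definition star (rho : tors -> tors -> L) (f g : tors -> L) : tors -> L :=
  fun T => \sum_(U \in [set U : tors * tors | addt U.1 U.2 = T]%classic)
             (eps U.1 U.2 * rho U.1 U.2 * f U.1 * g U.2).

Definition delta (T : tors) : tors -> L := fun S => (S == T)%:R.

(* n-fold product, bracketed as f * (f * ( ... * f)) *)
Definition star_pow (rho : tors -> tors -> L) (f : tors -> L) (n : nat) : tors -> L :=
  iterop n (star rho) f (delta (tors0 E p)).

Definition Delta (P Q : tors) : tors -> L :=
  fun T => \sum_(i < p) delta (addt Q (mulnt i P)) T.

End Torsion.

(* The base change of E to Kbar along k -> k_v -> K -> Kbar. *)
Definition base_change (k kv : fieldType) (i : {rmorphism k -> kv})
    (K : fieldExtType kv) (L : fieldType) (j : {rmorphism K -> L})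
    (E : weierstrass k) : weierstrass L :=
  map_weierstrass (fun a => j (i a)%:A) E.

(* Main.v *)
(* Writing rho as the coboundary of gamma, the coefficient of delta_T in
   Delta^{*p}, multiplied by gamma(T), becomes a sum over the tuples (i_l) with
   sum T of a power of the square root of e_p(Q,P) times the product of the
   gamma(Q + i_l P), by bilinearity and alternation of the Weil pairing.
   Shifting a tuple cyclically multiplies its term by e_p(T,Q).  Since e_p(Q,P)
   is a primitive p-th root of unity, the coefficient vanishes unless T = O.

   The properties of the pairing are derived from its definition by functions.
   In characteristic 0 the curve is y^2 = d(x) with d a separable cubic;
   functions are considered off finite sets of points.  A function without
   poles is constant, and no divisor (S) - (T) with S <> T is principal; the
   chord and tangent construction therefore makes the curve a group.
   Translations preserve orders because an automorphism of the curve preserves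
   principal divisors, and [p] preserves them because it is unramified.
   The pairing is antisymmetric since it equals, up to sign of S, the
   commutator f_S(Y) f_T(Y-S) / (f_T(Y) f_S(Y-T)).
   If e_p(-,T) were trivial for some T <> O, then g_T, having simple poles exactly
   at E[p], would be a common parameter for x([p]X) and y([p]X), giving
   polynomials with S^2 = d(R), which is impossible. *)
Require Import Defs.
From HB Require Import structures.
From mathcomp Require Import all_boot all_order all_algebra all_field.
From mathcomp Require Import mpoly.
From mathcomp Require Import classical_sets fsbigop.
From mathcomp Require Import boolp ring zify.

Set Implicit Arguments.
Unset Strict Implicit.
Unset Printing Implicit Defensive.

Import Order.TTheory GRing.Theory Num.Theory.

Local Open Scope ring_scope.

(** * Rational functions on y^2 = d(x) *)

(** Rational functions are plain functions on points with arbitrary values at finitely many places.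
    Equality in the function field is equality off a finite set, and it can be pulled back along any
    map with finite fibres. For multiplication by p this finiteness comes from the generators P and
    Q, which list E[p]. The definition of the pairing gives additivity in the first argument only,
    by composing translations; additivity in the second argument and alternation both come through
    antisymmetry. The commutator of f_S and f_T yields antisymmetry from the constancy of functions
    with trivial divisor, in place of Weil reciprocity. Generation by P and Q would by itself allow
    E[p] to be trivial or cyclic. That E[p] is nontrivial and the pairing nondegenerate is what
    makes e_p(Q,P) different from 1. A cyclic shift changes the exponent of the square root eps(Q,P)
    by twice the index sum, modulo p; this is how a power of e_p(Q,P) itself comes out. *)

Record cubic (F : closedFieldType) := Cubic {
  cpoly :> {poly F};
  cubic_monic : cpoly \is monic;
  cubic_size : size cpoly = 4%N;
  cubic_sep : coprimep cpoly cpoly^`();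
  cubic_char0 : [pchar F] =i pred0 }.

Definition on_cubic (F : closedFieldType) (c : cubic F) (X : option (F * F)) :=
  if X is Some (x, y) then y ^+ 2 == c.[x] else true.

Record pt (F : closedFieldType) (c : cubic F) :=
  Pt { pval : option (F * F); pvalP : on_cubic c pval }.

HB.instance Definition _ (F : closedFieldType) (c : cubic F) := [isSub for @pval F c].
HB.instance Definition _ (F : closedFieldType) (c : cubic F) := [Choice of pt c by <:].

Section Points.
Variables (F : closedFieldType) (c : cubic F).
Local Notation pt := (pt c).
Local Notation d := (cpoly c).
Implicit Types (X Y S T : pt) (f g h : pt -> F).

Definition ptO : pt := @Pt F c None isT.
(* Both coordinates of the origin are the junk value 0. *)
Definition px X : F := if pval X is Some (x, _) then x else 0.
Definition py X : F := if pval X is Some (_, y) then y else 0.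

Lemma natf_neq0 n : (n.+1%:R : F) != 0.
Proof. by have /pcharf0P -> := cubic_char0 c. Qed.

Lemma two_neq0 : (2%:R : F) != 0. Proof. exact: natf_neq0. Qed.

Lemma cubic_neq0 : (c : {poly F}) != 0.
Proof. by rewrite -size_poly_gt0 cubic_size. Qed.

Lemma cubicE x : c.[x] = x ^+ 3 + c`_2 * x ^+ 2 + c`_1 * x + c`_0.
Proof.
have h3 : c`_3 = 1 by have /monicP := cubic_monic c; rewrite /lead_coef cubic_size.
by rewrite horner_coef cubic_size !big_ord_recr big_ord0 /= h3; ring.
Qed.

Lemma py2 X : X != ptO -> py X ^+ 2 = c.[px X].
Proof.
by case: X => [[[x y]|] H] // _; apply/eqP; exact: H.
Qed.

Lemma pt_eqP X Y : X != ptO -> Y != ptO -> px X = px Y -> py X = py Y -> X = Y.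
Proof.
move=> hX hY; case: X hX => [[[x y]|] H]; case: Y hY => [[[x' y']|] H'];
  rewrite -?val_eqE // /px /py /= => _ _ ex ey; subst.
exact: val_inj.
Qed.

Definition ptA x y (H : y ^+ 2 = c.[x]) : pt := @Pt F c (Some (x, y)) (introT eqP H).

Lemma ptA_neqO x y (H : y ^+ 2 = c.[x]) : ptA H != ptO.
Proof. by rewrite -val_eqE. Qed.

Lemma pxA x y (H : y ^+ 2 = c.[x]) : px (ptA H) = x. Proof. by []. Qed.
Lemma pyA x y (H : y ^+ 2 = c.[x]) : py (ptA H) = y. Proof. by []. Qed.

Lemma sqrt_exists (a : F) : exists y, y ^+ 2 = a.
Proof.
have := @solve_monicpoly F 2 (fun i => if i == 0%N then a else 0) isT.
by case=> y; rewrite !big_ord_recr big_ord0 /= mul0r expr0 mulr1 add0r addr0; exists y.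
Qed.

Lemma pt_exists x : exists2 X, X != ptO & px X = x.
Proof. by have [y H] := sqrt_exists c.[x]; exists (ptA H) => //; exact: ptA_neqO. Qed.

(** [ae] of an equation between functions is equality in the function field; exceptional points
    absorb poles and junk values. *)
Definition ae (P : pt -> Prop) := exists s : seq pt, forall X, X \notin s -> P X.

Lemma aeW (P : pt -> Prop) : (forall X, P X) -> ae P.
Proof. by move=> H; exists [::]. Qed.

Lemma ae1 (P Q : pt -> Prop) : ae P -> (forall X, P X -> Q X) -> ae Q.
Proof. by case=> s H K; exists s => X /H /K. Qed.

Lemma ae2 (P Q R : pt -> Prop) :
  ae P -> ae Q -> (forall X, P X -> Q X -> R X) -> ae R.
Proof.
case=> s H [t K] L; exists (s ++ t) => X; rewrite mem_cat negb_or.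
by case/andP => /H hP /K; apply: L.
Qed.

Lemma ae3 (P Q R S : pt -> Prop) : ae P -> ae Q -> ae R ->
  (forall X, P X -> Q X -> R X -> S X) -> ae S.
Proof. by move=> a b d H; apply: (ae2 a (ae2 b d (fun X p q => conj p q))) => X p []; apply: H. Qed.

Lemma ae4 (P Q R S T : pt -> Prop) : ae P -> ae Q -> ae R -> ae S ->
  (forall X, P X -> Q X -> R X -> S X -> T X) -> ae T.
Proof. by move=> a b d e H; apply: (ae2 (ae2 a b (fun X p q => conj p q)) (ae2 d e (fun X p q => conj p q))) => X [p q] []; apply: H. Qed.

Lemma ae_neq S : ae (fun X => X != S).
Proof. by exists [:: S] => X; rewrite inE. Qed.

Lemma finite_x x : exists s : seq pt, forall X, px X = x -> X \in s.
Proof.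
have [y H] := sqrt_exists c.[x].
have H' : (- y) ^+ 2 = c.[x] by rewrite sqrrN.
exists [:: ptO; ptA H; ptA H'] => X hx; rewrite !inE.
have [//|hX] := eqVneq X ptO; apply/orP; right.
have: (py X - y) * (py X + y) = 0 by rewrite -subr_sqr py2 // hx H subrr.
move/eqP; rewrite mulf_eq0 subr_eq0 addr_eq0 => /orP [] /eqP e; apply/orP; [left|right];
  by apply/eqP/pt_eqP; rewrite ?ptA_neqO.
Qed.

Lemma ae_px_neq x : ae (fun X => px X != x).
Proof.
have [s H] := finite_x x; exists s => X; apply: contraNneq; exact: H.
Qed.

Lemma ae_poly (q : {poly F}) : q != 0 -> ae (fun X => q.[px X] != 0).
Proof.
move=> q0; have [r rE] := closed_field_poly_normal q.
have: ae (fun X => all (fun z => px X != z) r).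
  elim: r {rE} => [|z r IH] /=; first exact: aeW.
  by apply: (ae2 (ae_px_neq z) IH) => X -> ->.
move/ae1; apply=> X /allP H; rewrite rE hornerZ mulf_neq0 ?lead_coef_eq0 //.
rewrite horner_prod prodf_seq_neq0; apply/allP => z hz /=.
by rewrite !hornerE subr_eq0 H.
Qed.

(** The curve is infinite: a root of q(x) x + 1, where q vanishes at the abscissas of the
    exceptional points, is the abscissa of a good point. *)
Lemma ae_ex (P : pt -> Prop) : ae P -> exists X, P X.
Proof.
case=> s H; pose q := \prod_(z <- map px s) ('X - z%:P) : {poly F}.
have qm : q \is monic by apply: monic_prod_XsubC.
(* The factor x keeps the polynomial nonconstant when there is no exceptional point and q = 1. *)
have: size (q * ('X - 0%:P) + 1) != 1%N.
  have sz : size (q * ('X - 0%:P)) = (size s).+2.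
    by rewrite size_Mmonic ?monicXsubC ?monic_neq0 // size_XsubC size_prod_XsubC size_map addn2.
  by rewrite size_polyDl ?sz ?size_poly1.
case/closed_rootP => x; rewrite /root !hornerE => hx.
have [X hX ex] := pt_exists x; exists X; apply: H; apply: contraTN hx => Xs.
suff -> : q.[x] = 0 by rewrite mul0r add0r oner_eq0.
apply/eqP; rewrite -rootE root_prod_XsubC -ex; exact: map_f.
Qed.

Lemma ae_False : ~ ae (fun=> False).
Proof. by case/ae_ex. Qed.

Definition ev (a b : {poly F}) X : F := a.[px X] + b.[px X] * py X.
(** The norm of a + b y from F(x,y) to F(x); it reduces zeros on the curve to roots of
    polynomials. *)
Definition nrm (a b : {poly F}) : {poly F} := a ^+ 2 - d * b ^+ 2.

Lemma ev_nrm a b X : X != ptO -> ev a b X * ev a (- b) X = (nrm a b).[px X].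
Proof. move=> hX; rewrite /ev /nrm !(hornerE, horner_exp) -(py2 hX) /=; ring. Qed.

Lemma size_sqr (a : {poly F}) : size (a ^+ 2) = (size a).*2.-1.
Proof.
have [->|a0] := eqVneq a 0; first by rewrite expr0n /= size_poly0.
by rewrite expr2 size_mul // addnn.
Qed.

Lemma size_csqr (b : {poly F}) : b != 0 -> size (d * b ^+ 2) = (size b).*2.+2.
Proof.
move=> b0; rewrite size_mul ?cubic_neq0 ?expf_neq0 // size_sqr cubic_size.
by move: b0; rewrite -size_poly_gt0; case: (size b).
Qed.

(** For nonzero a and b, a^2 has even degree and d b^2 odd degree, so they cannot cancel. *)
Lemma nrm_eq0 a b : nrm a b = 0 -> a = 0 /\ b = 0.
Proof.
move=> /eqP; rewrite subr_eq0 => /eqP e.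
have b0 : b = 0.
  apply/eqP/negPn/negP => b0; have := congr1 (fun p : {poly F} => size p) e.
  rewrite size_csqr // size_sqr; case: (size a) => //= n; lia.
move: e; rewrite b0 expr0n mulr0 => /eqP; rewrite expf_eq0 /= => /eqP ->; by [].
Qed.

Lemma ev_neq0 a b : (a != 0) || (b != 0) -> ae (fun X => ev a b X != 0).
Proof.
move=> h; have n0 : nrm a b != 0.
  apply: contraTN h => /eqP /nrm_eq0 [-> ->]; by rewrite eqxx.
apply: (ae2 (ae_poly n0) (ae_neq ptO)) => X h1 hX.
by apply: contraNneq h1; rewrite -ev_nrm // => ->; rewrite mul0r.
Qed.

Lemma ev_ae0 a b : ae (fun X => ev a b X = 0) -> a = 0 /\ b = 0.
Proof.
move=> h; case: (eqVneq a 0) => [ea|a0]; case: (eqVneq b 0) => [eb|b0] //; exfalso;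
(have: ae (fun X => ev a b X != 0) by apply: ev_neq0; rewrite ?a0 ?b0 ?orbT);
by move/(ae2 h) => /(_ (fun=> False)) H; apply: ae_False; apply: H => X ->; rewrite eqxx.
Qed.

Lemma ev_inj a b a' b' : ae (fun X => ev a b X = ev a' b' X) -> a = a' /\ b = b'.
Proof.
move=> h; have: ae (fun X => ev (a - a') (b - b') X = 0).
  apply: (ae1 h) => X e; rewrite /ev !hornerE; move: e; rewrite /ev => e.
  rewrite mulrBl addrACA -opprD e; exact: subrr.
by case/ev_ae0 => /eqP + /eqP; rewrite !subr_eq0 => /eqP -> /eqP ->.
Qed.

Lemma evD a b a' b' X : ev (a + a') (b + b') X = ev a b X + ev a' b' X.
Proof. rewrite /ev !hornerE /=; ring. Qed.

Lemma evM a b a' b' X : X != ptO ->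
  ev (a * a' + d * (b * b')) (a * b' + b * a') X = ev a b X * ev a' b' X.
Proof. move=> hX; rewrite /ev !hornerE -(py2 hX) /=; ring. Qed.

Lemma evC (a : {poly F}) X : ev a 0 X = a.[px X].
Proof. by rewrite /ev horner0 mul0r addr0. Qed.

(** A denominator in x alone is general enough, since multiplying by the conjugate removes y from
    it. *)
Definition rational f := exists a b q : {poly F},
  q != 0 /\ ae (fun X => f X * q.[px X] = ev a b X).

Lemma rat_ext f g : rational f -> ae (fun X => f X = g X) -> rational g.
Proof.
move=> [a [b [q [q0 h]]]] e; exists a, b, q; split=> //.
by apply: (ae2 h e) => X <- ->.
Qed.

Lemma rat_const k : rational (fun=> k).
Proof.
exists k%:P, 0, 1; split; first exact: oner_neq0.
by apply: aeW => X; rewrite evC !hornerE.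
Qed.

Lemma rat_px : rational px.
Proof.
exists 'X, 0, 1; split; first exact: oner_neq0.
by apply: aeW => X; rewrite evC !hornerE.
Qed.

Lemma rat_py : rational py.
Proof.
exists 0, 1, 1; split; first exact: oner_neq0.
by apply: aeW => X; rewrite /ev !hornerE /=; ring.
Qed.

Lemma rat_add f g : rational f -> rational g -> rational (fun X => f X + g X).
Proof.
move=> [a [b [q [q0 h]]]] [a' [b' [q' [q0' h']]]].
exists (a * q' + a' * q), (b * q' + b' * q), (q * q'); split; first exact: mulf_neq0.
apply: (ae2 h h') => X e e'; rewrite evD.
have -> : ev (a * q') (b * q') X = ev a b X * q'.[px X] by rewrite /ev !hornerE /=; ring.
have -> : ev (a' * q) (b' * q) X = ev a' b' X * q.[px X] by rewrite /ev !hornerE /=; ring.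
by rewrite -e -e' hornerM; ring.
Qed.

Lemma rat_mul f g : rational f -> rational g -> rational (fun X => f X * g X).
Proof.
move=> [a [b [q [q0 h]]]] [a' [b' [q' [q0' h']]]].
exists (a * a' + d * (b * b')), (a * b' + b * a'), (q * q'); split; first exact: mulf_neq0.
apply: (ae3 h h' (ae_neq ptO)) => X e e' hX.
by rewrite evM // -e -e' hornerM; ring.
Qed.

Lemma rat_opp f : rational f -> rational (fun X => - f X).
Proof.
move=> h; apply: rat_ext (rat_mul (rat_const (-1)) h) _.
by apply: aeW => X; rewrite mulN1r.
Qed.

Lemma rat_sub f g : rational f -> rational g -> rational (fun X => f X - g X).
Proof. move=> hf hg; exact: (rat_add hf (rat_opp hg)). Qed.

(** The function field has no zero divisors. This dichotomy decides which branch of a formula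
    applies generically. *)
Lemma rat_dich f : rational f -> ae (fun X => f X = 0) \/ ae (fun X => f X != 0).
Proof.
move=> [a [b [q [q0 h]]]].
case: (boolP ((a != 0) || (b != 0))) => [ab|].
  right; apply: (ae2 h (ev_neq0 ab)) => X e; apply: contraNneq => e0.
  by rewrite -e e0 mul0r.
rewrite negb_or !negbK => /andP [/eqP ea /eqP eb].
left; apply: (ae2 h (ae_poly q0)) => X; rewrite ea eb /ev !horner0 mul0r addr0.
by move/eqP; rewrite mulf_eq0 => /orP [/eqP //|->].
Qed.

(** The denominator is made rational in x by the conjugate; the zero function is covered by 0^-1 =
    0. *)
Lemma rat_inv f : rational f -> rational (fun X => (f X)^-1).
Proof.
move=> rf; case: (rat_dich rf) => [z|nz].
  by apply: rat_ext (rat_const 0) _; apply: (ae1 z) => X ->; rewrite invr0.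
case: rf => [a [b [q [q0 h]]]].
have ab : nrm a b != 0.
  apply/negP => /eqP /nrm_eq0 [ea eb]; apply: ae_False.
  apply: (ae3 nz h (ae_poly q0)) => X f0; rewrite ea eb /ev !horner0 mul0r addr0.
  by move/eqP; rewrite mulf_eq0 (negPf f0) => /= ->.
exists (q * a), (- (q * b)), (nrm a b); split=> //.
apply: (ae3 nz h (ae_neq ptO)) => X f0 e hX.
have -> : ev (q * a) (- (q * b)) X = q.[px X] * ev a (- b) X by rewrite /ev !hornerE /=; ring.
by rewrite -ev_nrm // -e mulrA mulrA mulVf // mul1r.
Qed.

Lemma rat_div f g : rational f -> rational g -> rational (fun X => f X / g X).
Proof. move=> hf hg; exact: (rat_mul hf (rat_inv hg)). Qed.

Lemma rat_exp f n : rational f -> rational (fun X => f X ^+ n).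
Proof.
move=> hf; elim: n => [|n IH]; first exact: rat_const.
by apply: rat_ext (rat_mul hf IH) _; apply: aeW => X; rewrite exprS.
Qed.

Lemma rat_sum (I : Type) (r : seq I) (P : pred I) (h : I -> pt -> F) :
  (forall i, P i -> rational (h i)) -> rational (fun X => \sum_(i <- r | P i) h i X).
Proof.
move=> H; elim: r => [|i r IH].
  by apply: rat_ext (rat_const 0) _; apply: aeW => X; rewrite big_nil.
case Pi: (P i); last by apply: rat_ext IH _; apply: aeW => X; rewrite big_cons Pi.
by apply: rat_ext (rat_add (H i Pi) IH) _; apply: aeW => X; rewrite big_cons Pi.
Qed.

Lemma rat_prod (I : Type) (r : seq I) (P : pred I) (h : I -> pt -> F) :
  (forall i, P i -> rational (h i)) -> rational (fun X => \prod_(i <- r | P i) h i X).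
Proof.
move=> H; elim: r => [|i r IH].
  by apply: rat_ext (rat_const 1) _; apply: aeW => X; rewrite big_nil.
case Pi: (P i); last by apply: rat_ext IH _; apply: aeW => X; rewrite big_cons Pi.
by apply: rat_ext (rat_mul (H i Pi) IH) _; apply: aeW => X; rewrite big_cons Pi.
Qed.

Lemma rat_poly (q : {poly F}) f : rational f -> rational (fun X => q.[f X]).
Proof.
move=> hf; apply: (@rat_ext (fun X => \sum_(i < size q) q`_i * f X ^+ i)).
  by apply: rat_sum => i _; apply: rat_mul (rat_const _) (rat_exp _ hf).
by apply: aeW => X; rewrite horner_coef.
Qed.

Lemma rat_ev a b : rational (ev a b).
Proof.
exists a, b, 1; split; first exact: oner_neq0.
by apply: aeW => X; rewrite hornerE mulr1.
Qed.

End Points.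

(** * Orders of vanishing *)

Ltac szl H := apply: leq_trans H _; rewrite /=; lia.
(** The values 0 and 1 are split off because the bound on b in [regO] is a truncated predecessor. *)
Ltac szl2 H k k' := apply: leq_trans H _; case: (k) => [|[|?]]; case: (k') => [|[|?]] /=; rewrite ?addnS /=; lia.

Section Valuations.
Variables (F : closedFieldType) (c : cubic F).
Local Notation pt := (pt c).
Local Notation ptO := (ptO c).
Local Notation d := (cpoly c).
Implicit Types (X Y S T : pt) (f g h u : pt -> F) (n m : int) (v w : F).

Lemma size_mul_le (p q : {poly F}) (m n : nat) : (size p <= m)%N -> (size q <= n)%N ->
  (size (p * q)%R <= if (m == 0) || (n == 0) then 0 else (m + n).-1)%N.
Proof.
move=> hp hq; case: ifP => [/orP [] /eqP e|_].
- by move: hp; rewrite e leqn0 size_poly_eq0 => /eqP ->; rewrite mul0r size_poly0.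
- by move: hq; rewrite e leqn0 size_poly_eq0 => /eqP ->; rewrite mulr0 size_poly0.
- apply: leq_trans (size_polyMleq _ _) _; lia.
Qed.

Lemma coefM_top (p q : {poly F}) (m n : nat) : (size p <= m.+1)%N -> (size q <= n.+1)%N ->
  (p * q)`_(m + n) = p`_m * q`_n.
Proof.
move=> hp hq; rewrite coefM.
have hm : (m < (m + n).+1)%N by lia.
rewrite (bigD1 (Ordinal hm)) //= addKn big1 ?addr0 // => -[i hi] /=.
rewrite -val_eqE /= => ne; case: (ltnP m i) => h.
  by rewrite [p`_i]nth_default ?mul0r //; apply: leq_trans hp h.
by rewrite [q`_(_)]nth_default ?mulr0 //; apply: leq_trans hq _; lia.
Qed.

(* At the origin x and y have poles of order 2 and 3, so (a(x) + b(x) y) / q(x)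
   with deg q = k is regular iff deg a <= k and deg b <= k - 2, and then b does
   not contribute to the value. *)
Definition regO f v := exists (a b q : {poly F}) (k : nat),
  [/\ q`_k != 0, [/\ (size q <= k.+1)%N, (size a <= k.+1)%N & (size b <= k.-1)%N],
      ae (fun Y : pt => f Y * q.[px Y] = ev a b Y) & v = a`_k / q`_k].

(** The denominator must be allowed to involve y: at (x0, y0) with y0 != 0, the function 1 / (y +
    y0) is regular, but every denominator of it in x alone vanishes there. *)
Definition regA X f v := exists a b a' b' : {poly F},
  [/\ ev a' b' X != 0, ae (fun Y => f Y * ev a' b' Y = ev a b Y)
    & v = ev a b X / ev a' b' X].

(** Membership of f in the local ring at X, with residue v. The actual value of f at X does not
    enter, so it may be junk. *)
Definition reg X f v := if X == ptO then regO f v else regA X f v.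

Lemma reg_ext X f g v : reg X f v -> ae (fun Y => f Y = g Y) -> reg X g v.
Proof.
rewrite /reg; case: ifP => _.
  move=> [a [b [q [k [h1 h2 h3 h4]]]]] e; exists a, b, q, k; split=> //.
  by apply: (ae2 h3 e) => Y <- ->.
move=> [a [b [a' [b' [h1 h2 h3]]]]] e; exists a, b, a', b'; split=> //.
by apply: (ae2 h2 e) => Y <- ->.
Qed.

Lemma ev_neq0_val a b X : X != ptO -> ev a b X != 0 -> (a != 0) || (b != 0).
Proof.
move=> hX; apply: contraNT; rewrite negb_or !negbK => /andP [/eqP -> /eqP ->].
by rewrite /ev !horner0 mul0r addr0.
Qed.

Lemma reg_rat X f v : reg X f v -> rational f.
Proof.
rewrite /reg; case: ifP => [_|/negbT hX].
  move=> [a [b [q [k [h1 h2 h3 h4]]]]]; exists a, b, q; split=> //.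
  by apply: contraNneq h1 => ->; rewrite coef0.
move=> [a [b [a' [b' [h1 h2 h3]]]]].
apply: (rat_ext (rat_div (rat_ev c a b) (rat_ev c a' b'))).
apply: (ae2 h2 (ev_neq0 c (ev_neq0_val hX h1))) => Y e n0.
by rewrite -e mulfK.
Qed.

Lemma reg_const X k : reg X (fun=> k) k.
Proof.
rewrite /reg; case: ifP => [_|/negbT hX].
  exists k%:P, 0, 1, 0; split; rewrite ?coefC ?eqxx ?divr1 ?oner_neq0 ?size_poly1 ?size_poly0 ?size_polyC_leq1 //.
  by apply: aeW => Y; rewrite evC !hornerE.
exists k%:P, 0, 1, 0; rewrite !evC !hornerE divr1; split=> //; first exact: oner_neq0.
by apply: aeW => Y; rewrite !evC !hornerE.
Qed.

Lemma reg_add X f g v w : reg X f v -> reg X g w -> reg X (fun Y => f Y + g Y) (v + w).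
Proof.
rewrite /reg; case: ifP => [_|/negbT hX].
  move=> [a [b [q [k [h1 [sq sa sb] h3 ->]]]]] [a' [b' [q' [k' [h1' [sq' sa' sb'] h3' ->]]]]].
  exists (a * q' + a' * q), (b * q' + b' * q), (q * q'), (k + k')%N; split.
  - by rewrite coefM_top // mulf_neq0.
  - split.
    + szl (size_mul_le sq sq').
    + apply: leq_trans (size_polyD _ _) _; rewrite geq_max.
      by apply/andP; split; [szl (size_mul_le sa sq')|szl (size_mul_le sa' sq)].
    + apply: leq_trans (size_polyD _ _) _; rewrite geq_max.
      by apply/andP; split; [szl2 (size_mul_le sb sq') k k'|szl2 (size_mul_le sb' sq) k k'].
  - apply: (ae2 h3 h3') => Y e e'; rewrite evD.
    have -> : ev (a * q') (b * q') Y = ev a b Y * q'.[px Y] by rewrite /ev !hornerE /=; ring.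
    have -> : ev (a' * q) (b' * q) Y = ev a' b' Y * q.[px Y] by rewrite /ev !hornerE /=; ring.
    by rewrite -e -e' hornerM; ring.
  - have e2 : (a' * q)`_(k + k') = a'`_k' * q`_k by rewrite addnC coefM_top.
    by rewrite coefD e2 !coefM_top //; field; rewrite h1 h1'.
move=> [a [b [q [r [h1 h3 ->]]]]] [a' [b' [q' [r' [h1' h3' ->]]]]].
exists (a * q' + d * (b * r') + (a' * q + d * (b' * r))),
       (a * r' + b * q' + (a' * r + b' * q)), (q * q' + d * (r * r')), (q * r' + r * q').
split.
- by rewrite evM // mulf_neq0.
- by apply: (ae3 h3 h3' (ae_neq ptO)) => Y e e' hY; rewrite evM // evD !evM // -e -e'; ring.
- by rewrite [in RHS]evM // evD !evM //; field; rewrite h1 h1'.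
Qed.

Lemma reg_mul X f g v w : reg X f v -> reg X g w -> reg X (fun Y => f Y * g Y) (v * w).
Proof.
rewrite /reg; case: ifP => [_|/negbT hX].
  move=> [a [b [q [k [h1 [sq sa sb] h3 ->]]]]] [a' [b' [q' [k' [h1' [sq' sa' sb'] h3' ->]]]]].
  (* The degree is at most 3 + (k - 2) + (k' - 2) = k + k' - 1, so the y^2 term does not reach the
     coefficient that gives the value. *)
  have sbb : (size (d * (b * b'))%R <= k + k')%N.
    have sd : (size d <= 4)%N by rewrite cubic_size.
    by szl2 (size_mul_le sd (size_mul_le sb sb')) k k'.
  exists (a * a' + d * (b * b')), (a * b' + b * a'), (q * q'), (k + k')%N; split.
  - by rewrite coefM_top // mulf_neq0.
  - split.
    + szl (size_mul_le sq sq').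
    + apply: leq_trans (size_polyD _ _) _; rewrite geq_max.
      by apply/andP; split; [szl (size_mul_le sa sa')|apply: leq_trans sbb _].
    + apply: leq_trans (size_polyD _ _) _; rewrite geq_max.
      by apply/andP; split; [szl2 (size_mul_le sa sb') k k'|szl2 (size_mul_le sb sa') k k'].
  - apply: (ae3 h3 h3' (ae_neq ptO)) => Y e e' hY.
    by rewrite evM // -e -e' hornerM; ring.
  - have e2 : (d * (b * b'))`_(k + k') = 0 by apply: nth_default.
    by rewrite coefD e2 addr0 !coefM_top //; field; rewrite h1 h1'.
move=> [a [b [q [r [h1 h3 ->]]]]] [a' [b' [q' [r' [h1' h3' ->]]]]].
exists (a * a' + d * (b * b')), (a * b' + b * a'), (q * q' + d * (r * r')), (q * r' + r * q').
rewrite !evM //; split.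
- by rewrite mulf_neq0.
- by apply: (ae3 h3 h3' (ae_neq ptO)) => Y e e' hY; rewrite !evM // -e -e'; ring.
- by field; rewrite h1 h1'.
Qed.

Lemma reg_uniq X f v w : reg X f v -> reg X f w -> v = w.
Proof.
rewrite /reg; case: ifP => [_|/negbT hX].
  move=> [a [b [q [k [h1 [sq sa sb] h3 ->]]]]] [a' [b' [q' [k' [h1' [sq' sa' sb'] h3' ->]]]]].
  have [e _] : a * q' = a' * q /\ b * q' = b' * q.
    apply: (@ev_inj F c); apply: (ae2 h3 h3') => Y e e'.
    have -> : ev (a * q') (b * q') Y = ev a b Y * q'.[px Y] by rewrite /ev !hornerE /=; ring.
    have -> : ev (a' * q) (b' * q) Y = ev a' b' Y * q.[px Y] by rewrite /ev !hornerE /=; ring.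
    by rewrite -e -e'; ring.
  have := congr1 (fun p : {poly F} => p`_(k + k')) e.
  have e2 : (a' * q)`_(k + k') = a'`_k' * q`_k by rewrite addnC coefM_top.
  rewrite e2 coefM_top // => e'.
  by apply/eqP; rewrite eqr_div //; apply/eqP.
move=> [a [b [q [r [h1 h3 ->]]]]] [a' [b' [q' [r' [h1' h3' ->]]]]].
apply/eqP; rewrite eqr_div //.
rewrite -!evM //.
have [-> ->] : a * q' + d * (b * r') = a' * q + d * (b' * r) /\ a * r' + b * q' = a' * r + b' * q.
  apply: (@ev_inj F c); apply: (ae3 h3 h3' (ae_neq ptO)) => Y e e' hY.
  by rewrite !evM // -e -e'; ring.
by [].
Qed.

Lemma reg_neq0 X f v : reg X f v -> v != 0 -> ae (fun Y => f Y != 0).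
Proof.
move=> h v0; case: (rat_dich (reg_rat h)) => // z.
have := reg_uniq (reg_ext h z) (reg_const X 0) => e.
by rewrite e eqxx in v0.
Qed.

Lemma reg_inv X f v : reg X f v -> v != 0 -> reg X (fun Y => (f Y)^-1) v^-1.
Proof.
move=> h v0; have nz := reg_neq0 h v0; move: h v0.
rewrite /reg; case: ifP => [_|/negbT hX].
  move=> [a [b [q [k [h1 [sq sa sb] h3 ->]]]]] v0.
  have a0 : a`_k != 0 by apply: contraNneq v0 => ->; rewrite mul0r.
  have sbb : (size (d * b ^+ 2)%R <= k + k)%N.
    have sd : (size d <= 4)%N by rewrite cubic_size.
    by rewrite expr2; szl2 (size_mul_le sd (size_mul_le sb sb)) k k.
  (* The norm, which becomes the denominator of the inverse, keeps the full degree 2k. *)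
  have nk : (nrm c a b)`_(k + k) = a`_k ^+ 2.
    have e2 : (d * b ^+ 2)`_(k + k) = 0 by apply: nth_default.
    by rewrite /nrm coefB e2 subr0 expr2 coefM_top.
  exists (q * a), (- (q * b)), (nrm c a b), (k + k)%N; split.
  - by rewrite nk expf_neq0.
  - split.
    + rewrite /nrm; apply: leq_trans (size_polyD _ _) _; rewrite geq_max size_polyN expr2.
      by apply/andP; split; [szl (size_mul_le sa sa)|apply: leq_trans sbb _].
    + szl (size_mul_le sq sa).
    + by rewrite size_polyN; szl2 (size_mul_le sq sb) k k.
  - apply: (ae3 nz h3 (ae_neq ptO)) => Y f0 e hY.
    have -> : ev (q * a) (- (q * b)) Y = q.[px Y] * ev a (- b) Y by rewrite /ev !hornerE /=; ring.
    by rewrite -ev_nrm // -e mulrA mulrA mulVf // mul1r.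
  - by rewrite nk coefM_top //; field; rewrite h1 a0.
move=> [a [b [q [r [h1 h3 ->]]]]] v0.
have a0 : ev a b X != 0 by apply: contraNneq v0 => ->; rewrite mul0r.
exists q, r, a, b; split=> //; last by rewrite invf_div.
by apply: (ae2 h3 nz) => Y <- f0; rewrite mulKf.
Qed.

Lemma reg_exp X f v (k : nat) : reg X f v -> reg X (fun Y => f Y ^+ k) (v ^+ k).
Proof.
move=> h; elim: k => [|k IH]; first by rewrite expr0; apply: reg_const.
rewrite exprS; apply: reg_ext (reg_mul h IH) _; by apply: aeW => Y; rewrite exprS.
Qed.

(** Where y = 0, the curve is tangent to the vertical line and x - x(X) vanishes doubly, so y is the
    parameter there. *)
Definition tpar X : pt -> F :=
  if X == ptO then fun Y => px Y / py Y
  else if py X == 0 then @py F c else fun Y => px Y - px X.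

Lemma ae_py : ae (fun X : pt => py X != 0).
Proof.
apply: (ae2 (ae_poly c (cubic_neq0 c)) (ae_neq ptO)) => X + hX; apply: contraNneq => e.
by rewrite -py2 // e expr0n.
Qed.

Lemma ae_px : ae (fun X : pt => px X != 0).
Proof. exact: ae_px_neq. Qed.

Lemma tpar_neq0 X : ae (fun Y => tpar X Y != 0).
Proof.
rewrite /tpar; case: ifP => _.
  by apply: (ae2 ae_py ae_px) => Y h1 h2; rewrite mulf_neq0 ?invr_neq0.
case: ifP => _; first exact: ae_py.
by apply: (ae1 (ae_px_neq c (px X))) => Y; rewrite subr_eq0.
Qed.

Lemma cubic_lead : d`_3 = 1.
Proof. by have /monicP := cubic_monic c; rewrite /lead_coef cubic_size. Qed.

Lemma reg_ev X a b : X != ptO -> reg X (ev a b) (ev a b X).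
Proof.
move=> hX; rewrite /reg (negPf hX); exists a, b, 1, 0.
rewrite evC hornerE divr1 oner_neq0; split=> //.
by apply: aeW => Y; rewrite evC hornerE mulr1.
Qed.

Lemma reg_px X : X != ptO -> reg X (@px F c) (px X).
Proof.
move=> hX; have := reg_ev 'X 0 hX; rewrite evC hornerX => h.
by apply: reg_ext h _; apply: aeW => Y; rewrite evC hornerX.
Qed.

Lemma reg_py X : X != ptO -> reg X (@py F c) (py X).
Proof.
move=> hX; have := reg_ev 0 1 hX; rewrite /ev !hornerE => h.
by apply: reg_ext h _; apply: aeW => Y; rewrite !hornerE.
Qed.

Lemma reg_poly X f v (q : {poly F}) : reg X f v -> reg X (fun Y => q.[f Y]) q.[v].
Proof.
move=> h; elim/poly_ind: q => [|q k IH].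
  rewrite horner0; apply: reg_ext (reg_const X 0) _; by apply: aeW => Y; rewrite horner0.
rewrite !hornerE; apply: reg_ext (reg_add (reg_mul IH h) (reg_const X k)) _.
by apply: aeW => Y; rewrite !hornerE.
Qed.

Lemma reg_tpar X : reg X (tpar X) 0.
Proof.
rewrite /tpar; case: ifP => [hX|/negbT hX].
  (* x / y = x y / d(x), which has the shape required by [regO]. *)
  rewrite /reg hX; exists 0, 'X, d, 3%N; split.
  - by rewrite cubic_lead oner_neq0.
  - by rewrite cubic_size size_poly0 size_polyX.
  - apply: (ae2 ae_py (ae_neq ptO)) => Y y0 hY.
    by rewrite -py2 // /ev horner0 hornerX add0r; field.
  - by rewrite coef0 mul0r.
case: ifP => [/eqP e|_]; first by rewrite -e; apply: reg_py.
by rewrite -(subrr (px X)); apply: (reg_add (reg_px hX) (reg_const X (- px X))).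
Qed.

(** A relation and not a function of f: the zero function has no order. *)
Definition ord X f n := exists u v,
  [/\ reg X u v, v != 0 & ae (fun Y => f Y = tpar X Y ^ n * u Y)].

Lemma rat_tpar X : rational (tpar X).
Proof. exact: reg_rat (reg_tpar X). Qed.

Lemma rat_expz f n : rational f -> rational (fun Y => f Y ^ n).
Proof.
move=> h; case: n => n; first exact: rat_exp.
exact: (rat_inv (rat_exp n.+1 h)).
Qed.

Lemma ord_rat X f n : ord X f n -> rational f.
Proof.
move=> [u [v [hu v0 e]]].
apply: (rat_ext (rat_mul (rat_expz n (rat_tpar X)) (reg_rat hu))).
by apply: (ae1 e).
Qed.

Lemma ord_neq0 X f n : ord X f n -> ae (fun Y => f Y != 0).
Proof.
move=> [u [v [hu v0 e]]]; apply: (ae3 e (reg_neq0 hu v0) (tpar_neq0 X)) => Y -> u0 t0.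
by rewrite mulf_neq0 ?expfz_neq0.
Qed.

Lemma ord_ext X f g n : ord X f n -> ae (fun Y => f Y = g Y) -> ord X g n.
Proof.
move=> [u [v [hu v0 e]]] eg; exists u, v; split=> //.
by apply: (ae2 e eg) => Y <- ->.
Qed.

Lemma reg_tparX X (k : nat) : (0 < k)%N -> reg X (fun Y => tpar X Y ^+ k) 0.
Proof. by move=> k0; have := reg_exp k (reg_tpar X); rewrite expr0n; case: k k0. Qed.

(** If n < m, the unit of the first factorisation would be t^(m - n) times a regular function, hence
    would have value 0. *)
Lemma ord_uniq X f n m : ord X f n -> ord X f m -> n = m.
Proof.
wlog: n m / n <= m => [H h1 h2|nm].
  by case: (leP n m) => [|/ltW] h; [|symmetry]; apply: H.
move=> [u [v [hu v0 e]]] [u' [v' [hu' v0' e']]].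
apply/eqP; move: nm; rewrite le_eqVlt => /orP [//|nm]; exfalso.
pose k := `|m - n|%N; have k0 : (0 < k)%N by rewrite /k; lia.
have hk : m = n + k by rewrite /k; lia.
have := reg_ext (reg_mul (reg_tparX X k0) hu') _.
rewrite mul0r => /(_ u); have ee : ae (fun Y => tpar X Y ^+ k * u' Y = u Y).
  apply: (ae3 e e' (tpar_neq0 X)) => Y -> + t0; rewrite hk expfzDr // -mulrA.
  by move/(mulfI (expfz_neq0 _ t0)) => ->.
move/(_ ee)/(reg_uniq hu) => z; by rewrite z eqxx in v0.
Qed.

Lemma ord_mul X f g n m : ord X f n -> ord X g m -> ord X (fun Y => f Y * g Y) (n + m).
Proof.
move=> [u [v [hu v0 e]]] [u' [v' [hu' v0' e']]].
exists (fun Y => u Y * u' Y), (v * v'); split; [exact: reg_mul|exact: mulf_neq0|].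
by apply: (ae3 e e' (tpar_neq0 X)) => Y -> -> t0; rewrite expfzDr //; ring.
Qed.

Lemma ord_inv X f n : ord X f n -> ord X (fun Y => (f Y)^-1) (- n).
Proof.
move=> [u [v [hu v0 e]]].
exists (fun Y => (u Y)^-1), v^-1; split; [exact: reg_inv|exact: invr_neq0|].
by apply: (ae1 e) => Y ->; rewrite invfM invr_expz.
Qed.

Lemma ord_div X f g n m : ord X f n -> ord X g m -> ord X (fun Y => f Y / g Y) (n - m).
Proof. move=> h1 h2; exact: (ord_mul h1 (ord_inv h2)). Qed.

Lemma reg_ord0 X f v : reg X f v -> v != 0 -> ord X f 0.
Proof.
move=> h v0; exists f, v; split=> //; by apply: aeW => Y; rewrite expr0z mul1r.
Qed.

Lemma ord_const X k : k != 0 -> ord X (fun=> k) 0.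
Proof. exact: reg_ord0 (reg_const X k). Qed.

Lemma ord_exp X f n (k : nat) : ord X f n -> ord X (fun Y => f Y ^+ k) (n * k).
Proof.
move=> h; elim: k => [|k IH]; first by rewrite mulr0; apply: ord_const; apply: oner_neq0.
have -> : n * k.+1 = n + n * k by lia.
apply: ord_ext (ord_mul h IH) _; by apply: aeW => Y; rewrite exprS.
Qed.

Lemma ord_expz X f n m : ord X f n -> ord X (fun Y => f Y ^ m) (n * m).
Proof.
case: m => k h; first exact: ord_exp.
have -> : n * Negz k = - (n * k.+1) by lia.
exact: ord_inv (ord_exp _ h).
Qed.

Lemma ord_tpar X : ord X (tpar X) 1.
Proof.
exists (fun=> 1), 1; split; [exact: reg_const|exact: oner_neq0|].
by apply: aeW => Y; rewrite mulr1 expr1z.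
Qed.

Lemma ord_opp X f n : ord X f n -> ord X (fun Y => - f Y) n.
Proof.
move=> h; have m1 : (-1 : F) != 0 by rewrite oppr_eq0 oner_neq0.
have := ord_mul (ord_const X m1) h; rewrite add0r => h'.
by apply: ord_ext h' _; apply: aeW => Y; rewrite mulN1r.
Qed.

Lemma ord_reg X f n : 0 <= n -> ord X f n -> exists v, reg X f v /\ (0 < n -> v = 0).
Proof.
move=> n0 [u [v [hu v0 e]]].
have := reg_mul (reg_exp `|n|%N (reg_tpar X)) hu => h.
have en : n = `|n|%N :> int by lia.
exists (0 ^+ `|n|%N * v); split.
  by apply: reg_ext h _; apply: (ae1 e) => Y ->; rewrite {2}en.
by move=> n1; rewrite expr0n; case: eqP => [|_]; [lia|rewrite mul0r].
Qed.

Lemma ord_add_lt X f g n m : ord X f n -> ord X g m -> n < m ->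
  ord X (fun Y => f Y + g Y) n.
Proof.
move=> [u [v [hu v0 e]]] [u' [v' [hu' v0' e']]] nm.
pose k := `|m - n|%N; have k0 : (0 < k)%N by rewrite /k; lia.
have hk : m = n + k by rewrite /k; lia.
exists (fun Y => u Y + tpar X Y ^+ k * u' Y), (v + 0 * v'); split.
- exact: reg_add hu (reg_mul (reg_tparX X k0) hu').
- by rewrite mul0r addr0.
- by apply: (ae3 e e' (tpar_neq0 X)) => Y -> -> t0; rewrite hk expfzDr // -exprnP; ring.
Qed.

Lemma ord_add_neq X f g n m : ord X f n -> ord X g m -> n != m ->
  exists k, [/\ ord X (fun Y => f Y + g Y) k, k <= n, k <= m & (k == n) || (k == m)].
Proof.
move=> hf hg; rewrite neq_lt => /orP [] h.
  by exists n; split; rewrite ?eqxx ?lexx ?(ltW h) //; apply: ord_add_lt hf hg h.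
exists m; split; rewrite ?eqxx ?lexx ?orbT ?(ltW h) //.
by apply: ord_ext (ord_add_lt hg hf h) _; apply: aeW => Y; rewrite addrC.
Qed.

Lemma cubic_simple_root x : c.[x] = 0 ->
  exists2 q : {poly F}, d = q * ('X - x%:P) & q.[x] != 0.
Proof.
move=> hx; have rx : root d x by apply/rootP.
have /factor_theorem [q e] := rx; exists q => //.
have := coprimep_root (cubic_sep c) rx.
by rewrite e derivM derivXsubC !hornerE subrr mulr0 add0r.
Qed.

(** The ramification index at an affine point of the double cover given by x; its predecessor is the
    order of y. *)
Definition xord X : nat := if py X == 0 then 2 else 1.

(** Where y = 0, separability gives d = q(x) (x - x0) with q(x0) != 0, so x - x0 is y^2 times a
    unit. *)
Lemma ord_pxsub X : X != ptO -> ord X (fun Y => px Y - px X) (xord X).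
Proof.
move=> hX; rewrite /xord; case: ifP => [/eqP e|ne]; last first.
  by have := ord_tpar X; rewrite /tpar (negPf hX) ne.
have [q dE qx] : exists2 q : {poly F}, d = q * ('X - (px X)%:P) & q.[px X] != 0.
  by apply: cubic_simple_root; rewrite -py2 // e expr0n.
have ht : ord X (@py F c) 1 by have := ord_tpar X; rewrite /tpar (negPf hX) e eqxx.
have := ord_div (ord_exp 2 ht) (reg_ord0 (reg_poly q (reg_px hX)) qx).
rewrite mul1r subr0 => h; apply: ord_ext h _.
have q0 : q != 0 by apply: contraNneq qx => ->; rewrite horner0.
apply: (ae2 (ae_poly c q0) (ae_neq ptO)) => Y qY hY.
by rewrite py2 // dE !hornerE mulrC mulKf.
Qed.

Lemma ord_py X : X != ptO -> ord X (@py F c) (xord X).-1.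
Proof.
move=> hX; rewrite /xord; case: ifP => [/eqP e|/negbT ne]; last first.
  exact: reg_ord0 (reg_py hX) ne.
by have := ord_tpar X; rewrite /tpar (negPf hX) e eqxx.
Qed.

Lemma ord_polyA X (a : {poly F}) : X != ptO -> a != 0 ->
  exists k : nat, ord X (fun Y => a.[px Y]) (k * xord X)%N.
Proof.
move=> hX a0; have [k [q]] := multiplicity_XsubC a (px X).
rewrite a0 /= -/(root _ _) => nr aE; exists k.
have := ord_mul (reg_ord0 (reg_poly q (reg_px hX)) nr) (ord_exp k (ord_pxsub hX)).
have -> : 0 + (xord X)%:Z * k%:Z = (k * xord X)%N by lia.
move/ord_ext; apply; apply: aeW => Y.
by rewrite aE !(hornerE, horner_exp).
Qed.

Lemma ordO_px : ord ptO (@px F c) (-2).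
Proof.
have r : reg ptO (fun Y : pt => px Y * tpar ptO Y ^+ 2) 1.
  (* x (x / y)^2 = x^3 / d(x), whose value at the origin is the quotient of two leading coefficients
     1. *)
  rewrite /reg eqxx; exists ('X^3), 0, d, 3%N; split.
  - by rewrite cubic_lead oner_neq0.
  - by rewrite cubic_size size_poly0 size_polyXn.
  - apply: (ae2 ae_py (ae_neq ptO)) => Y y0 hY.
    have -> : tpar ptO Y = px Y / py Y by rewrite /tpar eqxx.
    rewrite -py2 // evC hornerXn; by field.
  - by rewrite coefXn cubic_lead divr1.
have := ord_mul (reg_ord0 r (oner_neq0 _)) (ord_expz (-2) (ord_tpar ptO)).
rewrite add0r mul1r => h; apply: ord_ext h _.
apply: (ae1 (tpar_neq0 ptO)) => Y t0; by rewrite -exprnN mulfK // expf_neq0.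
Qed.

Lemma ordO_py : ord ptO (@py F c) (-3).
Proof.
have := ord_mul ordO_px (ord_inv (ord_tpar ptO)); move/ord_ext; apply.
apply: (ae2 ae_py ae_px) => Y y0 x0; rewrite /tpar eqxx; by field; rewrite x0 y0.
Qed.

Lemma ordO_poly (a : {poly F}) : a != 0 ->
  ord ptO (fun Y : pt => a.[px Y]) (- ((size a).-1 * 2)%N%:Z).
Proof.
elim/poly_ind: a => [|a k IH]; first by rewrite eqxx.
have [->|a0] := eqVneq a 0.
  rewrite mul0r add0r polyC_eq0 => k0; rewrite size_polyC k0 /=.
  apply: ord_ext (ord_const ptO k0) _; by apply: aeW => Y; rewrite hornerC.
move=> _; have sE : size (a * 'X + k%:P) = (size a).+1.
  by rewrite size_MXaddC (negPf a0).
rewrite sE /=.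
have h := ord_mul (IH a0) ordO_px.
have sa : (0 < size a)%N by rewrite size_poly_gt0.
have -> : - ((size a) * 2)%N%:Z = - ((size a).-1 * 2)%N%:Z - 2 by lia.
have [k0|k0] := eqVneq k 0.
  by apply: ord_ext h _; apply: aeW => Y; rewrite k0 !hornerE.
have := ord_add_lt h (ord_const ptO k0); move=> h'.
have lt0 : - ((size a).-1 * 2)%N%:Z - 2 < 0 :> int by lia.
by apply: ord_ext (h' lt0) _; apply: aeW => Y; rewrite !hornerE.
Qed.

(** If a(x) and b(x) y have different orders, the smaller one wins. At the origin and where y = 0
    they always differ, by parity. At the remaining points a common power of x - x0 is removed,
    after which the conjugate is a unit if the function itself is not, and the norm gives the
    order. *)
Lemma ord_ev_ex X (a b : {poly F}) : (a != 0) || (b != 0) -> exists n, ord X (ev a b) n.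
Proof.
move=> ab.
have ha : a != 0 -> exists k : int, ord X (fun Y => a.[px Y]) k /\
    ((X == ptO) || (py X == 0) -> exists j : int, k = j * 2).
  move=> a0; have [e|hX] := eqVneq X ptO.
    rewrite e; exists (- ((size a).-1 * 2)%N%:Z); split; first exact: ordO_poly.
    by move=> _; exists (- ((size a).-1)%:Z); lia.
  have [k h] := ord_polyA hX a0; exists (k * xord X)%N; split=> //=.
  by rewrite /xord => ->; exists k; lia.
have hb : b != 0 -> exists k : int, ord X (fun Y => b.[px Y] * py Y) k /\
    ((X == ptO) || (py X == 0) -> exists j : int, k = j * 2 + 1).
  move=> b0; have [e|hX] := eqVneq X ptO.
    rewrite e; exists (- ((size b).-1 * 2)%N%:Z - 3); split.
      exact: ord_mul (ordO_poly b0) ordO_py.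
    by move=> _; exists (- ((size b).-1)%:Z - 2); lia.
  have [k h] := ord_polyA hX b0; exists ((k * xord X)%N%:Z + (xord X).-1); split.
    exact: ord_mul h (ord_py hX).
  by rewrite /= /xord => ->; exists k; lia.
have [a0|a0] := eqVneq a 0.
  rewrite a0 eqxx /= in ab; have [k [h _]] := hb ab; exists k.
  by apply: ord_ext h _; apply: aeW => Y; rewrite /ev a0 horner0 add0r.
have [b0|b0] := eqVneq b 0.
  have [k [h _]] := ha a0; exists k.
  by apply: ord_ext h _; apply: aeW => Y; rewrite b0 evC.
have [k [hk ek]] := ha a0; have [l [hl el]] := hb b0.
have [kl|kl] := eqVneq k l; last first.
  by have [n [h _ _ _]] := ord_add_neq hk hl kl; exists n.
case: (boolP ((X == ptO) || (py X == 0))) => [h|].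
  have [i ei] := ek h; have [j ej] := el h; exfalso; lia.
rewrite negb_or => /andP [hX y0].
(* Here x - x0 is a parameter and y a unit, so equal orders mean equal multiplicities of x0 in a and
   b. *)
have [i [q]] := multiplicity_XsubC a (px X); rewrite a0 /= => ra aE.
have [j [r]] := multiplicity_XsubC b (px X); rewrite b0 /= => rb bE.
have px1 := ord_pxsub hX; rewrite /xord (negPf y0) in px1.
have oi : ord X (fun Y => (px Y - px X) ^+ i) i.
  by have := ord_exp i px1; rewrite mul1r.
have oj : ord X (fun Y => (px Y - px X) ^+ j) j.
  by have := ord_exp j px1; rewrite mul1r.
have ij : i = j.
  have h1 : ord X (fun Y => a.[px Y]) i.
    have := ord_mul (reg_ord0 (reg_poly q (reg_px hX)) ra) oi; rewrite add0r.
    move/ord_ext; apply; apply: aeW => Y; by rewrite aE !(hornerE, horner_exp).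
  have h2 : ord X (fun Y => b.[px Y] * py Y) j.
    have := ord_mul (ord_mul (reg_ord0 (reg_poly r (reg_px hX)) rb) oj) (reg_ord0 (reg_py hX) y0).
    rewrite add0r addr0.
    move/ord_ext; apply; apply: aeW => Y; by rewrite bE !(hornerE, horner_exp).
  have := ord_uniq h1 hk; have := ord_uniq h2 hl; lia.
have evE Y : ev a b Y = (px Y - px X) ^+ i * ev q r Y.
  rewrite /ev aE bE -ij !(hornerE, horner_exp) /=; ring.
suff [n hn] : exists n, ord X (ev q r) n.
  by exists (i%:Z + n); apply: ord_ext (ord_mul oi hn) _; apply: aeW => Y; rewrite evE.
have [z|nz] := eqVneq (ev q r X) 0; last first.
  by exists 0; apply: reg_ord0 nz; apply: reg_ev.
(* The two conjugate values add up to 2 q(x0), which is not zero. *)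
have nz : ev q (- r) X != 0.
  apply/eqP => z'; move: ra; rewrite rootE => /eqP []; apply: (mulfI (two_neq0 c)).
  rewrite mulr0 -[RHS](addr0 0) -{1}z -z' /ev !hornerE /=; ring.
have n0 : nrm c q r != 0.
  apply/eqP => /nrm_eq0 [q0 _]; move: ra; by rewrite q0 root0.
have [k' hk'] := ord_polyA hX n0.
have := ord_div hk' (reg_ord0 (reg_ev q (- r) hX) nz) => h.
exists ((k' * xord X)%N%:Z - 0); apply: ord_ext h _.
apply: (ae2 (ev_neq0 c (ev_neq0_val hX nz)) (ae_neq ptO)) => Y e hY.
by rewrite -ev_nrm // mulfK.
Qed.

Lemma ord_ex X f : rational f -> ae (fun Y => f Y != 0) -> exists n, ord X f n.
Proof.
move=> [a [b [q [q0 h]]]] nz.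
have ab : (a != 0) || (b != 0).
  apply/negP => /negP; rewrite negb_or !negbK => /andP [/eqP ea /eqP eb].
  apply: ae_False; apply: (ae3 nz h (ae_poly c q0)) => Y f0; rewrite ea eb /ev !horner0 mul0r addr0.
  by move/eqP; rewrite mulf_eq0 (negPf f0) => /= ->.
have [n hn] := ord_ev_ex X ab.
have [m hm] : exists m, ord X (fun Y => q.[px Y]) m.
  have [|m hm] := @ord_ev_ex X q 0; first by rewrite q0.
  by exists m; apply: ord_ext hm _; apply: aeW => Y; rewrite evC.
exists (n - m); apply: ord_ext (ord_div hn hm) _.
by apply: (ae2 h (ae_poly c q0)) => Y <- q1; rewrite mulfK.
Qed.

Definition ordge X f n := ae (fun Y => f Y = 0) \/ exists2 m, n <= m & ord X f m.

Lemma ordge_ord X f n m : ordge X f n -> ord X f m -> n <= m.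
Proof.
case=> [z h|[k nk hk] h].
  exfalso; apply: ae_False; apply: (ae2 z (ord_neq0 h)) => Y ->; by rewrite eqxx.
by rewrite (ord_uniq h hk).
Qed.

Lemma ord_ordge X f n m : ord X f m -> n <= m -> ordge X f n.
Proof. by move=> h nm; right; exists m. Qed.

Lemma ordge_le X f n m : n <= m -> ordge X f m -> ordge X f n.
Proof. by move=> nm [z|[k mk h]]; [left|right; exists k => //; apply: le_trans nm mk]. Qed.

Lemma ordge_ext X f g n : ordge X f n -> ae (fun Y => f Y = g Y) -> ordge X g n.
Proof.
case=> [z|[m nm h]] e; [left|right; exists m => //; exact: ord_ext h e].
by apply: (ae2 z e) => Y -> <-.
Qed.

Lemma ordge_rat X f n : ordge X f n -> rational f.
Proof.
case=> [z|[m _ h]]; last exact: ord_rat h.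
by apply: rat_ext (rat_const c 0) _; apply: (ae1 z) => Y ->.
Qed.

Lemma rat_ordge X f n : rational f -> (forall m, ord X f m -> n <= m) -> ordge X f n.
Proof.
move=> rf H; case: (rat_dich rf) => [z|nz]; [by left|right].
by have [m hm] := ord_ex X rf nz; exists m => //; apply: H.
Qed.

Lemma reg_ordge0 X f v : reg X f v -> ordge X f 0.
Proof.
move=> h; apply: rat_ordge (reg_rat h) _ => m hm.
rewrite leNgt; apply/negP => m0.
have [u [w [hu w0 e]]] := hm.
have k0 : (0 < `|m|)%N by lia.
have := reg_mul (reg_tparX X k0) h; rewrite mul0r => h'.
have e0 : ae (fun Y => tpar X Y ^+ `|m|%N * f Y = u Y).
  apply: (ae2 e (tpar_neq0 X)) => Y -> t0.
  have -> : m = - (`|m|%N : int) by lia.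
  by rewrite -exprnN abszN absz_nat mulrA mulfV ?mul1r // expf_neq0.
by move: (reg_uniq hu (reg_ext h' e0)) w0 => ->; rewrite eqxx.
Qed.

Lemma reg_ordge1 X f : reg X f 0 -> ordge X f 1.
Proof.
move=> h; apply: rat_ordge (reg_rat h) _ => m hm.
have m0 := ordge_ord (reg_ordge0 h) hm.
rewrite -gtz0_ge1 lt_neqAle m0 andbT; apply/eqP => e.
rewrite -e in hm; have [u [v [hu v0 eu]]] := hm.
have := reg_ext hu; move/(_ f) => H.
have /H h' : ae (fun Y => u Y = f Y) by apply: (ae1 eu) => Y ->; rewrite expr0z mul1r.
by move: (reg_uniq h h') v0 => <-; rewrite eqxx.
Qed.

Lemma ordge_reg X f n : 0 <= n -> ordge X f n -> exists v, reg X f v /\ (0 < n -> v = 0).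
Proof.
move=> n0 [z|[m nm h]].
  exists 0; split=> //; apply: reg_ext (reg_const X 0) _; by apply: (ae1 z) => Y ->.
have [v [hv H]] := ord_reg (le_trans n0 nm) h; exists v; split=> // n1.
by apply: H; apply: lt_le_trans nm.
Qed.

Lemma ordge_mul X f g n m : ordge X f n -> ordge X g m ->
  ordge X (fun Y => f Y * g Y) (n + m).
Proof.
move=> [z|[k nk hk]]; first by left; apply: (ae1 z) => Y ->; rewrite mul0r.
move=> [z|[l ml hl]]; first by left; apply: (ae1 z) => Y ->; rewrite mulr0.
by apply: ord_ordge (ord_mul hk hl) _; apply: lerD.
Qed.

(** Reduces sums to bound 0, where closure under addition is that of the local ring. *)
Lemma ordge_shift X f n :
  ordge X f n <-> ordge X (fun Y => f Y * tpar X Y ^ (- n)) 0.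
Proof.
have ht k := ord_expz k (ord_tpar X).
split=> h.
  have := ordge_mul h (ord_ordge (ht (- n)) (lexx _)).
  by rewrite mul1r subrr.
have := ordge_mul h (ord_ordge (ht n) (lexx _)).
rewrite add0r mul1r => h'; apply: ordge_ext h' _.
by apply: (ae1 (tpar_neq0 X)) => Y t0; rewrite -mulrA -expfzDr // addNr expr0z mulr1.
Qed.

Lemma ordge_add X f g n : ordge X f n -> ordge X g n -> ordge X (fun Y => f Y + g Y) n.
Proof.
move=> /ordge_shift hf /ordge_shift hg; apply/ordge_shift.
have [v [hv _]] := ordge_reg (lexx 0) hf.
have [w [hw _]] := ordge_reg (lexx 0) hg.
apply: ordge_ext (reg_ordge0 (reg_add hv hw)) _; by apply: aeW => Y; rewrite mulrDl.
Qed.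

Lemma ordge_const X k : ordge X (fun=> k) 0.
Proof. exact: reg_ordge0 (reg_const X k). Qed.

Lemma ordge_opp X f n : ordge X f n -> ordge X (fun Y => - f Y) n.
Proof.
case=> [z|[m nm h]]; first by left; apply: (ae1 z) => Y ->; rewrite oppr0.
by apply: ord_ordge (ord_opp h) nm.
Qed.

Lemma ordge_residue X f : ordge X f 0 -> exists v, ordge X (fun Y => f Y - v) 1.
Proof.
move=> h; have [v [hv _]] := ordge_reg (lexx 0) h; exists v.
apply: reg_ordge1; rewrite -(subrr v); exact: reg_add hv (reg_const X (- v)).
Qed.

End Valuations.

(** * The group law *)

Section GroupLaw.
Variables (F : closedFieldType) (c : cubic F).
Local Notation pt := (pt c).
Local Notation ptO := (ptO c).
Local Notation d := (cpoly c).
Implicit Types (X Y S T U : pt) (f g h u : pt -> F) (n m : int) (v w : F).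

Lemma opp_on X : on_cubic c (omap (fun xy => (xy.1, - xy.2)) (pval X)).
Proof. by case: X => [[[x y]|] H] //=; rewrite sqrrN. Qed.

Definition popp X : pt := Pt (opp_on X).

Lemma popp_px X : px (popp X) = px X.
Proof. by case: X => [[[x y]|] H]. Qed.

Lemma popp_py X : py (popp X) = - py X.
Proof. by case: X => [[[x y]|] H] //=; rewrite /py /= oppr0. Qed.

Lemma popp_O : popp ptO = ptO. Proof. exact: val_inj. Qed.

Lemma poppK : involutive popp.
Proof. by case=> [[[x y]|] H]; apply: val_inj; rewrite //= opprK. Qed.

Lemma popp_neqO X : (popp X != ptO) = (X != ptO).
Proof. by rewrite -{1}popp_O (inj_eq (can_inj poppK)). Qed.

Lemma px_eq X Y : X != ptO -> Y != ptO -> px X = px Y -> X = Y \/ X = popp Y.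
Proof.
move=> hX hY e; have: (py X - py Y) * (py X + py Y) = 0.
  by rewrite -subr_sqr !py2 // e subrr.
move/eqP; rewrite mulf_eq0 subr_eq0 addr_eq0 => /orP [] /eqP ey; [left|right];
  by apply: pt_eqP; rewrite ?popp_neqO ?popp_px ?popp_py.
Qed.

Lemma ordge_sub X f g n : ordge X f n -> ordge X g n -> ordge X (fun Y => f Y - g Y) n.
Proof. by move=> hf hg; apply: (ordge_add hf (ordge_opp hg)). Qed.

(** The coordinate ring F[x] + F[x] y is integrally closed. At a root x0 of the denominator the
    numerator a + b y vanishes at both points above x0, which forces a(x0) = b(x0) = 0; so x - x0
    cancels and the degree of the denominator drops. *)
Lemma pol_of_regular f : rational f -> (forall X, X != ptO -> ordge X f 0) ->
  exists a b, ae (fun X => f X = ev a b X).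
Proof.
move=> [a [b [q [q0 h]]]] H.
have [k] := ubnP (size q); elim: k a b q q0 h => // k IH a b q q0 h sq.
have [s1|/closed_rootP [x rx]] := eqVneq (size q) 1%N.
  have /size_poly1P [z z0 qE] : size q == 1%N by rewrite s1.
  exists (z^-1%:P * a), (z^-1%:P * b); apply: (ae1 h) => X.
  rewrite qE hornerC => e; rewrite /ev !hornerE -mulrA -mulrDr.
  by move: e; rewrite /ev => <-; rewrite mulrC mulfK.
have [q' qE] := factor_theorem _ _ rx.
have q'0 : q' != 0 by apply: contraNneq q0 => e; rewrite qE e mul0r.
have ordq X : X != ptO -> px X = x -> ordge X (fun Y => q.[px Y]) (xord X).
  move=> hX ex; have h1 := reg_ordge0 (reg_poly q' (reg_px hX)).
  have := ordge_mul h1 (ord_ordge (ord_pxsub hX) (lexx _)); rewrite add0r => h2.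
  by apply: ordge_ext h2 _; apply: aeW => Y; rewrite qE !hornerE ex.
have ord_fq X : X != ptO -> px X = x -> ordge X (ev a b) (xord X).
  move=> hX ex; have := ordge_mul (H X hX) (ordq X hX ex); rewrite add0r => h2.
  by apply: ordge_ext h2 _; apply: (ae1 h).
have ev0 X : X != ptO -> px X = x -> ev a b X = 0.
  move=> hX ex; have [|v [hv v0]] := ordge_reg _ (ord_fq X hX ex); first by [].
  rewrite (reg_uniq (reg_ev a b hX) hv) v0 // /xord; by case: ifP.
have [X hX ex] := pt_exists c x.
have e1 := ev0 X hX ex.
have e2 : ev a b (popp X) = 0 by rewrite ev0 ?popp_neqO ?popp_px.
rewrite /ev popp_px popp_py ex in e1 e2.
have ax : a.[x] = 0.
  apply: (mulfI (two_neq0 c)); rewrite mulr0 -[RHS](addr0 0) -{1}e1 -e2; ring.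
have /factor_theorem [a' aE] : root a x by apply/rootP.
have bx : b.[x] = 0.
  have [y0|y0] := eqVneq (py X) 0; last first.
    by apply: (mulIf y0); rewrite mul0r; move: e1; rewrite ax add0r.
  (* With y = 0 at X, the numerator and a(x) vanish to order 2, while b(x) y would have order
     exactly 1. *)
  apply/eqP; apply: contraT => bx.
  have o1 : ord X (fun Y => b.[px Y] * py Y) 1.
    have bX : b.[px X] != 0 by rewrite ex.
    have := ord_mul (reg_ord0 (reg_poly b (reg_px hX)) bX) (ord_py hX).
    by rewrite /xord y0 eqxx.
  have o2 : ordge X (fun Y => a.[px Y]) 2.
    have h1 := reg_ordge0 (reg_poly a' (reg_px hX)).
    have := ordge_mul h1 (ord_ordge (ord_pxsub hX) (lexx _)); rewrite add0r => h2.
    have := ordge_ext h2; rewrite /xord y0 eqxx; apply.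
    by apply: aeW => Y; rewrite aE !hornerE ex.
  have o3 := ord_fq X hX ex; rewrite /xord y0 eqxx in o3.
  have := ordge_ord (ordge_ext (ordge_sub o3 o2) _) o1; apply.
  by apply: aeW => Y; rewrite /ev; ring.
have /factor_theorem [b' bE] : root b x by apply/rootP.
apply: (IH a' b' q') => //.
  apply: (ae2 h (ae_px_neq c x)) => Y.
  rewrite /ev qE aE bE !hornerE /= -subr_eq0 => e nx; apply: (mulIf nx).
  by rewrite e; ring.
by move: sq; rewrite qE size_Mmonic ?monicXsubC // size_XsubC addn2 /=; lia.
Qed.

(** The pole orders 2 deg a and 2 deg b + 3 have different parity, so no cancellation occurs between
    the two terms. *)
Lemma ordO_ev_le (a b : {poly F}) (k : nat) : ordge ptO (ev a b) (- k%:Z) ->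
  (a != 0 -> (2 * (size a).-1 <= k)%N) /\ (b != 0 -> (2 * (size b).-1 + 3 <= k)%N).
Proof.
move=> h.
have ha : a != 0 -> ord ptO (fun Y : pt => a.[px Y]) (- ((size a).-1 * 2)%N%:Z) := @ordO_poly _ _ a.
have hb : b != 0 -> ord ptO (fun Y : pt => b.[px Y] * py Y) (- ((size b).-1 * 2)%N%:Z - 3).
  move=> b0; exact: ord_mul (ordO_poly c b0) (ordO_py c).
have [a0|a0] := eqVneq a 0.
  split=> // b0; have := ordge_ord (ordge_ext h _) (hb b0); rewrite a0 => H.
  have : - k%:Z <= - ((size b).-1 * 2)%N%:Z - 3.
    by apply: H; apply: aeW => Y; rewrite /ev horner0 add0r.
  lia.
have [b0|b0] := eqVneq b 0.
  split=> // _; have := ordge_ord (ordge_ext h _) (ha a0); rewrite b0 => H.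
  have : - k%:Z <= - ((size a).-1 * 2)%N%:Z.
    by apply: H; apply: aeW => Y; rewrite evC.
  lia.
have [|l [hl l1 l2 _]] := ord_add_neq (ha a0) (hb b0); first by lia.
have := ordge_ord h hl; split=> _; lia.
Qed.

Lemma const_of_regular f : rational f -> (forall X, ordge X f 0) -> exists k, ae (fun X => f X = k).
Proof.
move=> rf H; have [a [b e]] := pol_of_regular rf (fun X _ => H X).
have [|ha hb] := @ordO_ev_le a b 0; first exact: ordge_ext (H ptO) e.
have b0 : b = 0 by apply/eqP; apply: contraT => /hb; lia.
have sa : (size a <= 1)%N.
  by have [->|/ha] := eqVneq a 0; [rewrite size_poly0|lia].
exists a`_0; apply: (ae1 e) => X ->.
by rewrite b0 evC {1}(size1_polyC sa) hornerC.
Qed.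

Lemma const_of_ord0 f : (forall X, ord X f 0) -> exists2 k, k != 0 & ae (fun X => f X = k).
Proof.
move=> H; have [k e] := const_of_regular (ord_rat (H ptO)) (fun X => ord_ordge (H X) (lexx 0)).
exists k => //; apply/eqP => k0; apply: ae_False.
by apply: (ae2 e (ord_neq0 (H ptO))) => X ->; rewrite k0 eqxx.
Qed.

Definition slope (x1 y1 x2 y2 : F) : F :=
  if x1 == x2 then (3 * x1 ^+ 2 + 2 * d`_2 * x1 + d`_1) / (2 * y1)
  else (y2 - y1) / (x2 - x1).

Definition third (x1 y1 x2 y2 : F) : F := slope x1 y1 x2 y2 ^+ 2 - d`_2 - x1 - x2.

Definition add_val (P Q : option (F * F)) : option (F * F) :=
  match P, Q with
  | None, _ => Q
  | _, None => P
  | Some (x1, y1), Some (x2, y2) =>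
    if (x1 == x2) && (y1 + y2 == 0) then None else
    Some (third x1 y1 x2 y2,
          - (y1 + slope x1 y1 x2 y2 * (third x1 y1 x2 y2 - x1)))
  end.

Section Line.
Variables (x1 y1 x2 y2 : F).
Hypotheses (h1 : y1 ^+ 2 = c.[x1]) (h2 : y2 ^+ 2 = c.[x2]).
Hypothesis ne : ~~ ((x1 == x2) && (y1 + y2 == 0)).
Local Notation l := (slope x1 y1 x2 y2).
Local Notation x3 := (third x1 y1 x2 y2).

(** The second equation is what remains of [line_eq] once both sides are expanded at x1: the linear
    coefficients agree. Free of division, it serves chord and tangent alike. *)
Lemma slopeP : y2 = y1 + l * (x2 - x1) /\
  3 * x1 ^+ 2 + 2 * d`_2 * x1 + d`_1 - 2 * y1 * l
    = (x2 - x1) * (l ^+ 2 - d`_2 - 2 * x1 - x2).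
Proof.
rewrite /slope; case: eqVneq => [e|nx].
  have ne' : y1 + y2 != 0 by move: ne; rewrite e eqxx.
  have ey : y1 = y2.
    have: (y1 - y2) * (y1 + y2) = 0 by rewrite -subr_sqr h1 h2 e subrr.
    by move/eqP; rewrite mulf_eq0 (negPf ne') orbF subr_eq0 => /eqP.
  have y0 : 2 * y1 != 0 by move: ne'; rewrite -ey -mulr2n mulr_natl.
  rewrite -e subrr mul0r mulr0 addr0 -ey; split=> //.
  by rewrite [X in _ - X]mulrCA mulfV // mulr1 subrr.
have w0 : x2 - x1 != 0 by rewrite subr_eq0 eq_sym.
split; first by field.
set m := (y2 - y1) / (x2 - x1).
have ey : y2 = y1 + m * (x2 - x1) by rewrite /m; field.
have : y2 ^+ 2 - y1 ^+ 2 = c.[x2] - c.[x1] by rewrite h1 h2.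
rewrite {1}ey !cubicE => e; apply: (mulfI w0); apply/eqP; rewrite -subr_eq0.
have -> : (x2 - x1) * (3 * x1 ^+ 2 + 2 * d`_2 * x1 + d`_1 - 2 * y1 * m) -
  (x2 - x1) * ((x2 - x1) * (m ^+ 2 - d`_2 - 2 * x1 - x2)) =
  (x2 ^+ 3 + d`_2 * x2 ^+ 2 + d`_1 * x2 + d`_0 - (x1 ^+ 3 + d`_2 * x1 ^+ 2 + d`_1 * x1 + d`_0))
   - ((y1 + m * (x2 - x1)) ^+ 2 - y1 ^+ 2) by ring.
by rewrite e subrr.
Qed.

Lemma line_eq z : c.[z] - (y1 + l * (z - x1)) ^+ 2 = (z - x1) * (z - x2) * (z - x3).
Proof.
have [_ K] := slopeP; apply/eqP; rewrite -subr_eq0.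
have -> : c.[z] - (y1 + l * (z - x1)) ^+ 2 - (z - x1) * (z - x2) * (z - x3) =
  (c.[x1] - y1 ^+ 2) + (z - x1) * ((3 * x1 ^+ 2 + 2 * d`_2 * x1 + d`_1 - 2 * y1 * l)
     - (x2 - x1) * (l ^+ 2 - d`_2 - 2 * x1 - x2)).
  by rewrite !cubicE /third; ring.
by rewrite h1 K !subrr mulr0 addr0.
Qed.

Lemma line_third : (y1 + l * (x3 - x1)) ^+ 2 = c.[x3].
Proof. by apply/eqP; rewrite eq_sym -subr_eq0 line_eq subrr mulr0. Qed.
End Line.

Lemma add_on X Y : on_cubic c (add_val (pval X) (pval Y)).
Proof.
case: X => [[[x1 y1]|] H]; case: Y => [[[x2 y2]|] H'] //=.
have [//|ne] := ifP; rewrite /= sqrrN line_third ?ne //; exact/eqP.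
Qed.

Definition padd X Y : pt := Pt (add_on X Y).

Lemma paddO X : padd X ptO = X.
Proof. by case: X => [[[x y]|] H]; apply: val_inj. Qed.

Lemma pOadd X : padd ptO X = X.
Proof. by case: X => [[[x y]|] H]; apply: val_inj. Qed.

Lemma paddN X : padd X (popp X) = ptO.
Proof. by case: X => [[[x y]|] H]; apply: val_inj; rewrite /= ?eqxx ?subrr ?eqxx. Qed.

(** * Principal divisors and linear equivalence of points *)

Definition dv S X : int := (X == S)%:Z.
Definition prin (D : pt -> int) := exists f, forall X, ord X f (D X).

Lemma prin_ext D D' : prin D -> D =1 D' -> prin D'.
Proof. by move=> [f H] e; exists f => X; rewrite -e. Qed.

Lemma prin_add D D' : prin D -> prin D' -> prin (fun X => D X + D' X).
Proof. by move=> [f H] [g H']; exists (fun X => f X * g X) => X; apply: ord_mul. Qed.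

Lemma prin_sub D D' : prin D -> prin D' -> prin (fun X => D X - D' X).
Proof. by move=> [f H] [g H']; exists (fun X => f X / g X) => X; apply: ord_div. Qed.

Lemma prin0 : prin (fun=> 0).
Proof. exists (fun=> 1) => X; apply: ord_const; exact: oner_neq0. Qed.

Lemma ord_pxc X k : X != ptO -> ord X (fun Y => px Y - k) (if px X == k then xord X else 0%N).
Proof.
move=> hX; case: eqP => [<-|/eqP ne]; first exact: ord_pxsub.
have nz : px X - k != 0 by rewrite subr_eq0.
exact: reg_ord0 (reg_add (reg_px hX) (reg_const X (- k))) nz.
Qed.

Lemma ordO_pxc k : ord ptO (fun Y => px Y - k) (-2).
Proof.
have nz : 'X - k%:P != 0 by rewrite polyXsubC_eq0.
have := ordO_poly c nz; rewrite size_XsubC /= => h.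
by apply: ord_ext h _; apply: aeW => Y; rewrite !hornerE.
Qed.

Lemma popp_fix X : X != ptO -> (popp X == X) = (py X == 0).
Proof.
move=> hX; apply/eqP/eqP => [e|e].
  have := congr1 (@py F c) e; rewrite popp_py => /eqP.
  rewrite -subr_eq0 -opprD oppr_eq0 -mulr2n -mulr_natl mulf_eq0 (negPf (two_neq0 c)).
  by move/eqP.
by apply: pt_eqP; rewrite ?popp_neqO ?popp_px ?popp_py // e oppr0.
Qed.

Lemma ord_vert S X : S != ptO ->
  ord X (fun Y => px Y - px S) (dv S X + dv (popp S) X - 2 * dv ptO X).
Proof.
move=> hS; rewrite /dv.
have [->|hX] := eqVneq X ptO.
  rewrite eq_sym (negPf hS) eq_sym (negPf (_ : popp S != ptO)) ?popp_neqO //.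
  exact: ordO_pxc.
have := ord_pxc (px S) hX; case: eqP => [e|ne] h.
  have -> : (X == S)%:Z + (X == popp S)%:Z - 2 * 0%:Z = xord X.
    rewrite /xord -popp_fix //.
    have [->|->] := px_eq hX hS e; first by rewrite eqxx eq_sym; case: eqP.
    by rewrite poppK eqxx eq_sym; case: eqP.
  exact: h.
have -> : (X == S) = false by apply/eqP => e; apply: ne; rewrite e.
have -> : (X == popp S) = false by apply/eqP => e; apply: ne; rewrite e popp_px.
exact: h.
Qed.

Lemma ord_add_ordge X f g n m : ord X f n -> ordge X g m -> n < m ->
  ord X (fun Y => f Y + g Y) n.
Proof.
move=> hf [z|[k mk hk]] nm; last exact: ord_add_lt hf hk (lt_le_trans nm mk).
by apply: ord_ext hf _; apply: (ae1 z) => Y ->; rewrite addr0.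
Qed.

Lemma padd_coord S T : S != ptO -> T != ptO -> T != popp S ->
  let l := slope (px S) (py S) (px T) (py T) in
  let x3 := third (px S) (py S) (px T) (py T) in
  [/\ ~~ ((px S == px T) && (py S + py T == 0)), padd S T != ptO,
      px (padd S T) = x3 & py (padd S T) = - (py S + l * (x3 - px S))].
Proof.
move=> hS hT hST l x3.
have ne : ~~ ((px S == px T) && (py S + py T == 0)).
  apply: contraNN hST => /andP [/eqP e1]; rewrite addrC addr_eq0 => /eqP e2.
  by apply/eqP; apply: pt_eqP; rewrite ?popp_neqO ?popp_px ?popp_py.
move: ne; rewrite /x3 /l; case: S hS hST {l x3} => [[[x1 y1]|] H] // _ _; case: T hT => [[[x2 y2]|] H'] // _.
by rewrite -val_eqE /px /py /= => ne; rewrite (negPf ne).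
Qed.

(* The product of y - L(x) with its conjugate y + L(x) is the cubic
   (x - x1)(x - x2)(x - x3), so tangent lines need no separate count. *)
Lemma ord_line S T X : S != ptO -> T != ptO -> T != popp S ->
  ord X (fun Y => py Y - (py S + slope (px S) (py S) (px T) (py T) * (px Y - px S)))
    (dv S X + dv T X + dv (popp (padd S T)) X - 3 * dv ptO X).
Proof.
move=> hS hT hST; have [ne hR xR yR] := padd_coord hS hT hST.
set l := slope _ _ _ _ in yR *; set U := popp (padd S T).
have hU : U != ptO by rewrite popp_neqO.
have xU : px U = third (px S) (py S) (px T) (py T) by rewrite popp_px xR.
pose L Y := py S + l * (px Y - px S).
have LS : py S = L S by rewrite /L subrr mulr0 addr0.
have LT : py T = L T by have [-> _] := slopeP (py2 hS) (py2 hT) ne.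
have LU : py U = L U by rewrite popp_py yR opprK /L xU.
have rL Y : Y != ptO -> reg Y L (L Y).
  move=> hY; apply: (reg_add (reg_const Y (py S))); apply: (reg_mul (reg_const Y l)).
  exact: (reg_add (reg_px hY) (reg_const Y (- px S))).
have [e|hX] := eqVneq X ptO.
  have dvO W : W != ptO -> dv W X = 0 by move=> hW; rewrite /dv e eq_sym (negPf hW).
  rewrite (dvO S) // (dvO T) // (dvO U) // /dv e eqxx.
  apply: (@ord_add_ordge _ _ _ (-3) (-2) (ordO_py c)) => //.
  apply: ordge_opp; apply: ordge_add.
    exact: ordge_le (ordge_const ptO _).
  have := ordge_mul (ordge_const ptO l) (ord_ordge (ordO_pxc (px S)) (lexx _)).
  by rewrite add0r.
have dvO : dv ptO X = 0 by rewrite /dv (negPf hX).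
rewrite dvO mulr0 subr0.
have rq : reg X (fun Y => py Y - L Y) (py X - L X).
  apply: (reg_add (reg_py hX)); rewrite -mulN1r.
  by apply: reg_ext (reg_mul (reg_const X (-1)) (rL X hX)) _; apply: aeW => Y; rewrite mulN1r.
have [q0|q0] := eqVneq (py X) (L X); last first.
  have dv0 W : py W = L W -> dv W X = 0.
    by move=> hW; rewrite /dv; case: eqP => // e; rewrite e hW eqxx in q0.
  rewrite !dv0 //; apply: reg_ord0 rq _; by rewrite subr_eq0.
(* On the line the abscissa determines the point, so the divisor at X counts how often x(X) is a
   root of the cubic. *)
have dvE W : W != ptO -> py W = L W -> dv W X = (px X == px W)%:Z.
  move=> hW yW; rewrite /dv; congr (Posz (nat_of_bool _)); apply/eqP/eqP => [->//|e].
  by apply: pt_eqP => //; rewrite q0 yW /L e.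
rewrite !dvE // xU.
have xN k : ord X (fun Y => px Y - k) ((xord X)%:Z * (px X == k)%:Z).
  by have := ord_pxc k hX; case: eqP => _; rewrite ?mulr1 ?mulr0.
have oN := ord_mul (ord_mul (xN (px S)) (xN (px T))) (xN (third (px S) (py S) (px T) (py T))).
have NE Y : Y != ptO -> (px Y - px S) * (px Y - px T) * (px Y - third (px S) (py S) (px T) (py T))
   = (py Y - L Y) * (py Y + L Y).
  by move=> hY; rewrite -(line_eq (py2 hS) (py2 hT) ne) -subr_sqr py2.
have oN' : ord X (fun Y => (py Y - L Y) * (py Y + L Y))
    ((xord X)%:Z * ((px X == px S)%:Z + (px X == px T)%:Z + (px X == third (px S) (py S) (px T) (py T))%:Z)).
  rewrite !mulrDr; apply: ord_ext oN _; by apply: (ae1 (ae_neq ptO)) => Y /NE.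
(* If y(X) != 0, the conjugate y + L has value 2 y(X) at X and contributes nothing. *)
have [y0|y0] := eqVneq (py X) 0; last first.
  rewrite /xord (negPf y0) mul1r in oN'.
  have nz : py X + L X != 0 by rewrite -q0 -mulr2n -mulr_natl mulf_neq0 // two_neq0.
  have rq' := reg_add (reg_py hX) (rL X hX).
  have := ord_div oN' (reg_ord0 rq' nz); rewrite subr0 => h; apply: ord_ext h _.
  by apply: (ae1 (reg_neq0 rq' nz)) => Y h; rewrite mulfK.
have oy : ord X (@py F c) 1 by have := ord_py hX; rewrite /xord y0 eqxx.
(* Now L is a multiple of x - x(X), of order at least 2, while y has order 1. Both y - L and y + L
   thus have order 1, and comparison with the product shows that x(X) is a simple root of the
   cubic. *)
have oL : ordge X L 2.
  have LE Y : L Y = l * (px Y - px X).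
    have e : 0 = L X by rewrite -q0 y0.
    by rewrite -[L Y]subr0 [X in _ - X]e /L; ring.
  have := ordge_mul (ordge_const X l) (ord_ordge (ord_pxsub hX) (lexx _)).
  rewrite /xord y0 eqxx add0r => h; by apply: ordge_ext h _; apply: aeW => Y; rewrite LE.
have o1 := ord_add_ordge oy (ordge_opp oL) (isT : 1 < 2 :> int).
have o2 := ord_add_ordge oy oL (isT : 1 < 2 :> int).
have := ord_uniq oN' (ord_mul o1 o2); rewrite /xord y0 eqxx => e2.
have -> : (px X == px S)%:Z + (px X == px T)%:Z + (px X == third (px S) (py S) (px T) (py T))%:Z = 1.
  by apply: (@mulfI _ 2%:Z).
exact: o1.
Qed.

(** The chord through S and T divided by the vertical line through S + T. *)
Lemma prin_line S T : prin (fun X => dv S X + dv T X - dv (padd S T) X - dv ptO X).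
Proof.
have [->|hS] := eqVneq S ptO; first by apply: prin_ext prin0 _ => X; rewrite pOadd; lia.
have [->|hT] := eqVneq T ptO; first by apply: prin_ext prin0 _ => X; rewrite paddO; lia.
have [->|hST] := eqVneq T (popp S).
  rewrite paddN; exists (fun Y => px Y - px S) => X.
  have -> : dv S X + dv (popp S) X - dv ptO X - dv ptO X = dv S X + dv (popp S) X - 2 * dv ptO X by lia.
  exact: ord_vert.
have [_ hR _ _] := padd_coord hS hT hST.
have p1 : prin (fun X => dv S X + dv T X + dv (popp (padd S T)) X - 3 * dv ptO X).
  by eexists => X; apply: ord_line.
have p2 : prin (fun X => dv (padd S T) X + dv (popp (padd S T)) X - 2 * dv ptO X).
  by eexists => X; apply: ord_vert.
apply: prin_ext (prin_sub p1 p2) _ => X; lia.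
Qed.

(** For T = O the function would have at most a simple pole, hence be constant. Otherwise the
    vertical line at T changes the divisor to (S) + (-T) - 2(O); such a function is linear in x, so
    its zeros are opposite points. *)
Lemma prin_sep S T : prin (fun X => dv S X - dv T X) -> S = T.
Proof.
have [->|hT] := eqVneq T ptO.
  move=> [f H]; have [|a [b e]] := @pol_of_regular f (ord_rat (H ptO)).
    by move=> X hX; apply: ord_ordge (H X) _; rewrite /dv (negPf hX); lia.
  have h : ordge ptO (ev a b) (- 1%N%:Z).
    by apply: ordge_ext e; apply: ord_ordge (H ptO) _; rewrite /dv eqxx; lia.
  have [ha hb] := ordO_ev_le h.
  have b0 : b = 0 by apply/eqP; apply: contraT => /hb; lia.
  have sa : (size a <= 1)%N.
    by have [->|/ha] := eqVneq a 0; [rewrite size_poly0|lia].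
  have ek : ae (fun X => f X = a`_0).
    by apply: (ae1 e) => X ->; rewrite b0 evC {1}(size1_polyC sa) hornerC.
  have k0 : a`_0 != 0.
    apply/eqP => k0; apply: ae_False; apply: (ae2 ek (ord_neq0 (H ptO))) => X ->.
    by rewrite k0 eqxx.
  have ek' : ae (fun X => a`_0 = f X) by apply: (ae1 ek).
  have := ord_uniq (H S) (ord_ext (ord_const S k0) ek').
  by rewrite /dv eqxx; case: eqP => // ->.
move=> p1.
have p2 : prin (fun X => dv T X + dv (popp T) X - 2 * dv ptO X).
  by eexists => X; apply: ord_vert.
have [f H] : prin (fun X => dv S X + dv (popp T) X - 2 * dv ptO X).
  by apply: prin_ext (prin_add p1 p2) _ => X; lia.
have [|a [b e]] := @pol_of_regular f (ord_rat (H ptO)).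
  by move=> X hX; apply: ord_ordge (H X) _; rewrite /dv (negPf hX); lia.
have h : ordge ptO (ev a b) (- 2%N%:Z).
  by apply: ordge_ext e; apply: ord_ordge (H ptO) _; rewrite /dv eqxx; lia.
have [ha hb] := ordO_ev_le h.
have b0 : b = 0 by apply/eqP; apply: contraT => /hb; lia.
have a0 : a != 0.
  apply/eqP => a0; apply: ae_False; apply: (ae2 e (ord_neq0 (H ptO))) => X ->.
  by rewrite b0 a0 evC horner0 eqxx.
have sa : size a = 2%N.
  have := ha a0; have : size a != 0%N by rewrite size_poly_eq0.
  case sz: (size a) => [|[|[|k]]] //= _ hk; last by lia.
  have /size_poly1P [z z0 aE] : size a == 1%N by rewrite sz.
  have ek' : ae (fun X => z = f X) by apply: (ae1 e) => X ->; rewrite b0 evC aE hornerC.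
  have := ord_uniq (H (popp T)) (ord_ext (ord_const _ z0) ek').
  by rewrite /dv !eqxx (negPf (_ : popp T != ptO)) ?popp_neqO //; lia.
have [x rx] : exists x, root a x by apply/closed_rootP; rewrite sa.
have [q aE] := factor_theorem _ _ rx.
have q0 : q != 0 by apply: contraNneq a0 => e0; rewrite aE e0 mul0r.
have /size_poly1P [z z0 qE] : size q == 1%N.
  by move: sa; rewrite aE size_Mmonic ?monicXsubC // size_XsubC addn2 /= => -[->].
have [R hR ex] := pt_exists c x.
have eq0 X : dv S X + dv (popp T) X = dv R X + dv (popp R) X.
  have h1 := ord_mul (ord_const X z0) (ord_vert X hR); rewrite add0r in h1.
  have := ord_uniq (H X) (ord_ext h1 _) => h2.
  suff: dv S X + dv (popp T) X - 2 * dv ptO X = dv R X + dv (popp R) X - 2 * dv ptO X by lia.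
  apply: h2; apply: (ae1 e) => Y ->; by rewrite b0 evC aE qE ex !hornerE.
have [e1|n1] := eqVneq S R.
  have := eq0 (popp T); rewrite /dv e1 eqxx.
  case: (eqVneq (popp T) (popp R)) => [/(can_inj poppK) -> //|_]; lia.
have := eq0 S; rewrite {1 3}/dv eqxx (negPf n1).
case: (eqVneq S (popp R)) => [e1 _|n2]; last by rewrite /dv (negPf n2); lia.
have := eq0 (popp T); rewrite /dv eqxx -e1.
case: (eqVneq (popp T) R) => [e2 _|_]; last by lia.
by rewrite e1 -e2 poppK.
Qed.

Lemma paddC : commutative padd.
Proof.
move=> S T; apply: prin_sep.
apply: prin_ext (prin_sub (prin_line T S) (prin_line S T)) _ => X; lia.
Qed.

(** Both sides are the point W for which (S) + (T) + (U) - (W) - 2(O) is principal. *)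
Lemma paddA : associative padd.
Proof.
move=> S T U; apply: prin_sep.
have p := prin_add (prin_line S T) (prin_line (padd S T) U).
have q := prin_add (prin_line T U) (prin_line S (padd T U)).
apply: prin_ext (prin_sub p q) _ => X; lia.
Qed.

Lemma pNadd : left_inverse ptO popp padd.
Proof. by move=> X; rewrite paddC paddN. Qed.

End GroupLaw.

HB.instance Definition _ (F : closedFieldType) (c : cubic F) :=
  GRing.isZmodule.Build (pt c) (@paddA F c) (@paddC F c) (@pOadd F c) (@pNadd F c).

(** * Rational maps and their ramification *)

Lemma deriv_eq0 (F : fieldType) (q : {poly F}) :
  [pchar F] =i pred0 -> q^`() = 0 -> (size q <= 1)%N.
Proof.
move=> /pcharf0P ch dq; apply/leq_sizeP => -[//|j] _; have := congr1 (fun r : {poly F} => r`_j) dq.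
rewrite coef_deriv coef0 -mulr_natr => /eqP; rewrite mulf_eq0 ch orbF => /eqP //.
Qed.

Section RationalMaps.
Variables (F : closedFieldType) (c : cubic F).
Local Notation pt := (pt c).
Local Notation d := (cpoly c).
Implicit Types (X Y S T U : pt) (f g h u : pt -> F) (n : int) (v w : F) (al be : pt -> pt).

Lemma ptOE : ptO c = 0. Proof. by []. Qed.

Lemma pxN X : px (- X) = px X. Proof. exact: popp_px. Qed.
Lemma pyN X : py (- X) = - py X. Proof. exact: popp_py. Qed.

(** The generic value O is set apart because the coordinates of the origin are junk. *)
Definition rcoord al := ae (fun X => al X = 0) \/
  [/\ ae (fun X => al X != 0), rational (fun X => px (al X)) & rational (fun X => py (al X))].

Lemma rcoord_ext al be : rcoord al -> ae (fun X => al X = be X) -> rcoord be.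
Proof.
case=> [z|[nz rx ry]] e; [left|right; split].
- by apply: (ae2 z e) => X -> <-.
- by apply: (ae2 nz e) => X ? <-.
- by apply: rat_ext rx _; apply: (ae1 e) => X ->.
- by apply: rat_ext ry _; apply: (ae1 e) => X ->.
Qed.

Lemma rat_third f1 g1 f2 g2 : rational f1 -> rational f2 -> forall l, rational l ->
  ae (fun X => l X = slope c (f1 X) (g1 X) (f2 X) (g2 X)) ->
  rational (fun X => third c (f1 X) (g1 X) (f2 X) (g2 X)).
Proof.
move=> r1 r2 l rl e; apply: rat_ext (rat_sub (rat_sub (rat_sub (rat_exp 2 rl) (rat_const c d`_2)) r1) r2) _.
by apply: (ae1 e) => X ->.
Qed.

(** Dichotomy on x(al) - x(be) and on y(al) + y(be) tells which of chord, tangent or opposite points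
    is the generic case. *)
Lemma rcoord_add al be : rcoord al -> rcoord be -> rcoord (fun X => al X + be X).
Proof.
case=> [z|[nz rx ry]].
  by move/rcoord_ext; apply; apply: (ae1 z) => X ->; rewrite add0r.
case=> [z'|[nz' rx' ry']].
  apply: (@rcoord_ext al); first by right.
  by apply: (ae1 z') => X ->; rewrite addr0.
have fin l : rational l ->
    ae (fun X => l X = slope c (px (al X)) (py (al X)) (px (be X)) (py (be X))) ->
    ae (fun X => be X != - al X) -> rcoord (fun X => al X + be X).
  move=> rl el ne; right; have r3 := rat_third rx rx' rl el; split.
  - by apply: (ae3 nz nz' ne) => X h1 h2 h3; have [] := padd_coord h1 h2 h3.
  - by apply: rat_ext r3 _; apply: (ae3 nz nz' ne) => X h1 h2 h3; have [_ _ ->] := padd_coord h1 h2 h3.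
  - apply: rat_ext (rat_opp (rat_add ry (rat_mul rl (rat_sub r3 rx)))) _.
    by apply: (ae4 nz nz' ne el) => X h1 h2 h3 ->; have [_ _ _ ->] := padd_coord h1 h2 h3.
have [ex|nx] := rat_dich (rat_sub rx rx'); last first.
  apply: (fin _ (rat_div (rat_sub ry' ry) (rat_sub rx' rx))).
    by apply: (ae1 nx) => X; rewrite subr_eq0 /slope => /negPf ->.
  by apply: (ae1 nx) => X; apply: contraNneq => ->; rewrite pxN subrr.
have [ey|ny] := rat_dich (rat_add ry ry').
  left; apply: (ae4 nz nz' ex ey) => X h1 h2 /eqP; rewrite subr_eq0 => /eqP e1 /eqP.
  rewrite addr_eq0 => /eqP e2; apply/eqP; rewrite addr_eq0; apply/eqP.
  by apply: pt_eqP; rewrite ?oppr_eq0 ?pxN ?pyN.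
have rl : rational (fun X => (3 * px (al X) ^+ 2 + 2 * d`_2 * px (al X) + d`_1) / (2 * py (al X))).
  apply: rat_div; last exact: rat_mul (rat_const c 2) ry.
  apply: rat_add (rat_const c _); apply: rat_add; first exact: rat_mul (rat_const c 3) (rat_exp 2 rx).
  exact: rat_mul (rat_const c _) rx.
apply: (fin _ rl).
  by apply: (ae1 ex) => X /eqP; rewrite subr_eq0 /slope => ->.
by apply: (ae1 ny) => X; apply: contraNneq => ->; rewrite pyN subrr.
Qed.

Lemma rcoord_id : rcoord id.
Proof.
right; split; [exact: ae_neq|exact: rat_px|exact: rat_py].
Qed.

Lemma rcoord_const S : rcoord (fun=> S).
Proof.
have [->|hS] := eqVneq S 0; first by left; apply: aeW.
by right; split; [apply: aeW|exact: rat_const|exact: rat_const].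
Qed.

Lemma rcoord_mulrn (k : nat) : rcoord (fun X => X *+ k).
Proof.
elim: k => [|k IH]; first by apply: (rcoord_ext (rcoord_const 0)); apply: aeW.
apply: rcoord_ext (rcoord_add rcoord_id IH) _; by apply: aeW => X; rewrite mulrS.
Qed.

(** Finite fibres are what allows a statement holding off a finite set to be composed with al. *)
Definition finfib al := forall Y, exists s : seq pt, forall X, al X = Y -> X \in s.
Definition rmap al := [/\ rational (fun X => px (al X)), rational (fun X => py (al X)) & finfib al].

Lemma ae_comp al (P : pt -> Prop) : finfib al -> ae P -> ae (fun X => P (al X)).
Proof.
move=> fa [s H]; suff: ae (fun X => al X \notin s) by move/ae1; apply=> X /H.
elim: s {H} => [|Y s IH]; first exact: aeW.
have [t ht] := fa Y.
have: ae (fun X => al X != Y) by exists t => X; apply: contraNneq => /ht.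
by move/(ae2 IH); apply=> X h1 h2; rewrite inE negb_or h2.
Qed.

Lemma rmap_rcoord al : rcoord al -> finfib al -> rmap al.
Proof.
move=> [z|[_ rx ry]] fa; last by [].
exfalso; apply: ae_False; apply: (ae2 z (ae_comp fa (ae_neq 0))) => X ->; by rewrite eqxx.
Qed.

Lemma rat_comp al f : rmap al -> rational f -> rational (fun X => f (al X)).
Proof.
move=> [rx ry fa] [a [b [q [q0 h]]]].
have := rat_div (rat_add (rat_poly a rx) (rat_mul (rat_poly b rx) ry)) (rat_poly q rx).
move/rat_ext; apply; apply: (ae2 (ae_comp fa h) (ae_comp fa (ae_poly c q0))) => X e qX.
by rewrite -[X in X / _]/(ev a b (al X)) -e mulfK.
Qed.

Lemma ord_poly_neg X f (n : int) (a : {poly F}) : ord X f n -> n < 0 -> a != 0 ->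
  ord X (fun Y => a.[f Y]) (n * (size a).-1).
Proof.
move=> hf n0; elim/poly_ind: a => [|a k IH]; first by rewrite eqxx.
have [->|a0] := eqVneq a 0.
  rewrite mul0r add0r polyC_eq0 => k0; rewrite size_polyC k0 /= mulr0.
  apply: ord_ext (ord_const X k0) _; by apply: aeW => Y; rewrite hornerC.
move=> _; have sE : size (a * 'X + k%:P) = (size a).+1.
  by rewrite size_MXaddC (negPf a0).
have sa : (size a).-1.+1 = size a by rewrite prednK // size_poly_gt0.
have h := ord_mul (IH a0) hf.
have h' : ord X (fun Y => (a * 'X + k%:P).[f Y]) (n * (size a).-1 + n).
  apply: ord_ext (ord_add_ordge h (ordge_const X k) _) _; last by apply: aeW => Y; rewrite !hornerE.
  nia.
move: h'; have -> : n * (size a).-1 + n = n * (size a) by rewrite -{2}sa -addn1 PoszD mulrDr mulr1.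
by rewrite sE.
Qed.

Lemma reg_of_ordge X f k : ordge X (fun Y => f Y - k) 1 -> reg X f k.
Proof.
move=> h; have [//|v [hv v0]] := ordge_reg _ h.
rewrite v0 // in hv; have := reg_add hv (reg_const X k); rewrite add0r => h'.
by apply: reg_ext h' _; apply: aeW => Y; rewrite subrK.
Qed.

Lemma reg_sub X f g v w : reg X f v -> reg X g w -> reg X (fun Y => f Y - g Y) (v - w).
Proof.
move=> hf hg; rewrite -[v - w]/(v + - w) -mulN1r.
apply: reg_ext (reg_add hf (reg_mul (reg_const X (-1)) hg)) _.
by apply: aeW => Y; rewrite mulN1r.
Qed.

Lemma ord_pos_reg X f n : ord X f n -> 0 < n -> reg X f 0.
Proof. by move=> h n0; have [v [hv v0]] := ord_reg (ltW n0) h; rewrite v0 in hv. Qed.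

Lemma reg0_ord X f : reg X f 0 -> ae (fun Y => f Y != 0) -> exists m : nat, (0 < m)%N /\ ord X f m.
Proof.
move=> h nz; have [n hn] := ord_ex X (reg_rat h) nz.
have n1 := ordge_ord (reg_ordge1 h) hn.
by exists `|n|%N; split; [lia|rewrite (_ : `|n|%N%:Z = n) //; lia].
Qed.

Lemma ae_pyc k : ae (fun Z : pt => py Z - k != 0).
Proof.
have h : ae (fun Z : pt => ev (- k%:P) 1 Z != 0) by apply: ev_neq0; rewrite oner_neq0 orbT.
by apply: (ae1 h) => Z; rewrite /ev !hornerE addrC.
Qed.

(* The extension of [al] to a morphism sends [X] to [Y], with ramification
   index [m]. *)
Definition pull al X Y (m : nat) := (0 < m)%N /\
  forall f n, ord Y f n -> ord X (fun Z => f (al Z)) (n * m%:Z).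

Lemma pull_of_reg al X Y (m : nat) : finfib al -> (0 < m)%N ->
  (forall u v, reg Y u v -> v != 0 -> ord X (fun Z => u (al Z)) 0) ->
  ord X (fun Z => tpar Y (al Z)) m -> pull al X Y m.
Proof.
move=> fa m0 H Ht; split=> // f n [u [v [hu v0 e]]].
have := ord_mul (ord_expz n Ht) (H _ _ hu v0); rewrite addr0 mulrC.
by move/ord_ext; apply; apply: (ae1 (ae_comp fa e)).
Qed.

(** A rational map from a smooth curve extends to every point. If x(al) has a pole at X, the image
    is the origin; otherwise x(al) and y(al) are regular and their residues are the coordinates of
    the image. *)
Lemma pull_ex al X : rmap al -> exists Y m, pull al X Y m.
Proof.
move=> ra; have [rx ry fa] := ra.
have nx k : ae (fun Z => px (al Z) - k != 0).
  by apply: (ae1 (ae_comp fa (ae_px_neq c k))) => Z; rewrite subr_eq0.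
have ny : ae (fun Z => py (al Z) != 0) by apply: (ae_comp fa (ae_py c)).
have [n0 h0] : exists n, ord X (fun Z => px (al Z)) n.
  by apply: ord_ex rx _; apply: (ae1 (nx 0)) => Z; rewrite subr0.
have [n1 h1] := ord_ex X ry ny.
have y2 : ae (fun Z => py (al Z) ^+ 2 = d.[px (al Z)]).
  by apply: (ae1 (ae_comp fa (ae_neq 0))) => Z hZ; rewrite py2.
case: (ltP n0 0) => [n0neg|n0pos].
  have hd := ord_poly_neg h0 n0neg (cubic_neq0 c); rewrite cubic_size /= in hd.
  have e := ord_uniq (ord_ext (ord_exp 2 h1) y2) hd.
  (* From y^2 = d(x) the orders satisfy 2 n1 = 3 n0, so they are -3m and -2m, and m is the order of
     x / y. *)
  have [m [m0 e0 e1]] : exists m : nat, [/\ (0 < m)%N, n0 = - 2 * m%:Z & n1 = - 3 * m%:Z].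
    by exists `|n0 - n1|%N; split; lia.
  exists 0, m; apply: pull_of_reg => //; last first.
    have := ord_div h0 h1; have -> : n0 - n1 = m by lia.
    by rewrite /tpar -ptOE eqxx.
  move=> u v; rewrite /reg -ptOE eqxx => -[a [b [q [k [qk [sq sa sb] hu vE]]]]] v0.
  have ak : a`_k != 0 by apply: contraNneq v0 => z; rewrite vE z mul0r.
  have ordk (r : {poly F}) : r`_k != 0 -> (size r <= k.+1)%N ->
      ord X (fun Z => r.[px (al Z)]) (n0 * k).
    move=> rk sr; have r0 : r != 0 by apply: contraNneq rk => ->; rewrite coef0.
    have sE : size r = k.+1.
      apply/eqP; rewrite eqn_leq sr /=; apply: contraNT rk; rewrite -leqNgt => h.
      by rewrite nth_default.
    by have := ord_poly_neg h0 n0neg r0; rewrite sE.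
  have hb : ordge X (fun Z => b.[px (al Z)] * py (al Z)) (n0 * k + 1).
    have [b0|b0] := eqVneq b 0; first by left; apply: aeW => Z; rewrite b0 horner0 mul0r.
    apply: ord_ordge (ord_mul (ord_poly_neg h0 n0neg b0) h1) _.
    have : (0 < size b)%N by rewrite size_poly_gt0.
    have : (size b <= k.-1)%N := sb.
    move: (size b) => sz; nia.
  have ha := ord_add_ordge (ordk a ak sa) hb; have [|ha'] := ltP (n0 * k) (n0 * k + 1); last by lia.
  move/ha => ha'; have := ord_div ha' (ordk q qk sq); rewrite subrr.
  move/ord_ext; apply.
  have q0 : q != 0 by apply: contraNneq qk => ->; rewrite coef0.
  apply: (ae2 (ae_comp fa hu) (ae_comp fa (ae_poly c q0))) => Z e' qZ.
  by rewrite -[X in X / _]/(ev a b (al Z)) -e' mulfK.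
have [x0 /reg_of_ordge hx] := ordge_residue (ord_ordge h0 n0pos).
have n1pos : 0 <= n1.
  have hd := reg_ordge0 (reg_poly d hx).
  by have := ordge_ord hd (ord_ext (ord_exp 2 h1) y2); lia.
have [y0 /reg_of_ordge hy] := ordge_residue (ord_ordge h1 n1pos).
have exy : y0 ^+ 2 = d.[x0].
  exact: reg_uniq (reg_ext (reg_exp 2 hy) y2) (reg_poly d hx).
pose Y := ptA exy; have hY : Y != 0 := ptA_neqO exy.
have hev a b : reg X (fun Z => ev a b (al Z)) (ev a b Y).
  exact: reg_add (reg_poly a hx) (reg_mul (reg_poly b hx) hy).
have ht : reg X (fun Z => tpar Y (al Z)) 0.
  rewrite /tpar (negPf hY); case: ifP => [/eqP e|_]; first by move: hy; rewrite -[y0]/(py Y) e.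
  by rewrite -(subrr (px Y)); apply: reg_sub hx (reg_const X _).
have [m [m0 hm]] := reg0_ord ht (ae_comp fa (tpar_neq0 Y)).
exists Y, m; apply: pull_of_reg => // u v.
rewrite /reg (negPf hY) => -[a [b [a' [b' [q0 e vE]]]]] v0.
have a0 : ev a b Y != 0 by apply: contraNneq v0 => z; rewrite vE z mul0r.
have := ord_div (reg_ord0 (hev a b) a0) (reg_ord0 (hev a' b') q0); rewrite subr0.
move/ord_ext; apply.
apply: (ae2 (ae_comp fa e) (ae_comp fa (ev_neq0 c (ev_neq0_val hY q0)))) => Z <- qZ.
by rewrite mulfK.
Qed.

(** x - x(Y) and y - y(Y) have positive order at Y, while at any other point one of them has order
    at most 0; pulled back to X it would have two orders. *)
Lemma pull_eq0 al X Y Y' m m' : pull al X Y m -> pull al X Y' m' -> Y != 0 -> Y = Y'.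
Proof.
move=> [m0 H] [m0' H'] hY.
have h1 := ord_pxsub hY.
have hY' : Y' != 0.
  apply/eqP => e; rewrite e in H'.
  have := ord_uniq (H _ _ h1) (H' _ _ (ordO_pxc c (px Y))).
  by rewrite /xord; case: ifP => _; lia.
have ex : px Y' = px Y.
  apply/eqP; apply: contraT => ne.
  have := ord_pxc (px Y) hY'; rewrite (negPf ne) => h2.
  have := ord_uniq (H _ _ h1) (H' _ _ h2).
  by rewrite /xord; case: ifP => _; lia.
apply: pt_eqP => //.
have nz := ae_pyc (py Y).
have [|k [k0 hk]] := @reg0_ord Y _ _ nz.
  by rewrite -[X in reg _ _ X](subrr (py Y)); apply: reg_sub (reg_py hY) (reg_const Y _).
have rY' := reg_sub (reg_py hY') (reg_const Y' (py Y)).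
apply/eqP; rewrite eq_sym -subr_eq0; apply: contraT => ne.
have := ord_uniq (H _ _ hk) (H' _ _ (reg_ord0 rY' ne)); lia.
Qed.

Lemma pull_uniq al X Y Y' m m' : pull al X Y m -> pull al X Y' m' -> Y = Y' /\ m = m'.
Proof.
move=> h h'; have e : Y = Y'.
  have [hY|hY] := eqVneq Y 0; last exact: pull_eq0 h h' hY.
  have [hY'|hY'] := eqVneq Y' 0; first by rewrite hY hY'.
  by symmetry; apply: pull_eq0 h' h hY'.
split=> //; subst Y'; case: h => _ H; case: h' => _ H'.
by have := ord_uniq (H _ _ (ord_tpar Y)) (H' _ _ (ord_tpar Y)); lia.
Qed.

Lemma pull_comp al be X Y Z m k : pull al X Y m -> pull be Y Z k ->
  pull (fun W => be (al W)) X Z (k * m).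
Proof.
move=> [m0 H] [k0 H']; split=> [|f n h]; first by rewrite muln_gt0 k0 m0.
by rewrite PoszM mulrA; apply: (H (fun W => f (be W))); apply: H'.
Qed.

Lemma pull_ext al be X Y m : pull al X Y m -> (forall Z, al Z = be Z) -> pull be X Y m.
Proof.
move=> [m0 H] e; split=> // f n /H /ord_ext; apply; by apply: aeW => Z; rewrite e.
Qed.

Lemma pull_id X : pull id X X 1.
Proof. by split=> // f n; rewrite mulr1. Qed.

Lemma ae_reg f : rational f -> ae (fun X => reg X f (f X)).
Proof.
move=> [a [b [q [q0 h]]]]; apply: (ae3 h (ae_poly c q0) (ae_neq 0)) => X e qX hX.
rewrite /reg (negPf hX); exists a, b, q, 0; rewrite evC; split=> //.
  by apply: (ae1 h) => Y; rewrite evC.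
by rewrite -e mulfK.
Qed.

(** The extension agrees with the given map only off a finite set at first; [pull_tr] and
    [pull_mulrn] remove the exceptions. *)
Lemma pull_generic al : rmap al -> ae (fun X => exists m, pull al X (al X) m).
Proof.
move=> ra; have [rx ry fa] := ra.
apply: (ae3 (ae_reg rx) (ae_reg ry) (ae_comp fa (ae_neq 0))) => X hx hy hX.
have [Y [m h]] := pull_ex X ra; exists m; suff -> : al X = Y by [].
have [m0 H] := h.
have [e|hY] := eqVneq Y 0.
  have := H _ _; rewrite e => /(_ _ _ (ordO_pxc c 0)).
  have := reg_ordge0 (reg_sub hx (reg_const X 0)) => h1 /(ordge_ord h1); lia.
apply: pt_eqP => //.
  have := H _ _ (ord_pxsub hY) => h1.
  have h2 := ord_pos_reg h1 _.
  have := reg_uniq (h2 _) (reg_sub hx (reg_const X (px Y))) => e.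
  apply/eqP; rewrite -subr_eq0 -e //; rewrite /xord; case: ifP => _; lia.
have nz := ae_pyc (py Y).
have [|k [k0 hk]] := @reg0_ord Y _ _ nz.
  by rewrite -[X in reg _ _ X](subrr (py Y)); apply: reg_sub (reg_py hY) (reg_const Y _).
have h2 := ord_pos_reg (H _ _ hk) _.
have := reg_uniq (h2 _) (reg_sub hy (reg_const X (py Y))) => e.
apply/eqP; rewrite -subr_eq0 -e //; lia.
Qed.

Lemma prin4 A B C D : prin (fun X => dv A X + dv B X - dv C X - dv D X) -> A + B = C + D.
Proof.
move=> h; apply: prin_sep.
have := prin_add (prin_sub h (prin_line A B)) (prin_line C D).
move/prin_ext; apply=> X; rewrite -[A + B]/(padd A B) -[C + D]/(padd C D); lia.
Qed.

(** * Translations *)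

Definition tr S : pt -> pt := fun X => X + S.

Lemma finfib_tr S : finfib (tr S).
Proof. by move=> Y; exists [:: Y - S] => X <-; rewrite inE /tr addrK. Qed.

Lemma rmap_tr S : rmap (tr S).
Proof. exact: rmap_rcoord (rcoord_add rcoord_id (rcoord_const S)) (@finfib_tr S). Qed.

Lemma ae_tr S (P : pt -> Prop) : ae P -> ae (fun X => P (X + S)).
Proof. exact: ae_comp (@finfib_tr S). Qed.

Lemma finfib_opp : finfib (fun X => - X).
Proof. by move=> Y; exists [:: - Y] => X <-; rewrite inE opprK. Qed.

Lemma ae_opp (P : pt -> Prop) : ae P -> ae (fun X => P (- X)).
Proof. exact: ae_comp finfib_opp. Qed.

(** Translations by S and -S are inverse to each other, so their ramification indices multiply to
    1. *)
Lemma pull_tr_ex S X : exists2 Y, pull (tr S) X Y 1 & pull (tr (- S)) Y X 1.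
Proof.
have [Y [m h]] := pull_ex X (rmap_tr S); have [Z [k h']] := pull_ex Y (rmap_tr (- S)).
have e W : tr (- S) (tr S W) = id W by rewrite /tr addrK.
have [eZ] := pull_uniq (pull_ext (pull_comp h h') e) (pull_id X).
by move/eqP; rewrite muln_eq1 => /andP [/eqP ek /eqP em]; subst; exists Y.
Qed.

(* An automorphism of the curve preserves principal divisors, hence is affine;
   the generic value of [tr S] then determines it. *)
Lemma pull_tr S X : pull (tr S) X (X + S) 1.
Proof.
(* rho is the inverse of the extension of [tr S]; the goal becomes rho W = W - S for every W. *)
have [|rho Hrho] := @choice _ _ (fun U V => pull (tr (- S)) U V 1 /\ pull (tr S) V U 1).
  by move=> U; have [V] := pull_tr_ex (- S) U; rewrite opprK; exists V.
have rhoP U V W : pull (tr S) V W 1 -> dv U W = dv (rho U) V.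
  move=> h; rewrite /dv; congr (Posz (nat_of_bool _)); have [_ hU] := Hrho U.
  apply/eqP/eqP => [e|e]; last by rewrite e in h; have [] := pull_uniq h hU.
  rewrite e in h; have [V' h1 h2] := pull_tr_ex S V.
  have [e1 _] := pull_uniq h1 h; rewrite e1 in h2.
  by have [hU' _] := Hrho U; have [-> _] := pull_uniq h2 hU'.
(* Pulling back the principal divisor (U) + (V) - (U + V) - (O) replaces each point by its image
   under rho. *)
have rho_add U V : rho U + rho V = rho (U + V) + rho 0.
  apply: prin4; have [f H] := prin_line U V; exists (fun Y => f (tr S Y)) => Y.
  have [W h _] := pull_tr_ex S Y; have [_ hf] := h.
  by have := hf _ _ (H W); rewrite mulr1 !(rhoP _ _ _ h).
have gen : ae (fun U => rho U = U - S).
  apply: (ae1 (pull_generic (rmap_tr (- S)))) => U [m h].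
  by have [h' _] := Hrho U; have [-> _] := pull_uniq h' h.
have rho0 : rho 0 = - S.
  have [V hV] := ae_ex gen.
  have [U [hU hUV]] := ae_ex (ae2 gen (ae_tr V gen) (fun U p q => conj p q)).
  have := rho_add U V; rewrite hU hV hUV addrACA -[in RHS]addrA => /addrI.
  by move/addrI.
(* W is the sum of U and -(U - W), and for almost all U the formula is known at both. *)
have rhoE W : rho W = W - S.
  have [U [hU hW]] := ae_ex (ae2 gen (ae_tr (- W) (ae_opp gen)) (fun U p q => conj p q)).
  have e0 : U - (U - W) = W by rewrite opprB addrCA subrr addr0.
  have := rho_add U (- (U - W)); rewrite e0 hU hW rho0 => e; apply: (addIr (- S)).
  by rewrite -e opprB addrACA [U + (W - U)]addrCA subrr addr0 addrA.
have [W h h'] := pull_tr_ex S X; have [h1 _] := Hrho W.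
by have [e _] := pull_uniq h' h1; rewrite {2}e rhoE subrK.
Qed.

Lemma ord_tr S X f n : ord (X + S) f n -> ord X (fun Y => f (Y + S)) n.
Proof. by move=> h; have [_ H] := pull_tr S X; have := H _ _ h; rewrite mulr1. Qed.

Lemma rat_tr S f : rational f -> rational (fun Y => f (Y + S)).
Proof. exact: rat_comp (rmap_tr S). Qed.

(** * Multiplication by k: unramified and surjective *)

Section Multiplication.
Variable k : nat.
Hypothesis ker_fin : exists s : seq pt, forall X, X *+ k = 0 -> X \in s.

Lemma finfib_mulrn : finfib (fun X => X *+ k).
Proof.
move=> Y; have [s H] := ker_fin.
have [[X0 e]|ne] := pselect (exists X, X *+ k = Y); last first.
  by exists [::] => X e; case: ne; exists X.
exists (map (fun Z => Z + X0) s) => X eX; apply/mapP; exists (X - X0); last by rewrite subrK.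
by apply: H; rewrite mulrnBl eX e subrr.
Qed.

Lemma rmap_mulrn : rmap (fun X => X *+ k).
Proof. exact: rmap_rcoord (rcoord_mulrn k) finfib_mulrn. Qed.

(** The leading coefficients of a' q and a q' differ by the factors deg a and deg q, which must
    agree in characteristic 0. *)
Lemma wronskian_size (a q : {poly F}) : a != 0 -> q != 0 ->
  a^`() * q = a * q^`() -> size a = size q.
Proof.
move=> a0 q0 e.
have ch := cubic_char0 c.
have sa : (0 < size a)%N by rewrite size_poly_gt0.
have sq : (0 < size q)%N by rewrite size_poly_gt0.
have cst (r t : {poly F}) : t != 0 -> t * r^`() = 0 -> (size r <= 1)%N.
  move=> t0 /eqP; rewrite mulf_eq0 (negPf t0) => /eqP; exact: deriv_eq0.
have dC (r : {poly F}) : (size r <= 1)%N -> r^`() = 0.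
  by move=> sr; rewrite (size1_polyC sr) derivC.
case: (leqP (size a) 1) => s1.
  have := cst q a a0; rewrite -e dC // mul0r => /(_ erefl); lia.
case: (leqP (size q) 1) => s2.
  have := cst a q q0; rewrite mulrC e dC // mulr0 => /(_ erefl); lia.
have [i ai] : exists i, size a = i.+2 by exists (size a).-2; lia.
have [j qj] : exists j, size q = j.+2 by exists (size q).-2; lia.
have sda : (size a^`() <= i.+1)%N by have := lt_size_deriv a0; rewrite ai.
have sdq : (size q^`() <= j.+1)%N by have := lt_size_deriv q0; rewrite qj.
have la : a`_i.+1 != 0 by rewrite -[i.+1]/(i.+2.-1) -ai -/(lead_coef a) lead_coef_eq0.
have lq : q`_j.+1 != 0 by rewrite -[j.+1]/(j.+2.-1) -qj -/(lead_coef q) lead_coef_eq0.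
have := congr1 (fun r : {poly F} => r`_(i + j.+1)) e.
rewrite (coefM_top sda) ?qj // addnS -addSn (coefM_top _ sdq) ?ai // !coef_deriv.
move/eqP; rewrite -[a`_i.+1 *+ _]mulr_natr -[q`_j.+1 *+ _]mulr_natr -subr_eq0.
have -> : a`_i.+1 * i.+1%:R * q`_j.+1 - a`_i.+1 * (q`_j.+1 * j.+1%:R) =
  (a`_i.+1 * q`_j.+1) * (i.+1%:R - j.+1%:R) by ring.
rewrite !mulf_eq0 (negPf la) (negPf lq) /= subr_eq0.
wlog ij : i j {ai qj sda sdq la lq} / (i <= j)%N.
  by move=> H; case: (leqP i j) => [/H //|/ltnW /H h]; rewrite eq_sym => /h.
rewrite eq_sym -subr_eq0 -natrB ?ltnS //; have /pcharf0P -> := ch.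
by rewrite subSS subn_eq0 => ji; congr _.+2; apply/eqP; rewrite eqn_leq ij.
Qed.

(** Subtracting the multiple of q that kills the leading term of a keeps the Wronskian relation but
    lowers the degree, so the difference is 0. *)
Lemma wronskian_const (a q : {poly F}) : q != 0 -> a^`() * q = a * q^`() ->
  exists v, a = v *: q.
Proof.
move=> q0 e; have [->|a0] := eqVneq a 0; first by exists 0; rewrite scale0r.
pose v := lead_coef a / lead_coef q.
have v0 : v != 0 by rewrite mulf_neq0 ?invr_neq0 ?lead_coef_eq0.
have sz := wronskian_size a0 q0 e.
exists v; apply/eqP; rewrite -subr_eq0; apply: contraT => b0.
have : (size (a - v *: q)%R < size q)%N.
  rewrite ltn_neqAle; apply/andP; split; last first.
    by apply: leq_trans (size_polyD _ _) _; rewrite size_polyN size_scale // sz maxnn.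
  apply/eqP => s'; have := lead_coef_eq0 (a - v *: q); rewrite (negPf b0) /lead_coef s'.
  by rewrite coefB coefZ -{1}sz /v /lead_coef mulfVK ?subrr ?eqxx // -/(lead_coef q) lead_coef_eq0.
rewrite (_ : size (a - v *: q) = size q) ?ltnn //; apply: wronskian_size => //.
rewrite derivB derivZ !mulrBl e; congr (_ - _).
by rewrite -!scalerAl mulrC.
Qed.

(* By translation the ramification index is the same at all points; it is 1
   where the derivative of x([k]X) as a function of x does not vanish. *)
Lemma pull_mulrn X : pull (fun Y => Y *+ k) X (X *+ k) 1.
Proof.
have rm := rmap_mulrn; have [rx _ fa] := rm.
have [a [b [q [q0 h]]]] := rx.
(* x([k]X) is invariant under X -> -X, hence is a function a / q of x alone. *)
have b0 : b = 0.
  have [_ e] : a = a /\ b = - b.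
    apply: (@ev_inj F c); apply: (ae2 h (ae_opp h)) => Y <-.
    rewrite mulNrn !pxN => ->; by rewrite /ev pxN pyN !hornerE /= mulrN mulNr.
  apply/polyP => i; rewrite coef0; apply: (mulfI (two_neq0 c)).
  have := congr1 (fun r : {poly F} => r`_i) e; rewrite coefN => e'.
  by rewrite mulr0 mulr_natl mulr2n {1}e' addNr.
(* This is the numerator of the derivative of a / q; if it vanished, x([k]X) would be constant,
   against finite fibres. *)
have W0 : a^`() * q - a * q^`() != 0.
  rewrite subr_eq0; apply/eqP => /(wronskian_const q0) [v av].
  apply: ae_False; apply: (ae3 h (ae_comp fa (ae_px_neq c v)) (ae_poly c q0)) => Y + + qY.
  by rewrite b0 evC av hornerZ => /(mulIf qY) ->; rewrite eqxx.
have [X0 [[[m hm] eX0] [[WX yX] [yk [qX X0n]]]]] : exists X0, ((exists m, pull (fun Y => Y *+ k) X0 (X0 *+ k) m) /\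
    px (X0 *+ k) * q.[px X0] = ev a b X0) /\
    (((a^`() * q - a * q^`()).[px X0] != 0 /\ py X0 != 0) /\ (py (X0 *+ k) != 0 /\
      (q.[px X0] != 0 /\ X0 != 0))).
  apply: ae_ex; apply: (ae2 (ae2 (pull_generic rm) h (fun _ p q => conj p q))
    (ae2 (ae2 (ae_poly c W0) (ae_py c) (fun _ p q => conj p q))
     (ae2 (ae_comp fa (ae_py c)) (ae2 (ae_poly c q0) (ae_neq 0) (fun _ p q => conj p q))
       (fun _ p q => conj p q)) (fun _ p q => conj p q)) (fun _ p q => conj p q)).
have m1 : m = 1%N.
  have [m0 H] := hm; have hY : X0 *+ k != 0 by apply: contraNneq yk => ->.
  have := H _ _ (ord_pxsub hY); rewrite /xord (negPf yk) mul1r.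
  set v := px (X0 *+ k) => hv; rewrite b0 evC -/v in eX0.
  (* The derivative of a - v q at x(X0) is the Wronskian divided by q(x(X0)), so the root is simple
     and x([k]Y) - v has order 1 at X0. *)
  have /factor_theorem [r rE] : root (a - v *: q) (px X0).
    by rewrite rootE !hornerE eX0 subrr.
  have rX : r.[px X0] != 0.
    apply: contraNneq WX => z; have := congr1 (fun t : {poly F} => (t^`()).[px X0]) rE.
    rewrite derivM derivXsubC derivB derivZ !hornerE z subrr mulr0 add0r => /eqP.
    rewrite subr_eq0 => /eqP e; rewrite -eX0 e; apply/eqP; ring.
  have h1 := ord_mul (reg_ord0 (reg_poly r (reg_px X0n)) rX) (ord_pxsub X0n).
  have := ord_div h1 (reg_ord0 (reg_poly q (reg_px X0n)) qX).
  rewrite /xord (negPf yX) add0r subr0 => h2.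
  suff: (1%:Z = m%:Z) by case.
  apply: ord_uniq hv; apply: ord_ext h2 _.
  apply: (ae2 h (ae_poly c q0)) => Y; rewrite b0 evC => e qY.
  apply: (mulIf qY); rewrite mulfVK // mulrBl e.
  have := congr1 (fun t : {poly F} => t.[px Y]) rE; by rewrite !hornerE => <-.
(* Translation by S before [k] equals translation by kS after it, which carries index 1 from X0 to
   X. *)
rewrite m1 in hm; pose S := X - X0.
have [Y [j hY]] := pull_ex X rm.
have h1 := pull_comp (pull_tr S X0) (_ : pull _ _ _ _); rewrite /S addrC subrK in h1.
have h2 := pull_comp hm (pull_tr (S *+ k) (X0 *+ k)).
have e Z : tr S Z *+ k = tr (S *+ k) (Z *+ k) by rewrite /tr mulrnDl.
have [eY ej] := pull_uniq (pull_ext (h1 _ _ _ hY) e) h2.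
move: hY; rewrite eY -[j]muln1 ej /S mulrnBl addrC subrK; exact.
Qed.

Lemma ord_mulrn X f n : ord (X *+ k) f n -> ord X (fun Y => f (Y *+ k)) n.
Proof. by move=> h; have [_ H] := pull_mulrn X; have := H _ _ h; rewrite mulr1. Qed.

(** If Y, and hence -Y, were not in the image, 1 / (x([k]X) - x(Y)) would have no pole and be
    constant. *)
Lemma mulrn_surj Y : exists X, X *+ k = Y.
Proof.
have [->|hY] := eqVneq Y 0; first by exists 0; rewrite mul0rn.
have [rx _ fa] := rmap_mulrn.
have [//|ne] := pselect (exists X, X *+ k = Y); exfalso.
have ne' X : X *+ k != Y by apply/eqP => e; apply: ne; exists X.
have ne2 X : X *+ k != - Y by apply/eqP => e; apply: (ne); exists (- X); rewrite mulNrn e opprK.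
have [||v e] := @const_of_regular F c (fun X => (px (X *+ k) - px Y)^-1).
- exact: rat_inv (rat_sub rx (rat_const c _)).
- move=> X; have := ord_inv (ord_mulrn (ord_vert (X *+ k) hY)).
  move/ord_ordge; apply; rewrite /dv (negPf (ne' X)) (negPf (_ : X *+ k != popp Y)) ?ne2 //; lia.
apply: ae_False; apply: (ae2 e (ae_comp fa (ae_px_neq c (v^-1 + px Y)))) => X <-.
by rewrite invrK subrK eqxx.
Qed.

End Multiplication.

End RationalMaps.

(** * Properties of the Weil pairing *)

Section Algebraic.
Variables (F : closedFieldType) (c : cubic F).
Local Notation pt := (pt c).
Local Notation d := (cpoly c).
Implicit Types (X Y S T U : pt) (f g h u : pt -> F) (n : int) (v w : F).

Lemma ae_forall (n : nat) (P : nat -> pt -> Prop) :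
  (forall i, (i < n)%N -> ae (P i)) -> ae (fun X => forall i, (i < n)%N -> P i X).
Proof.
elim: n => [|n IH] H; first exact: aeW.
apply: (ae2 (IH (fun i hi => H i (ltnW hi))) (H n (ltnSn n))) => X h1 h2 i.
by rewrite ltnS leq_eqVlt => /orP [/eqP ->|/h1].
Qed.

(** Over an algebraically closed field q splits, and one factor f - z must vanish since the function
    field is a domain. *)
Lemma const_of_root f (q : {poly F}) : rational f -> q != 0 ->
  ae (fun X => q.[f X] = 0) -> exists v, ae (fun X => f X = v).
Proof.
move=> rf q0; have [r qE] := closed_field_poly_normal q => h.
have: ae (fun X => \prod_(z <- r) (f X - z) = 0).
  apply: (ae1 h) => X; rewrite qE hornerZ => /eqP.
  rewrite mulf_eq0 lead_coef_eq0 (negPf q0) /= horner_prod => /eqP <-.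
  by apply: eq_bigr => z _; rewrite !hornerE.
elim: r {qE h} => [|z r IH] h.
  by exfalso; apply: ae_False; apply: (ae1 h) => X /eqP; rewrite big_nil oner_eq0.
have [z0|nz] := rat_dich (rat_sub rf (rat_const c z)).
  by exists z; apply: (ae1 z0) => X /eqP; rewrite subr_eq0 => /eqP.
apply: IH; apply: (ae2 h nz) => X /eqP; rewrite big_cons mulf_eq0.
by move=> /orP [/eqP -> /eqP //|/eqP].
Qed.

Lemma ord_prod X (n : nat) (h : nat -> pt -> F) (D : nat -> int) :
  (forall i, (i < n)%N -> ord X (h i) (D i)) ->
  ord X (fun Y => \prod_(i < n) h i Y) (\sum_(i < n) D i).
Proof.
elim: n => [|n IH] H.
  rewrite big_ord0; apply: ord_ext (ord_const X (oner_neq0 _)) _.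
  by apply: aeW => Y; rewrite big_ord0.
rewrite big_ord_recr; apply: ord_ext (ord_mul (IH (fun i hi => H i (ltnW hi))) (H n (ltnSn n))) _.
by apply: aeW => Y; rewrite big_ord_recr.
Qed.

(** Every point is a sum of two points outside any given finite set. *)
Lemma ae_all_of_ae (P : pt -> Prop) : ae P -> (forall X Y, P X -> P Y -> P (X + Y)) ->
  forall X, P X.
Proof.
move=> h H W; have h' := ae_tr (- W) (ae_opp h).
have [U [hU hW]] := ae_ex (ae2 h h' (fun U p q => conj p q)).
have -> : W = U + - (U - W) by rewrite opprB addrCA subrr addr0.
exact: H.
Qed.

Lemma two_torsion x : d.[x] = 0 -> exists E : pt, [/\ E != 0, px E = x, py E = 0 & E *+ 2 = 0].
Proof.
move=> dx; have h : (0 : F) ^+ 2 = d.[x] by rewrite dx expr0n.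
have nO := ptA_neqO h; exists (ptA h); split=> //.
have /eqP fix0 : popp (ptA h) == ptA h by rewrite popp_fix // pyA.
by rewrite mulr2n -{2}fix0; apply: (paddN (ptA h)).
Qed.

Lemma cubic_roots : exists x1 x2 : F, [/\ d.[x1] = 0, d.[x2] = 0 & x1 != x2].
Proof.
have [x1 /rootP r1] : exists x, root d x by apply/closed_rootP; rewrite cubic_size.
have [q qE q1] := cubic_simple_root r1.
have q0 : q != 0 by apply: contraNneq (cubic_neq0 c) => e; rewrite qE e mul0r.
have [x2 /rootP r2] : exists x, root q x.
  apply/closed_rootP; have := cubic_size c; rewrite qE size_Mmonic ?monicXsubC // size_XsubC addn2 /=.
  by case=> ->.
exists x1, x2; split=> //; first by rewrite qE hornerM r2 mul0r.
by apply: contraNneq q1 => ->; rewrite r2.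
Qed.

Lemma two_ker_fin : exists s : seq pt, forall X, X *+ 2 = 0 -> X \in s.
Proof.
have [s H] := ae_py c; exists (0 :: s) => X h; rewrite inE; have [//|hX] := eqVneq X 0.
apply: contraT => /H; rewrite -popp_fix //.
by move: h; rewrite mulr2n => /eqP; rewrite addr_eq0 eq_sym => ->.
Qed.

(** A point of order 2 survives odd multiples; for even n, a point that works for n / 2 is halved by
    surjectivity of doubling. *)
Lemma exponent_unbounded (n : nat) : (0 < n)%N -> exists X : pt, X *+ n != 0.
Proof.
have [x1 [_ [/two_torsion [E [E0 _ _ E2]] _ _]]] := cubic_roots.
have [k] := ubnP n; elim: k n => // k IH n nk n0.
have [on|en] := boolP (odd n).
  exists E; rewrite -(odd_double_half n) on mulrnDr -mul2n mulrnA E2 mul0rn addr0; exact: E0.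
have nE : n = (n./2 * 2)%N by rewrite muln2 -{1}(odd_double_half n) (negPf en).
have [||X hX] := IH n./2; [lia|lia|].
have [Y hY] := mulrn_surj two_ker_fin X; exists Y.
by rewrite nE mulnC mulrnA hY.
Qed.

(** * Bilinearity, antisymmetry and nondegeneracy on p-torsion *)

Section Torsion.
Variable p : nat.
Hypothesis p_odd : odd p.
Hypothesis p_gt1 : (1 < p)%N.
Hypothesis ker_fin : exists s : seq pt, forall X, X *+ p = 0 -> X \in s.

(* If [p] were injective then x([p]X) would be a linear polynomial in x fixing
   the roots of the cubic, so [p]X = X or -X, and p^2 - 1 would kill the curve. *)
Lemma torsion_nontrivial : exists2 T : pt, T != 0 & T *+ p = 0.
Proof.
have [//|ne] := pselect (exists2 T : pt, T != 0 & T *+ p = 0); exfalso.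
have inj X : X != 0 -> X *+ p != 0.
  by move=> hX; apply/eqP => e; apply: ne; exists X.
have [rx ry fa] := rmap_mulrn ker_fin.
have regx X : X != 0 -> reg X (fun Y => px (Y *+ p)) (px (X *+ p)).
  move=> hX; apply: reg_of_ordge.
  apply: ord_ordge (ord_mulrn ker_fin (ord_pxsub (inj X hX))) _.
  by rewrite /xord; case: ifP.
have [|a [b e]] := pol_of_regular rx.
  by move=> X hX; apply: reg_ordge0 (regx X hX).
have h0 : ordge (0 : pt) (ev a b) (- 2%N%:Z).
  apply: ordge_ext e; apply: ord_ordge (ord_mulrn ker_fin _) (lexx _).
  rewrite mul0rn; exact: ordO_px.
have [ha hb] := ordO_ev_le h0.
have b0 : b = 0 by apply/eqP; apply: contraT => /hb; lia.
have sa : (size (a - 'X)%R <= 2)%N.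
  apply: leq_trans (size_polyD _ _) _; rewrite size_polyN size_polyX geq_max leqnn andbT.
  by have [->|/ha] := eqVneq a 0; [rewrite size_poly0|lia].
(* As p is odd, [p] fixes the points of order 2. *)
have aX x : d.[x] = 0 -> a.[x] = x.
  move=> /two_torsion [E [E0 Ex _ E2]].
  have Ep : E *+ p = E.
    by rewrite -(odd_double_half p) p_odd mulrnDr -mul2n mulrnA E2 mul0rn addr0.
  have := regx E E0; rewrite Ep Ex => h.
  have := reg_uniq (reg_ext h e) (reg_ev a b E0).
  by rewrite b0 evC Ex.
have aE : a = 'X.
  have [x1 [x2 [r1 r2 ne12]]] := cubic_roots.
  apply/eqP; rewrite -subr_eq0; apply: contraT => nz.
  have := max_poly_roots nz; move/(_ [:: x1; x2]); rewrite /= !rootE !hornerE !aX // !subrr eqxx.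
  by rewrite inE ne12 => /(_ isT isT); rewrite ltnNge sa.
have pp : forall X, X *+ (p * p) = X.
  apply: ae_all_of_ae => [|X Y hX hY]; last by rewrite mulrnDl hX hY.
  apply: (ae2 e (ae_neq 0)) => X; rewrite b0 aE evC hornerX => ex hX.
  rewrite mulrnA; have [e1|e1] := px_eq (inj X hX) hX ex; first by rewrite !e1.
  by rewrite e1 -[popp X]/(- X) mulNrn e1 -[popp X]/(- X) opprK.
have [|X] := @exponent_unbounded (p * p).-1; first by nia.
have e1 : X *+ (p * p).-1 + X = X by rewrite -mulrSr prednK ?pp //; nia.
by move=> /eqP; apply; apply: (addIr X); rewrite e1 add0r.
Qed.

Variables (e : pt -> pt -> F) (f g : pt -> pt -> F).
Hypothesis f_ord : forall T X, T *+ p = 0 -> ord X (f T) (p%:Z * dv T X - p%:Z * dv 0 X).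
Hypothesis g_rat : forall T, T *+ p = 0 -> rational (g T).
Hypothesis fg : forall T, T *+ p = 0 -> ae (fun X => f T (X *+ p) = g T X ^+ p).
Hypothesis g_tr : forall S T, S *+ p = 0 -> T *+ p = 0 ->
  ae (fun X => g T (X + S) = e S T * g T X).

Let p_gt0 : (0 < p)%N. Proof. exact: ltnW. Qed.
Let fib := @finfib_mulrn F c p ker_fin.

Lemma f_neq0 T : T *+ p = 0 -> ae (fun X => f T X != 0).
Proof. by move=> hT; apply: ord_neq0 (f_ord 0 hT). Qed.

Lemma g_neq0 T : T *+ p = 0 -> ae (fun X => g T X != 0).
Proof.
move=> hT; apply: (ae2 (fg hT) (ae_comp fib (f_neq0 hT))) => X -> .
by rewrite expf_eq0 p_gt0.
Qed.

Lemma weil_add S S' T : S *+ p = 0 -> S' *+ p = 0 -> T *+ p = 0 ->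
  e (S + S') T = e S T * e S' T.
Proof.
move=> hS hS' hT; have hSS : (S + S') *+ p = 0 by rewrite mulrnDl hS hS' addr0.
have [X [[h1 h2] [h3 h4]]] := ae_ex (ae2 (ae2 (g_tr hSS hT) (g_tr hS' hT) (fun X p q => conj p q))
  (ae2 (ae_tr S' (g_tr hS hT)) (g_neq0 hT) (fun X p q => conj p q)) (fun X p q => conj p q)).
apply: (mulIf h4); rewrite -h1 -mulrA -h2 -h3 -addrA; congr (g T (_ + _)); exact: addrC.
Qed.

Lemma weil_0 T : T *+ p = 0 -> e 0 T = 1.
Proof.
move=> hT; have [X [h1 h2]] := ae_ex (ae2 (g_tr (mul0rn _ p) hT) (g_neq0 hT) (fun X p q => conj p q)).
by apply: (mulIf h2); rewrite -h1 addr0 mul1r.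
Qed.

Lemma weil_mulrn S T (n : nat) : S *+ p = 0 -> T *+ p = 0 -> e (S *+ n) T = e S T ^+ n.
Proof.
move=> hS hT; elim: n => [|n IH]; first by rewrite mulr0n weil_0.
by rewrite mulrS weil_add // ?IH ?exprS // mulrnAC hS mul0rn.
Qed.

Lemma weil_exp S T : S *+ p = 0 -> T *+ p = 0 -> e S T ^+ p = 1.
Proof. by move=> hS hT; rewrite -weil_mulrn // hS weil_0. Qed.

Lemma weil_neq0 S T : S *+ p = 0 -> T *+ p = 0 -> e S T != 0.
Proof.
move=> hS hT; have := oner_neq0 F; rewrite -(weil_exp hS hT); apply: contraNneq => ->.
by rewrite expr0n; case: p p_gt0.
Qed.

Lemma torN T : T *+ p = 0 -> (- T) *+ p = 0.
Proof. by move=> h; rewrite mulNrn h oppr0. Qed.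

Lemma weil_opp S T : S *+ p = 0 -> T *+ p = 0 -> e (- S) T = (e S T)^-1.
Proof.
move=> hS hT; apply: (mulIf (weil_neq0 hS hT)); rewrite -weil_add ?torN // addNr weil_0 //.
by rewrite mulVf // weil_neq0.
Qed.

(** The divisors p(S) - p(O) and p(S+T) - p(S) above cancel p(T) - p(O) and p(S+T) - p(T) below. *)
Lemma commutator_const S T : S *+ p = 0 -> T *+ p = 0 -> exists2 v, v != 0 &
  ae (fun Y => f S Y * f T (Y - S) / (f T Y * f S (Y - T)) = v).
Proof.
move=> hS hT; apply: const_of_ord0 => X.
have dvE (A B : pt) : dv A (X - B) = dv (A + B) X by rewrite /dv subr_eq.
have := ord_div (ord_mul (f_ord X hS) (ord_tr (f_ord (X - S) hT)))
                (ord_mul (f_ord X hT) (ord_tr (f_ord (X - T) hS))).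
rewrite !dvE !add0r [T + S]addrC; congr (ord _ _ _); ring.
Qed.

(** The i-th factor has divisor p((i+1)S) - p(iS), and the sum telescopes around the cycle generated
    by S. *)
Lemma cycle_const S : S *+ p = 0 -> exists2 v, v != 0 &
  ae (fun Y => \prod_(i < p) f S (Y - S *+ i) = v).
Proof.
move=> hS; apply: const_of_ord0 => X.
have := @ord_prod X p (fun i Y => f S (Y - S *+ i)) _ (fun i _ => ord_tr (f_ord (X - S *+ i) hS)).
suff -> : \sum_(i < p) (p%:Z * dv S (X - S *+ i) - p%:Z * dv 0 (X - S *+ i)) = 0 by [].
pose D i := p%:Z * dv (S *+ i) X.
have DE i : p%:Z * dv S (X - S *+ i) - p%:Z * dv 0 (X - S *+ i) = D i.+1 - D i.
  by rewrite /D /dv !subr_eq add0r mulrS.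
under eq_bigr do rewrite DE.
rewrite -(big_mkord xpredT (fun i => D i.+1 - D i)) telescope_sumr //.
by rewrite /D hS mulr0n subrr.
Qed.

Lemma root_const h v : rational h -> ae (fun X => h X ^+ p = v) -> exists2 w, w ^+ p = v & ae (fun X => h X = w).
Proof.
move=> rh hh; have q0 : 'X^p - v%:P != 0 :> {poly F}.
  by rewrite -size_poly_gt0 size_XnsubC.
have [|w hw] := const_of_root rh q0.
  by apply: (ae1 hh) => X e1; rewrite !hornerE ?hornerXn e1 subrr.
exists w => //; have [X [h1 h2]] := ae_ex (ae2 hh hw (fun X p q => conj p q)).
by rewrite -h2.
Qed.

(** The p-th power of this product at X is the product of [cycle_const] at pX. *)
Lemma cycle_root_const S S' : S *+ p = 0 -> S' *+ p = S -> exists2 w, w != 0 &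
  ae (fun Y => \prod_(i < p) g S (Y - S' *+ i) = w).
Proof.
move=> hS hS'; have [v v0 hv] := cycle_const hS.
have rM : rational (fun Y => \prod_(i < p) g S (Y - S' *+ i)).
  by apply: rat_prod => i _; apply: (rat_tr (- (S' *+ i)) (g_rat hS)).
have [|w wv hw] := root_const (v := v) rM.
  have hi := @ae_forall p (fun i X => f S ((X - S' *+ i) *+ p) = g S (X - S' *+ i) ^+ p)
    (fun i _ => ae_tr _ (fg hS)).
  apply: (ae2 hi (ae_comp fib hv)) => X h <-.
  rewrite -prodrXl; apply: eq_bigr => i _; rewrite -h //; congr (f S _).
  by rewrite mulrnBl mulrnAC hS'.
exists w => //; apply: contraNneq v0 => w0; rewrite -wv w0 expr0n; by case: p p_gt0.
Qed.

(* Pulling back along [p] and extracting a p-th root gives the constant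
   g_S(X) g_T(X-S') / (g_T(X) g_S(X-T')) with pS' = S and pT' = T; in its product
   over the translates X - iS' only g_T(X-S) / g_T(X) survives. *)
Lemma commutator_weil S T v : S *+ p = 0 -> T *+ p = 0 ->
  ae (fun Y => f S Y * f T (Y - S) / (f T Y * f S (Y - T)) = v) -> e (- S) T = v.
Proof.
move=> hS hT hv.
have [S' hS'] := mulrn_surj ker_fin S; have [T' hT'] := mulrn_surj ker_fin T.
pose k X := g S X * g T (X - S') / (g T X * g S (X - T')).
have rk : rational k.
  apply: rat_div; apply: rat_mul; try exact: g_rat.
    exact: (rat_tr (- S') (g_rat hT)).
  exact: (rat_tr (- T') (g_rat hS)).
have [|k0 k0p hk] := root_const (v := v) rk.
  apply: (ae2 (ae_comp fib hv) (ae4 (fg hS) (fg hT) (ae_tr (- S') (fg hT)) (ae_tr (- T') (fg hS))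
    (fun X p q r s => conj p (conj q (conj r s))))) => X <- [h1 [h2 [h3 h4]]].
  have eS : X *+ p - S = (X - S') *+ p by rewrite mulrnBl hS'.
  have eT : X *+ p - T = (X - T') *+ p by rewrite mulrnBl hT'.
  by rewrite h1 h2 eS eT h3 h4 /k expr_div_n !exprMn.
have [M M0 hM] := cycle_root_const hS hS'.
have hi := @ae_forall p (fun i X => k (X - S' *+ i) = k0) (fun i _ => ae_tr _ hk).
have hj := @ae_forall p.+1 (fun i X => g T (X - S' *+ i) != 0) (fun i _ => ae_tr _ (g_neq0 hT)).
have [X [[h1 h2] [h3 [h4 h5]]]] := ae_ex (ae2 (ae2 hi hj (fun X p q => conj p q))
  (ae3 hM (ae_tr (- T') hM) (g_tr (torN hS) hT) (fun X p q r => conj p (conj q r)))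
  (fun X p q => conj p q)).
have tele (n : nat) : (n <= p)%N -> \prod_(i < n) (g T (X - S' *+ i - S') / g T (X - S' *+ i))
   = g T (X - S' *+ n) / g T X.
  elim: n => [|n IH] hn; first by rewrite big_ord0 mulr0n subr0 divff // -[X]subr0; apply: (h2 0%N).
  rewrite big_ord_recr /= IH ?(ltnW hn) //.
  have -> : X - S' *+ n - S' = X - S' *+ n.+1 by rewrite mulrSr opprD addrA.
  by rewrite mulrC mulrA mulfVK // h2 // leqW.
have gX : g T X != 0 by have := h2 0%N isT; rewrite mulr0n subr0.
have: \prod_(i < p) k (X - S' *+ i) = v.
  rewrite (eq_bigr (fun=> k0)) ?prodr_const ?card_ord // => i _; exact: h1.
have -> : \prod_(i < p) k (X - S' *+ i) =
    (\prod_(i < p) g S (X - S' *+ i)) / (\prod_(i < p) g S (X - T' - S' *+ i)) *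
    \prod_(i < p) (g T (X - S' *+ i - S') / g T (X - S' *+ i)).
  rewrite -prodfV -!big_split /=; apply: eq_bigr => i _; rewrite /k.
  have -> : X - S' *+ i - T' = X - T' - S' *+ i by rewrite addrAC.
  rewrite invfM; ring.
(* The two products of g_S are the constant M, taken at X and at X - T'. *)
by rewrite h3 h4 divff // mul1r tele // hS' h5 mulfK.
Qed.

(** Interchanging S and T inverts the commutator, and additivity in the first argument removes the
    signs. *)
Lemma weil_antisym S T : S *+ p = 0 -> T *+ p = 0 -> e S T * e T S = 1.
Proof.
move=> hS hT; have [v v0 hv] := commutator_const hS hT.
have e1 := commutator_weil hS hT hv.
have e2 : e (- T) S = v^-1.
  by apply: commutator_weil => //; apply: (ae1 hv) => X <-; rewrite invf_div.
by apply: invr_inj; rewrite invfM invr1 -!weil_opp // e1 e2 divff.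
Qed.

(** Antisymmetry only gives e(T,T)^2 = 1; since e(T,T)^p = 1 with p odd, the value is 1. *)
Lemma weil_alt T : T *+ p = 0 -> e T T = 1.
Proof.
move=> hT; have h2 : e T T ^+ 2 = 1 by rewrite expr2 weil_antisym.
have := weil_exp hT hT; rewrite -(odd_double_half p) p_odd exprD expr1 -mul2n exprM h2.
by rewrite expr1n mulr1.
Qed.

(* By invariance the poles of [h] at the torsion points all look like the one at
   the origin, where [g T] has a simple pole: subtract multiples of its powers. *)
Lemma invariant_poly T h (n : nat) : T != 0 -> T *+ p = 0 -> (forall S, S *+ p = 0 -> e S T = 1) ->
  (forall S, S *+ p = 0 -> ae (fun X => h (X + S) = h X)) ->
  (forall X, X *+ p != 0 -> ordge X h 0) -> ordge (0 : pt) h (- n%:Z) ->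
  exists R : {poly F}, ae (fun X => h X = R.[g T X]).
Proof.
move=> T0 hT e1.
(* Since [p] is unramified, p times this order is the order of f_T at [p]X. *)
have og X : ord X (g T) (dv T (X *+ p) - dv 0 (X *+ p)).
  have [m hm] := ord_ex X (g_rat hT) (g_neq0 hT).
  have := ord_uniq (ord_exp p hm) (ord_ext (ord_mulrn ker_fin (f_ord (X *+ p) hT)) (fg hT)).
  rewrite -mulrBr mulrC => /mulfI <- //; lia.
have og0 : ord (0 : pt) (g T) (-1).
  by have := og 0; rewrite mul0rn /dv eqxx eq_sym (negPf T0).
elim: n h => [|n IH] h inv hreg h0.
  (* Without a pole at the origin there is, by invariance, none on E[p], so h is constant. *)
  have [||v hv] := @const_of_regular F c h; first exact: ordge_rat h0.
    move=> X; have [hX|/hreg //] := eqVneq (X *+ p) 0.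
    have := inv _ (torN hX) => hi; case: h0 => [z|[m m0 hm]].
      by left.
    rewrite -(subrr X) in hm; exact: ord_ordge (ord_ext (ord_tr hm) hi) m0.
  by exists v%:P; apply: (ae1 hv) => X ->; rewrite hornerC.
have on := ord_exp n.+1 og0.
(* v is the value of h / g_T^(n+1) at the origin; subtracting v g_T^(n+1) from h lowers the pole
   order there. *)
have := ordge_mul h0 (ord_ordge (ord_inv on) (lexx _)).
have -> : - n.+1%:Z - -1 * n.+1%:Z = 0 by lia.
move=> /ordge_residue [v hv].
have := ordge_mul hv (ord_ordge on (lexx _)).
have -> : 1 + -1 * n.+1%:Z = - n%:Z by lia.
move=> hv'.
have [| | |R hR] := IH (fun X => h X - v * g T X ^+ n.+1).
- move=> S hS; apply: (ae2 (inv S hS) (g_tr hS hT)) => X -> ->.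
  by rewrite e1 // mul1r.
- move=> X hX; apply: ordge_sub; first exact: hreg.
  have := ordge_mul (ordge_const X v) (ord_ordge (ord_exp n.+1 (og X)) (_ : 0 <= _)).
  rewrite add0r; apply; rewrite /dv (negPf hX); nia.
- apply: ordge_ext hv' _; apply: (ae1 (g_neq0 hT)) => X gX.
  by rewrite mulrBl mulfVK // expf_neq0.
exists (R + v *: 'X^(n.+1)); apply: (ae1 hR) => X hX.
by rewrite hornerD hornerZ hornerXn -hX subrK.
Qed.

(* Differentiating S^2 = d(R) shows that S divides R', which is excluded by
   2 deg S = 3 deg R. *)
Lemma no_param (R S : {poly F}) : S ^+ 2 = d \Po R -> (size R <= 1)%N.
Proof.
move=> hSR; apply: deriv_eq0 (cubic_char0 c) _; apply/eqP; apply: contraT => R0.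
have sR : (1 < size R)%N.
  by rewrite ltnNge; apply: contraNN R0 => h; rewrite (size1_polyC h) derivC.
have Rnz : R != 0 by rewrite -size_poly_gt0 ltnW.
have [[u v] /=] := Bezout_coprimepP _ _ (cubic_sep c).
rewrite -size_poly_eq1 => /size_poly1P [k k0 uv].
have dS : S^`() * S *+ 2 = (d^`() \Po R) * R^`().
  by rewrite -deriv_comp -hSR deriv_exp expr1.
have SR : S %| R^`().
  (* Composing u d + v d' = k with R and multiplying by R' gives k R' = u(R) S^2 R' + 2 v(R) S
     S'. *)
  apply/dvdpP; exists (k^-1%:P * ((u \Po R) * S * R^`() + (v \Po R) * (S^`() *+ 2))).
  have := congr1 (fun r : {poly F} => (r \Po R) * R^`()) uv.
  rewrite comp_polyD !comp_polyM comp_polyC -hSR mulrDl => e1.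
  apply: (mulfI (_ : k%:P != 0)); first by rewrite polyC_eq0.
  rewrite -e1 -[X in _ + X]mulrA -dS !mulrA -polyCM divff // mul1r; ring.
have sS := dvdp_leq R0 SR.
have := lt_size_deriv Rnz => sR'.
have sSR : (size S <= (size R).-1)%N by apply: leq_trans sS _; rewrite -ltnS prednK // ltnW.
have := congr1 (fun r : {poly F} => (size r).-1) hSR.
rewrite size_comp_poly size_sqr cubic_size /= => e1; move: sSR e1 sR.
move: (size S) (size R) => s r; lia.
Qed.

Lemma weil_nondeg T : T != 0 -> T *+ p = 0 -> ~ (forall S, S *+ p = 0 -> e S T = 1).
Proof.
move=> T0 hT e1; have [rx ry fa] := rmap_mulrn ker_fin.
have hinv (S X : pt) : S *+ p = 0 -> (X + S) *+ p = X *+ p.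
  by move=> hS; rewrite mulrnDl hS addr0.
have [| | |R hR] := @invariant_poly T (fun X => px (X *+ p)) 2 T0 hT e1.
- by move=> S hS; apply: aeW => X; rewrite hinv.
- move=> X hX; have := reg_ordge0 (reg_px hX) => -[z|[m m0 hm]].
    by left; apply: (ae_comp fa z).
  exact: ord_ordge (ord_mulrn ker_fin hm) m0.
- apply: ord_ordge (ord_mulrn ker_fin _) (lexx _); rewrite mul0rn; exact: ordO_px.
have [| | |Q hQ] := @invariant_poly T (fun X => py (X *+ p)) 3 T0 hT e1.
- by move=> S hS; apply: aeW => X; rewrite hinv.
- move=> X hX; have := reg_ordge0 (reg_py hX) => -[z|[m m0 hm]].
    by left; apply: (ae_comp fa z).
  exact: ord_ordge (ord_mulrn ker_fin hm) m0.
- apply: ord_ordge (ord_mulrn ker_fin _) (lexx _); rewrite mul0rn; exact: ordO_py.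
(* Q^2 - d(R) vanishes at g_T; were it a nonzero polynomial, g_T and with it x([p]X) would be
   constant. *)
have hQR : Q ^+ 2 = d \Po R.
  apply/eqP; rewrite -subr_eq0; apply: contraT => nz.
  have [|v hv] := const_of_root (g_rat hT) nz.
    apply: (ae3 hR hQ (ae_comp fa (ae_neq 0))) => X hx hy hX.
    by rewrite hornerD hornerN horner_comp horner_exp -hx -hy py2 // subrr.
  exfalso; apply: ae_False.
  apply: (ae3 hR hv (ae_comp fa (ae_px_neq c R.[v]))) => X -> -> ; by rewrite eqxx.
have sR := no_param hQR.
apply: ae_False; apply: (ae2 hR (ae_comp fa (ae_px_neq c R`_0))) => X ->.
by rewrite {1}(size1_polyC sR) hornerC eqxx.
Qed.

(** If P = O, then E[p] is generated by Q and alternation makes the pairing trivial, although E[p]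
    is not. If e(Q,P) = 1, then e(-,P) is trivial because e(P,P) = 1 too. *)
Lemma weil_generators P Q : P *+ p = 0 -> Q *+ p = 0 ->
  (forall U, U *+ p = 0 -> exists a b : nat, U = P *+ a + Q *+ b) ->
  P != 0 /\ e Q P != 1.
Proof.
move=> hP hQ gen; have tor (U : pt) (a : nat) : U *+ p = 0 -> (U *+ a) *+ p = 0.
  by move=> h; rewrite mulrnAC h mul0rn.
have P0 : P != 0.
  apply/eqP => P0; have [T T0 hT] := torsion_nontrivial.
  have Q0 : Q != 0.
    by apply: contraNneq T0 => Q0; have [a [b ->]] := gen T hT; rewrite P0 Q0 !mul0rn addr0.
  apply: (weil_nondeg Q0 hQ) => S /gen [a [b ->]].
  by rewrite P0 mul0rn add0r weil_mulrn // weil_alt // expr1n.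
split=> //; apply/eqP => eQP; apply: (weil_nondeg P0 hP) => S /gen [a [b ->]].
by rewrite weil_add ?tor // !weil_mulrn // eQP weil_alt // !expr1n mulr1.
Qed.

End Torsion.
End Algebraic.

(** * Completing the square *)

Record ell (F : closedFieldType) := Ell {
  ell_eq :> weierstrass F;
  ell_char0 : [pchar F] =i pred0;
  ell_disc : elliptic ell_eq }.

Section CompleteSquare.
Variables (F : closedFieldType) (E : ell F).
Local Notation W := (ell_eq E).

Let two0 : (2%:R : F) != 0. Proof. by have /pcharf0P -> := ell_char0 E. Qed.

Let four0 : (4%:R : F) != 0. Proof. by have /pcharf0P -> := ell_char0 E. Qed.

(** With [k1] and [k0]: the coefficients b2/4, b4/2, b6/4 that appear when y is replaced by y - (a1
    x + a3)/2. *)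
Definition k2 : F := (a1 W ^+ 2 + 4 * a2 W) / 4.
Definition k1 : F := (2 * a4 W + a1 W * a3 W) / 2.
Definition k0 : F := (a3 W ^+ 2 + 4 * a6 W) / 4.

Definition ell_poly : {poly F} := \poly_(i < 4) [:: k0; k1; k2; 1]`_i.

Lemma ell_size : size ell_poly = 4%N.
Proof. by rewrite size_poly_eq //= oner_neq0. Qed.

Lemma ell_monic : ell_poly \is monic.
Proof. by rewrite monicE /lead_coef ell_size coef_poly. Qed.

Lemma ell_polyE x : ell_poly.[x] = x ^+ 3 + k2 * x ^+ 2 + k1 * x + k0.
Proof. by rewrite horner_poly !big_ord_recr big_ord0 /=; ring. Qed.

Lemma ell_dpolyE x : ell_poly^`().[x] = 3 * x ^+ 2 + 2 * k2 * x + k1.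
Proof.
have d0 : ell_poly != 0 by rewrite -size_poly_gt0 ell_size.
have s : (size ell_poly^`() <= 3)%N by have := lt_size_deriv d0; rewrite ell_size.
by rewrite (horner_coef_wide _ s) !big_ord_recr big_ord0 /= !coef_deriv !coef_poly /=; ring.
Qed.

(** A common root z expresses k1 and k0 through z and k2, and with these values the discriminant is
    identically 0. *)
Lemma ell_sep : coprimep ell_poly ell_poly^`().
Proof.
apply: Pdiv.ClosedField.root_coprimep => z; rewrite rootE => /eqP r.
apply/eqP => r'; have /negP [] := ell_disc E; apply/eqP.
rewrite ell_polyE in r; rewrite ell_dpolyE in r'.
have e2 : a2 W = k2 - a1 W ^+ 2 / 4 by rewrite /k2; field; rewrite ?two0 ?four0.
have e4 : a4 W = k1 - a1 W * a3 W / 2 by rewrite /k1; field; rewrite ?two0 ?four0.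
have e6 : a6 W = k0 - a3 W ^+ 2 / 4 by rewrite /k0; field; rewrite ?two0 ?four0.
have r1 : k1 = - (3 * z ^+ 2 + 2 * k2 * z).
  by apply/eqP; rewrite -addr_eq0 addrC r'.
have r0 : k0 = - (z ^+ 3 + k2 * z ^+ 2 + k1 * z).
  by apply/eqP; rewrite -addr_eq0 addrC r.
by rewrite /discriminant e2 e4 e6 r0 r1; field; rewrite ?two0 ?four0.
Qed.

Definition ell_cubic : cubic F := Cubic ell_monic ell_size ell_sep (ell_char0 E).

Local Notation pt := (pt ell_cubic).
Implicit Types (X Y S T : pt).

Definition ycoord X : F := py X - (a1 W * px X + a3 W) / 2.

Definition toP X : Defs.point F := if X == 0 then None else Some (px X, ycoord X).

Lemma toP0 : toP 0 = None. Proof. by rewrite /toP eqxx. Qed.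

Lemma on_curveE x y : on_curve W (Some (x, y)) = ((y + (a1 W * x + a3 W) / 2) ^+ 2 == ell_poly.[x]).
Proof.
rewrite /on_curve ell_polyE -subr_eq0 -[RHS]subr_eq0; congr (_ == _).
by rewrite /k2 /k1 /k0; field; rewrite ?two0 ?four0.
Qed.

Lemma toP_on X : on_curve W (toP X).
Proof.
rewrite /toP; have [//|hX] := eqVneq X 0.
by rewrite on_curveE /ycoord subrK py2.
Qed.

Lemma toP_surj (Y : Defs.point F) : on_curve W Y -> exists X, toP X = Y.
Proof.
case: Y => [[x y]|_]; last by exists 0; rewrite toP0.
rewrite on_curveE => /eqP h; exists (@ptA _ ell_cubic _ _ h).
by rewrite /toP (negPf (ptA_neqO _)) /ycoord pyA pxA addrK.
Qed.

Lemma toP_inj : injective toP.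
Proof.
move=> X Y; rewrite /toP; have [->|hX] := eqVneq X 0; have [->|hY] := eqVneq Y 0 => //.
by move=> [ex]; rewrite /ycoord ex => /addIr ey; apply: pt_eqP.
Qed.

Lemma toP_neq0 X : X != 0 -> toP X = Some (px X, ycoord X).
Proof. by rewrite /toP => /negPf ->. Qed.

Lemma pt_eqN X Y : X != 0 -> Y != 0 -> (px X == px Y) && (py X + py Y == 0) -> Y = - X.
Proof.
move=> hX hY /andP [/eqP ex]; rewrite addr_eq0 => /eqP ey.
by apply: pt_eqP; rewrite ?oppr_eq0 ?pxN ?pyN // ey opprK.
Qed.

Lemma toPD X Y : toP (X + Y) = addp W (toP X) (toP Y).
Proof.
have [->|hX] := eqVneq X 0; first by rewrite add0r toP0.
have [->|hY] := eqVneq Y 0; first by rewrite addr0 toP0; case: (toP X) => [[]|].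
rewrite (toP_neq0 hX) (toP_neq0 hY) /addp.
have condE : (px X == px Y) && (ycoord X + ycoord Y + a1 W * px Y + a3 W == 0) =
   (px X == px Y) && (py X + py Y == 0).
  case: eqP => //= e; congr (_ == _); rewrite /ycoord e; by field; rewrite ?two0 ?four0.
rewrite condE; case: ifP => [h|ne].
  by rewrite (pt_eqN hX hY h) subrr toP0.
have hXY : Y != - X.
  by apply: contraFneq ne => ->; rewrite pxN pyN subrr !eqxx.
have [_ n0 xE yE] := padd_coord hX hY hXY.
rewrite (toP_neq0 (n0 : X + Y != 0)) /ycoord -[X + Y]/(padd X Y) xE yE.
have k2E : (ell_poly)`_2 = k2 by rewrite coef_poly.
have k1E : (ell_poly)`_1 = k1 by rewrite coef_poly.
set lam := (if _ then _ else _).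
(* The change of the ordinate adds (a1 x + a3)/2, which raises every slope by a1/2. *)
have slopeE : slope ell_cubic (px X) (py X) (px Y) (py Y) = lam + a1 W / 2.
  rewrite /slope /lam /=; case: eqP => [e|/eqP nx].
    have y0 : py X != 0.
      apply: contraFneq ne => y0; rewrite e eqxx y0 add0r /=.
      by rewrite -[_ == 0](expf_eq0 _ 2) py2 // -e -py2 // y0 expr0n.
    have dE : py X * 2 - (a1 W * px X + a3 W) + a1 W * px X + a3 W = 2 * py X by ring.
    by rewrite k2E k1E /k2 /k1 /ycoord; field; rewrite two0 four0 y0 dE mulf_neq0.
  have nx' : px Y - px X != 0 by rewrite subr_eq0 eq_sym.
  by rewrite /ycoord; field; rewrite nx' two0.
rewrite /third slopeE /= k2E /k2.
by congr (Some (_, _)); field; rewrite ?two0 ?four0.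
Qed.

Lemma toP_mulrn X n : toP (X *+ n) = mulp W n (toP X).
Proof.
rewrite /mulp; elim: n => [|n IH]; first by rewrite toP0.
by rewrite mulrS toPD IH.
Qed.

End CompleteSquare.

(** * Forms on the curve *)

Lemma meval_homog (R : comNzRingType) (n d : nat) (G : {mpoly R[n]}) (k : R) (v : 'I_n -> R) :
  G \is d.-homog -> G.@[fun i => k * v i] = k ^+ d * G.@[v].
Proof.
move=> hG; rewrite !mevalE big_distrr /= big_seq [RHS]big_seq; apply: eq_bigr => m hm.
have <- := dhomog_mf hG hm.
under eq_bigr do rewrite exprMn.
by rewrite big_split /= prodrXr -mdegE mulrCA.
Qed.

Section Forms.
Variables (F : closedFieldType) (E : ell F).
Local Notation W := (ell_eq E).
Local Notation c := (ell_cubic E).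
Local Notation pt := (pt c).
Implicit Types (X Y S T : pt) (G : {mpoly F[3]}) (f g h t : fraction F).

Lemma reg_prodr X (I : Type) (r : seq I) (v : I -> pt -> F) (w : I -> F) :
  (forall i, reg X (v i) (w i)) -> reg X (fun Y => \prod_(i <- r) v i Y) (\prod_(i <- r) w i).
Proof.
move=> H; elim: r => [|i r IH].
  rewrite big_nil; apply: reg_ext (reg_const X 1) _; by apply: aeW => Y; rewrite big_nil.
rewrite big_cons; apply: reg_ext (reg_mul (H i) IH) _; by apply: aeW => Y; rewrite big_cons.
Qed.

Lemma reg_sumr X (I : Type) (r : seq I) (v : I -> pt -> F) (w : I -> F) :
  (forall i, reg X (v i) (w i)) -> reg X (fun Y => \sum_(i <- r) v i Y) (\sum_(i <- r) w i).
Proof.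
move=> H; elim: r => [|i r IH].
  rewrite big_nil; apply: reg_ext (reg_const X 0) _; by apply: aeW => Y; rewrite big_nil.
rewrite big_cons; apply: reg_ext (reg_add (H i) IH) _; by apply: aeW => Y; rewrite big_cons.
Qed.

Lemma reg_meval X G (v : pt -> 'I_3 -> F) (w : 'I_3 -> F) :
  (forall i, reg X (fun Y => v Y i) (w i)) -> reg X (fun Y => G.@[v Y]) G.@[w].
Proof.
move=> H; rewrite mevalE; have := @reg_sumr X _ (msupp G)
  (fun m Y => G@_m * \prod_(i <- index_enum 'I_3) v Y i ^+ m i)
  (fun m => G@_m * \prod_(i <- index_enum 'I_3) w i ^+ m i).
move=> /(_ _) /reg_ext; apply; last by apply: aeW => Y; rewrite mevalE.
move=> m; apply: reg_mul (reg_const X _) _; apply: reg_prodr => i; exact: reg_exp.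
Qed.

Lemma ordO_ycoord : ord (0 : pt) (@ycoord F E) (-3).
Proof.
have h : ordge (0 : pt) (fun Y => - ((a1 W * px Y + a3 W) / 2)) (-2).
  have h1 := ordge_mul (ordge_const (0 : pt) (a1 W)) (ord_ordge (ordO_px c) (lexx _)).
  rewrite add0r in h1; have h2 := ordge_add h1 (ordge_le (isT : -2 <= 0 :> int) (ordge_const 0 (a3 W))).
  by have := ordge_mul h2 (ordge_const 0 2^-1); rewrite addr0; apply: ordge_opp.
exact: ord_add_ordge (ordO_py c) h _.
Qed.

Lemma ycoord_neq0 : ae (fun Y : pt => ycoord Y != 0).
Proof. exact: ord_neq0 ordO_ycoord. Qed.

Lemma reg_ycoord X : X != 0 -> reg X (@ycoord F E) (ycoord X).
Proof.
move=> hX; apply: reg_sub (reg_py hX) _; apply: reg_mul (reg_const X _).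
apply: reg_add (reg_const X _); apply: reg_mul (reg_const X _) (reg_px hX).
Qed.

Definition hc X : 'I_3 -> F := homog_coord (toP X).

(* Homogeneous coordinates near [X], rescaled so that they are regular at [X]. *)
Definition scl X Y : F := if X == 0 then (ycoord Y)^-1 else 1.

Lemma reg_hc X i : reg X (fun Y => scl X Y * hc Y i) (hc X i).
Proof.
have hcE Y (hY : Y != 0) : hc Y = tnth [tuple px Y; ycoord Y; 1] by rewrite /hc (toP_neq0 hY).
rewrite /scl; have [->|hX] := eqVneq X 0; last first.
  have H : reg X (fun Y => tnth [tuple px Y; ycoord Y; 1] i) (hc X i).
    rewrite hcE //; case: i => [[|[|[|//]]] hi]; rewrite !(tnth_nth 0) /=;
      [exact: reg_px|exact: reg_ycoord|exact: reg_const].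
  by apply: reg_ext H _; apply: (ae1 (ae_neq 0)) => Y hY; rewrite mul1r hcE.
have H : reg (0 : pt) (fun Y => tnth [tuple px Y / ycoord Y; 1; (ycoord Y)^-1] i) (hc 0 i).
  rewrite /hc toP0 /=; case: i => [[|[|[|//]]] hi]; rewrite !(tnth_nth 0) /=.
  - exact: ord_pos_reg (ord_div (ordO_px c) ordO_ycoord) _.
  - exact: reg_const.
  - exact: ord_pos_reg (ord_inv ordO_ycoord) _.
apply: reg_ext H _; apply: (ae2 (ae_neq 0) ycoord_neq0) => Y hY y0; rewrite hcE //.
by case: i => [[|[|[|//]]] hi]; rewrite !(tnth_nth 0) /= ?mulr1 ?mulVf // mulrC.
Qed.

Lemma scl_neq0 X : ae (fun Y => scl X Y != 0).
Proof.
rewrite /scl; case: (X == 0); last by apply: aeW => Y; rewrite oner_neq0.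
by apply: (ae1 ycoord_neq0) => Y; rewrite invr_eq0.
Qed.

(** Homogeneity lets the n-th power of the rescaling factor absorb the pole of G at the origin. *)
Lemma reg_form X G n : G \is n.-homog ->
  reg X (fun Y => scl X Y ^+ n * evalp G (toP Y)) (evalp G (toP X)).
Proof.
move=> hG; apply: reg_ext (reg_meval G (reg_hc X)) _.
by apply: aeW => Y; rewrite (meval_homog _ _ hG).
Qed.

Lemma rat_evalp G : rational (fun Y : pt => evalp G (toP Y)).
Proof.
have [X hX _] := pt_exists c 0.
apply: reg_rat (reg_ext (reg_meval G (reg_hc X)) _).
apply: aeW => Y; apply: meval_eq => i; by rewrite /scl (negPf hX) mul1r.
Qed.

(** Numerator and denominator have the same degree, so the rescaling factors cancel. *)
Lemma reg_value X f n : f.1 \is n.-homog -> f.2 \is n.-homog -> evalp f.2 (toP X) != 0 ->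
  reg X (fun Y => value_at f (toP Y)) (value_at f (toP X)).
Proof.
move=> h1 h2 nz; have := reg_mul (reg_form X h1) (reg_inv (reg_form X h2) nz).
move/reg_ext; apply; apply: (ae2 (scl_neq0 X) (reg_neq0 (reg_form X h2) nz)) => Y s0.
rewrite mulf_eq0 negb_or => /andP [s1 e0]; rewrite /value_at; field.
by rewrite e0 s1.
Qed.

Lemma curve_form0 X : evalp (weierstrass_form W) (toP X) = 0.
Proof.
rewrite /evalp /weierstrass_form.
rewrite !(mevalB, mevalD, mevalM, mevalZ, mevalXU, rmorphXn) /=.
have [->|hX] := eqVneq X 0.
  by rewrite toP0 /= !(tnth_nth 0) /=; ring.
have := toP_on X; rewrite (toP_neq0 hX) /= !(tnth_nth 0) /= -subr_eq0 => /eqP e.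
rewrite -[RHS]e; ring.
Qed.

Lemma zero_on_curve0 G X : zero_on_curve W G -> evalp G (toP X) = 0.
Proof.
by case=> H ->; have := curve_form0 X; rewrite /evalp mevalM => ->; rewrite mulr0.
Qed.

(* Modulo the Weierstrass form, X^3 is a combination of monomials of smaller
   degree in X. *)
Definition reduced n G := forall m : 'X_{1..3}, G@_m != 0 -> mdeg m = n /\ (m ord0 <= 2)%N.
Definition reducible n G := exists H R, G = H * weierstrass_form W + R /\ reduced n R.

Lemma reducible_add n G G' : reducible n G -> reducible n G' -> reducible n (G + G').
Proof.
move=> [H [R [-> hR]]] [H' [R' [-> hR']]]; exists (H + H'), (R + R'); split; first by ring.
move=> m; rewrite mcoeffD; have [e|/hR //] := eqVneq R@_m 0.
by rewrite e add0r => /hR'.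
Qed.

Lemma reducible_scale n k G : reducible n G -> reducible n (k *: G).
Proof.
move=> [H [R [-> hR]]]; exists (k *: H), (k *: R); split.
  by rewrite scalerDr scalerAl.
by move=> m; rewrite mcoeffZ mulf_eq0 negb_or => /andP [_ /hR].
Qed.

Lemma reducible_mul n H : reducible n (H * weierstrass_form W).
Proof. by exists H, 0; split; [rewrite addr0|move=> m; rewrite mcoeff0 eqxx]. Qed.

Lemma reducible_monomial n (m : 'X_{1..3}) : mdeg m = n -> reducible n ('X_[m] : {mpoly F[3]}).
Proof.
have [k] := ubnP (m ord0); elim: k m => // k IH m mk mn.
have [m2|m3] := leqP (m ord0) 2.
  exists 0, 'X_[m]; split; first by rewrite mul0r add0r.
  by move=> m'; rewrite mcoeffX; have [<-|_] := eqVneq m m'; rewrite ?eqxx.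
pose x : 'X_{1..3} := U_(ord0)%MM; pose y : 'X_{1..3} := U_(1 : 'I_3)%MM.
pose z : 'X_{1..3} := U_(2 : 'I_3)%MM.
have [m' mE] : exists m', m = (x + x + x + m')%MM.
  exists (m - (x + x + x))%MM; rewrite addmC submK //.
  apply/mnm_lepP => i; rewrite !mnmE.
  have [<-|ne] := eqVneq ord0 i; first by lia.
  by [].
(* X^3 is replaced by monomials with at most two factors X, so the induction on the X-degree applies
   to each. *)
have e : ('X_[m] : {mpoly F[3]}) = (- 'X_[m']) * weierstrass_form W
   + ('X_[y + y + z + m'] + a1 W *: 'X_[x + y + z + m'] + a3 W *: 'X_[y + z + z + m']
      + (- a2 W) *: 'X_[x + x + z + m'] + (- a4 W) *: 'X_[x + z + z + m']
      + (- a6 W) *: 'X_[z + z + z + m']).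
  rewrite mE /weierstrass_form !mpolyXD -!mul_mpolyC !mpolyCN; ring.
have deg1 u v w : (mdeg (U_(u) + U_(v) + U_(w) + m')%MM = n :> nat).
  by move: mn; rewrite mE !mdegD !mdeg1.
have mx : (m ord0 = 3 + m' ord0)%N by rewrite mE !mnmE.
rewrite e; do !apply: reducible_add; try apply: reducible_scale; try exact: reducible_mul;
  apply: IH; rewrite ?deg1 //; rewrite !mnmE /=; move: mk; rewrite mx; lia.
Qed.

Lemma reducible_homog n G : G \is n.-homog -> reducible n G.
Proof.
move=> /dhomogP hG; rewrite [G]mpolyE big_seq.
elim/big_ind: _ => [|p q|m hm]; last 1 first.
- by apply: reducible_scale; apply: reducible_monomial; apply: hG.
- by exists 0, 0; split; [rewrite mul0r addr0|move=> m; rewrite mcoeff0 eqxx].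
- exact: reducible_add.
Qed.

Lemma ord_sum_distinct X (I : eqType) (r : seq I) (h : I -> pt -> F) (w : I -> int) :
  r != [::] -> uniq [seq w i | i <- r] -> {in r, forall i, ord X (h i) (w i)} ->
  exists2 i, i \in r & ord X (fun Y => \sum_(j <- r) h j Y) (w i).
Proof.
elim: r => // i r IH _ /= /andP [wi ur] H.
have hi : ord X (h i) (w i) by apply: H; rewrite inE eqxx.
have [r0|r0] := eqVneq r [::].
  exists i; first by rewrite inE eqxx.
  by apply: ord_ext hi _; apply: aeW => Y; rewrite r0 big_seq1.
have [|j jr hj] := IH r0 ur; first by move=> j jr; apply: H; rewrite inE jr orbT.
have ne : w i != w j by apply: contraNneq wi => ->; apply: map_f.
have [k [hk _ _ kE]] := ord_add_neq hi hj ne.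
have hk' : ord X (fun Y => \sum_(l <- i :: r) h l Y) k.
  by apply: ord_ext hk _; apply: aeW => Y; rewrite big_cons.
case/orP: kE => /eqP e; rewrite e in hk'; [exists i|exists j] => //; rewrite inE ?eqxx ?jr ?orbT //.
Qed.

Lemma big_ord3 (R : Type) (idx : R) (op : Monoid.law idx) (f : 'I_3 -> R) :
  \big[op/idx]_(i < 3) f i = op (op (f ord0) (f 1)) (f 2).
Proof.
rewrite !big_ord_recr big_ord0 /= Monoid.mul1m; congr (op (op (f _) (f _)) (f _)); exact: val_inj.
Qed.

Lemma mdeg3 (m : 'X_{1..3}) : mdeg m = (m ord0 + m 1%R + m 2%R)%N.
Proof. by rewrite mdegE big_ord3. Qed.

Lemma mnm3_eq (m m' : 'X_{1..3}) : m ord0 = m' ord0 -> m 1 = m' 1 -> m 2 = m' 2 -> m = m'.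
Proof.
move=> h0 h1 h2; apply/mnmP => i.
have [-> //|n0] := eqVneq i ord0; have [-> //|n1] := eqVneq i 1; have [-> //|n2] := eqVneq i 2.
by case: i n0 n1 n2 => [[|[|[|//]]] hi]; rewrite -!val_eqE.
Qed.

(* The functions x^i y^j with i <= 2 have distinct orders -2i-3j at the origin. *)
Lemma reduced_eq0 n G : reduced n G -> ae (fun Y : pt => evalp G (toP Y) = 0) -> G = 0.
Proof.
move=> hG z; apply/eqP; rewrite -msupp_eq0; apply: contraT => s0.
pose w (m : 'X_{1..3}) : int := - ((2 * m ord0 + 3 * m 1%R)%N)%:Z.
(* 2i + 3j modulo 3 determines i <= 2, then j; the exponent of Z follows from the total degree. *)
have winj : {in msupp G &, injective w}.
  move=> m m'; rewrite !mcoeff_msupp => /hG [+ h0] /hG [+ h0']; rewrite !mdeg3 /w => d1 d2 e.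
  apply: mnm3_eq; lia.
have [||m mG hm] := @ord_sum_distinct 0 _ (msupp G)
    (fun m Y => G@_m * (px Y ^+ m ord0 * ycoord Y ^+ m 1)) w s0.
- rewrite map_inj_in_uniq //; exact: msupp_uniq.
- move=> m; rewrite mcoeff_msupp => Gm.
  have := ord_mul (ord_const (0 : pt) Gm) (ord_mul (ord_exp (m ord0) (ordO_px c)) (ord_exp (m 1) ordO_ycoord)).
  by congr (ord _ _ _); rewrite /w; lia.
exfalso; apply: ae_False; apply: (ae3 z (ord_neq0 hm) (ae_neq 0)) => Y e + hY.
move/eqP; apply; rewrite -[RHS]e /evalp mevalE; apply: eq_bigr => k _; congr (_ * _).
by rewrite big_ord3 (toP_neq0 hY) /= !(tnth_nth 0) /= expr1n mulr1.
Qed.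

(** A form vanishing at almost all points has reduced remainder 0, so it is a multiple of the
    Weierstrass form. *)
Lemma form_neq0 n G : G \is n.-homog -> ~ zero_on_curve W G ->
  ae (fun Y : pt => evalp G (toP Y) != 0).
Proof.
move=> hG nz; have [z|//] := rat_dich (rat_evalp G).
exfalso; apply: nz; have [H [R [GE hR]]] := reducible_homog hG.
exists H; rewrite GE (reduced_eq0 hR) ?addr0 //.
apply: (ae1 z) => Y; have z0 := curve_form0 Y; rewrite GE /evalp (mevalD _ (H * _) R).
by move: z0; rewrite (mevalM _ H) /evalp => ->; rewrite mulr0 add0r.
Qed.

End Forms.

(** * Orders of fractions and the torsion group *)

Section Orders.
Variables (F : closedFieldType) (E : ell F).
Local Notation W := (ell_eq E).
Local Notation c := (ell_cubic E).
Local Notation pt := (pt c).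
Implicit Types (X Y S T : pt) (f g h t u : fraction F).

Definition fval f Y : F := value_at f (toP Y : Defs.point F).

Lemma fraction_neq0 f : rational_fun W f -> ae (fun Y : pt => evalp f.2 (toP Y) != 0).
Proof. by move=> [[n [_ h2]] nz]; apply: form_neq0 h2 nz. Qed.

Lemma rat_fval f : rational (fval f).
Proof. exact: rat_div (rat_evalp E f.1) (rat_evalp E f.2). Qed.

Lemma fval_same f g : ae (fun Y : pt => evalp f.2 (toP Y) != 0) ->
  ae (fun Y : pt => evalp g.2 (toP Y) != 0) -> same_fun W f g -> ae (fun Y => fval f Y = fval g Y).
Proof.
move=> hf hg hs; apply: (ae2 hf hg) => Y f0 g0.
have := zero_on_curve0 Y hs; rewrite /evalp mevalB !mevalM => /eqP; rewrite subr_eq0 => e.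
by apply/eqP; rewrite /fval /value_at eqr_div.
Qed.

Lemma fval_mulf f g Y : fval (Defs.mulf f g) Y = fval f Y * fval g Y.
Proof. by rewrite /fval /value_at /evalp /= !mevalM invfM mulrACA. Qed.

Lemma fval_expf f n Y : fval (expf f n) Y = fval f Y ^ n.
Proof.
case: n => n; rewrite /fval /value_at /evalp /= !rmorphXn /=; first by rewrite -expr_div_n.
by rewrite -expr_div_n NegzE -exprnN -exprVn invf_div.
Qed.

Lemma unit_at_ord X u : rational_fun W u -> unit_at W u (toP X) -> ord X (fval u) 0.
Proof.
move=> ru [h [rh hs h2 h1]]; have [[n [hh1 hh2]] _] := rh.
have rv := reg_value hh1 hh2 h2.
have v0 : value_at h (toP X) != 0 by rewrite /value_at mulf_neq0 ?invr_eq0.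
apply: ord_ext (reg_ord0 rv v0) _.
by apply: (ae1 (fval_same (fraction_neq0 ru) (fraction_neq0 rh) hs)).
Qed.

Lemma vanishes_reg X u : rational_fun W u -> vanishes_at W u (toP X) -> reg X (fval u) 0.
Proof.
move=> ru [h [rh hs h2 h1]]; have [[n [hh1 hh2]] _] := rh.
have rv := reg_value hh1 hh2 h2.
rewrite /value_at h1 mul0r in rv; apply: reg_ext rv _.
by apply: (ae1 (fval_same (fraction_neq0 ru) (fraction_neq0 rh) hs)).
Qed.

Lemma regular_ordge X u : rational_fun W u -> regular_at W u (toP X) -> ordge X (fval u) 0.
Proof.
move=> ru [h [rh hs h2]]; have [[n [hh1 hh2]] _] := rh.
apply: reg_ordge0; apply: reg_ext (reg_value hh1 hh2 h2) _.
by apply: (ae1 (fval_same (fraction_neq0 ru) (fraction_neq0 rh) hs)).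
Qed.

Lemma vanishes_self h (Y : Defs.point F) : rational_fun W h -> evalp h.2 Y != 0 -> evalp h.1 Y = 0 ->
  vanishes_at W h Y.
Proof.
move=> rh h2 h1; exists h; split=> //; rewrite /same_fun subrr; exists 0; by rewrite mul0r.
Qed.

(** Quotients of linear forms suffice: X / Y at the origin, elsewhere the line describing [tpar],
    over Z. *)
Lemma local_param_exists X : exists h,
  [/\ rational_fun W h, vanishes_at W h (toP X) & ord X (fval h) 1].
Proof.
have Xi_homog (i : 'I_3) : ('X_i : {mpoly F[3]}) \is 1%N.-homog by rewrite dhomogX; apply/eqP; exact: mdeg1.
have [X1 hX1 _] := pt_exists c 0.
have z1 Y : Y != 0 -> evalp ('X_2 : {mpoly F[3]}) (toP Y) = 1.
  by move=> hY; rewrite /evalp mevalXU toP_neq0 //= (tnth_nth 0).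
have x1 Y : Y != 0 -> evalp ('X_0 : {mpoly F[3]}) (toP Y) = px Y.
  by move=> hY; rewrite /evalp mevalXU toP_neq0 //= (tnth_nth 0).
have y1 Y : Y != 0 -> evalp ('X_1 : {mpoly F[3]}) (toP Y) = ycoord Y.
  by move=> hY; rewrite /evalp mevalXU toP_neq0 //= (tnth_nth 0).
have nzZ : ~ zero_on_curve W ('X_2 : {mpoly F[3]}).
  by move=> /(zero_on_curve0 X1); rewrite z1 // => /eqP; rewrite oner_eq0.
have [->|hX] := eqVneq X 0.
  have y0 : evalp ('X_1 : {mpoly F[3]}) (toP (0 : pt)) = 1.
    by rewrite /evalp mevalXU toP0 /= (tnth_nth 0).
  have rh : rational_fun W ('X_0 : {mpoly F[3]}, 'X_1 : {mpoly F[3]}).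
    split; first by exists 1%N; split; exact: Xi_homog.
    by move=> /(zero_on_curve0 (0 : pt)); rewrite y0 => /eqP; rewrite oner_eq0.
  exists ('X_0, 'X_1); split=> //.
    apply: vanishes_self => //=; first by rewrite y0 oner_neq0.
    by rewrite /evalp mevalXU toP0 /= (tnth_nth 0).
  apply: ord_ext (ord_div (ordO_px c) (ordO_ycoord E)) _.
  by apply: (ae1 (ae_neq 0)) => Y hY; rewrite /fval /value_at /= x1 // y1.
pose l : {mpoly F[3]} := if py X == 0 then 'X_1 + (a1 W / 2) *: 'X_0 + (a3 W / 2) *: 'X_2
  else 'X_0 - px X *: 'X_2.
have lE Y : Y != 0 -> evalp l (toP Y) = tpar X Y.
  move=> hY; have := x1 Y hY; have := y1 Y hY; have := z1 Y hY; rewrite /evalp => ez ey ex.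
  rewrite /l /tpar (negPf hX); case: ifP => _.
    rewrite !(mevalD, mevalZ) ez ey ex /ycoord; field.
    by have /pcharf0P -> := ell_char0 E.
  by rewrite !(mevalB, mevalZ) ez ex mulr1.
have rh : rational_fun W (l, 'X_2 : {mpoly F[3]}).
  split=> //; exists 1%N; split=> //=; rewrite /l; case: ifP => _.
    by rewrite !dhomogD ?dhomogZ.
  by rewrite dhomogD ?dhomogN ?dhomogZ.
exists (l, 'X_2); split=> //.
  apply: vanishes_self => //=; first by rewrite z1 // oner_neq0.
  rewrite lE //; have := reg_tpar X; rewrite /tpar (negPf hX); case: eqP => // _ _; exact: subrr.
apply: ord_ext (ord_tpar X) _.
by apply: (ae1 (ae_neq 0)) => Y hY; rewrite /fval /value_at /= lE // z1 // divr1.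
Qed.

(** t vanishes, so its order is at least 1. Dividing the explicit parameter h of order 1 by t leaves
    a regular function, so it is at most 1. *)
Lemma uniformizer_ord X t : uniformizer_at W t (toP X) -> ord X (fval t) 1.
Proof.
move=> [rt vt H]; have [h [rh vh oh]] := local_param_exists X.
have [u [ru ou hs]] := H h rh vh.
have den : ae (fun Y : pt => evalp (Defs.mulf u t).2 (toP Y) != 0).
  apply: (ae2 (fraction_neq0 ru) (fraction_neq0 rt)) => Y u0 t0.
  by rewrite /evalp /= mevalM mulf_neq0.
have e := fval_same (fraction_neq0 rh) den hs.
have nz : ae (fun Y => fval t Y != 0).
  by apply: (ae2 e (ord_neq0 oh)) => Y ->; rewrite fval_mulf mulf_eq0 negb_or => /andP [].
have [k [k0 hk]] := reg0_ord (vanishes_reg rt vt) nz.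
have h1 := ordge_mul (regular_ordge ru ou) (ord_ordge hk (lexx _)).
have h2 : ordge X (fval h) (0 + k%:Z).
  by apply: ordge_ext h1 _; apply: (ae1 e) => Y ->; rewrite fval_mulf.
have := ordge_ord h2 oh => k1.
by have <- : k%:Z = 1 by lia.
Qed.

Lemma order_ord X f n : rational_fun W f -> order_at W f (toP X) n -> ord X (fval f) n.
Proof.
move=> rf [t [u [ht ru hu hs]]]; have ot := uniformizer_ord ht.
have [rt _ _] := ht.
have nzt := ord_neq0 ot.
have den : ae (fun Y : pt => evalp (Defs.mulf u (expf t n)).2 (toP Y) != 0).
  apply: (ae3 (fraction_neq0 ru) (fraction_neq0 rt) nzt) => Y u0 t0.
  rewrite /fval /value_at mulf_eq0 negb_or => /andP [t1 _].
  rewrite /evalp /= mevalM mulf_neq0 //.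
  by case: (n) => k /=; rewrite rmorphXn expf_neq0.
have e := fval_same (fraction_neq0 rf) den hs.
have := ord_mul (unit_at_ord ru hu) (ord_expz n ot); rewrite add0r mul1r => h.
by apply: ord_ext h _; apply: (ae1 e) => Y ->; rewrite fval_mulf fval_expf.
Qed.

End Orders.

(** The group structure depends on the curve being elliptic in characteristic 0, which [torsion]
    does not record; this alias carries it. *)
Definition tors_of (F : closedFieldType) (E : ell F) (p : nat) := torsion (ell_eq E) p.

HB.instance Definition _ (F : closedFieldType) (E : ell F) (p : nat) :=
  Choice.copy (tors_of E p) (torsion (ell_eq E) p).

(** * The group structure on E[p] *)

Section TorsionGroup.
Variables (F : closedFieldType) (E : ell F) (p : nat).
Local Notation W := (ell_eq E).
Local Notation c := (ell_cubic E).
Local Notation pt := (pt c).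
Local Notation tors := (tors_of E p).
Implicit Types (S T U : tors) (X Y : pt).

Lemma tors_pt_exists T : exists X : pt, toP X == sval T.
Proof. by case/andP: (svalP T) => /(@toP_surj F E) [X e] _; exists X; rewrite e. Qed.

Definition tpt T : pt := xchoose (tors_pt_exists T).

Lemma toP_tpt T : toP (tpt T) = sval T.
Proof. exact/eqP/(xchooseP (tors_pt_exists T)). Qed.

Lemma is_torsionE X : is_torsion W p (toP X) = (X *+ p == 0).
Proof.
rewrite /is_torsion toP_on /= -toP_mulrn -(toP0 E); exact: (inj_eq (@toP_inj F E)).
Qed.

Lemma tpt_tor T : tpt T *+ p = 0.
Proof. by apply/eqP; rewrite -is_torsionE toP_tpt; exact: (svalP T). Qed.

Lemma tpt_inj : injective tpt.
Proof. by move=> S T e; apply: val_inj; rewrite /= -!toP_tpt e. Qed.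

Definition ptt X : tors := insubd (tors0 W p) (toP X).

Lemma sval_ptt X : X *+ p = 0 -> sval (ptt X) = toP X.
Proof. by move=> h; rewrite (insubdK (tors0 W p)) //; rewrite -[_ \in _]/(is_torsion _ _ _) is_torsionE h. Qed.

Lemma pttK X : X *+ p = 0 -> tpt (ptt X) = X.
Proof. by move=> h; apply: toP_inj; rewrite toP_tpt sval_ptt. Qed.

Lemma tptK T : ptt (tpt T) = T.
Proof. by apply: tpt_inj; rewrite pttK // tpt_tor. Qed.

Definition addT S T : tors := addt S T.
Definition zeroT : tors := tors0 W p.
Definition oppT T : tors := ptt (- tpt T).

Lemma addTE S T : addT S T = ptt (tpt S + tpt T).
Proof. by rewrite /addT /addt /ptt toPD !toP_tpt. Qed.

Lemma tptD S T : tpt (addT S T) = tpt S + tpt T.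
Proof. by rewrite addTE pttK // mulrnDl !tpt_tor addr0. Qed.

Lemma tpt0 : tpt zeroT = 0.
Proof. by apply: toP_inj; rewrite toP_tpt toP0. Qed.

Lemma addTA : associative addT.
Proof. by move=> S T U; apply: tpt_inj; rewrite !tptD addrA. Qed.
Lemma addTC : commutative addT.
Proof. by move=> S T; apply: tpt_inj; rewrite !tptD addrC. Qed.
Lemma add0T : left_id zeroT addT.
Proof. by move=> T; apply: tpt_inj; rewrite tptD tpt0 add0r. Qed.
Lemma addNT : left_inverse zeroT oppT addT.
Proof.
by move=> T; apply: tpt_inj; rewrite tptD tpt0 pttK ?addNr // mulNrn tpt_tor oppr0.
Qed.

End TorsionGroup.

HB.instance Definition _ (F : closedFieldType) (E : ell F) (p : nat) :=
  GRing.isZmodule.Build (tors_of E p) (@addTA F E p) (@addTC F E p) (@add0T F E p) (@addNT F E p).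

(** * Transfer of the pairing from the cubic to E[p] *)

Section WeilPairing.
Variables (F : closedFieldType) (E : ell F) (p : nat).
Hypotheses (p_odd : odd p) (p_gt1 : (1 < p)%N).
Local Notation W := (ell_eq E).
Local Notation c := (ell_cubic E).
Local Notation pt := (pt c).
Local Notation tors := (tors_of E p).
Implicit Types (S T U : tors) (X Y : pt).

Lemma addt_add S T : addt (S : torsion W p) T = S + T :> tors.
Proof. by []. Qed.

Lemma mulnt_mulrn (n : nat) T : mulnt n (T : torsion W p) = T *+ n :> tors.
Proof. by rewrite /mulnt; elim: n => //= n ->; rewrite addt_add mulrS. Qed.

Lemma tpt_add S T : tpt (S + T) = tpt S + tpt T. Proof. exact: tptD. Qed.
Lemma tpt_zero : tpt (0 : tors) = 0. Proof. exact: tpt0. Qed.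

Lemma tpt_mulrn T n : tpt (T *+ n) = tpt T *+ n.
Proof. by elim: n => [|n IH]; rewrite ?tpt_zero // !mulrS tpt_add IH. Qed.

Lemma tors_exponent T : T *+ p = 0.
Proof. by apply: tpt_inj; rewrite tpt_mulrn tpt_tor tpt_zero. Qed.

Variables (P Q : tors).
Hypothesis gen : generate (P : torsion W p) Q.

Lemma generateE T : exists a b : nat, T = P *+ a + Q *+ b.
Proof. by have [a [b ->]] := gen T; exists a, b; rewrite !mulnt_mulrn. Qed.

Lemma mulrn_mod T n : T *+ n = T *+ (n %% p).
Proof. by rewrite {1}(divn_eq n p) mulrnDr mulnC mulrnA tors_exponent mul0rn add0r. Qed.

Definition tors_seq : seq tors :=
  undup [seq P *+ i + Q *+ j | i <- iota 0 p, j <- iota 0 p].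

Lemma mem_tors_seq T : T \in tors_seq.
Proof.
rewrite mem_undup; have [a [b ->]] := generateE T.
rewrite mulrn_mod [Q *+ b]mulrn_mod; apply/allpairsP; exists ((a %% p)%N, (b %% p)%N).
by split; rewrite // mem_iota /= add0n ltn_mod ltnW.
Qed.

Lemma tors_ker_fin : exists s : seq pt, forall X, X *+ p = 0 -> X \in s.
Proof.
exists (map (@tpt F E p) tors_seq) => X h; rewrite -(pttK h); apply: map_f; exact: mem_tors_seq.
Qed.

Variable e : torsion W p -> torsion W p -> F.
Hypothesis he : is_weil_pairing e.

Let ept (X Y : pt) := e (ptt p X) (ptt p Y).

(** The identities defining the pairing hold where the chosen denominators do not vanish, that is,
    off a finite set. *)
Lemma weil_functions : exists f g : pt -> pt -> F,
  [/\ forall (T X : pt), T *+ p = 0 -> ord X (f T) (p%:Z * dv T X - p%:Z * dv 0 X),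
      forall T : pt, T *+ p = 0 -> rational (g T),
      forall T : pt, T *+ p = 0 -> ae (fun X => f T (X *+ p) = g T X ^+ p)
    & forall S T : pt, S *+ p = 0 -> T *+ p = 0 -> ae (fun X => g T (X + S) = ept S T * g T X)].
Proof.
have fib := finfib_mulrn tors_ker_fin.
have [f hf] := choice he; have [g hg] := choice hf.
exists (fun T : pt => fval (f (ptt p T))), (fun T : pt => fval (g (ptt p T))); split.
- move=> T X hT; have [rf _ H _ _] := hg (ptt p T).
  have := order_ord rf (H (toP X) (toP_on X)).
  by rewrite -[val _]/(sval _) sval_ptt // -(toP0 E) !(inj_eq (@toP_inj F E)).
- by move=> T _; apply: rat_fval.
- move=> T hT; have [rf rg _ H _] := hg (ptt p T).
  apply: (ae2 (ae_comp fib (fraction_neq0 rf)) (fraction_neq0 rg)) => X f0 g0.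
  have := H (toP X) (toP_on X); rewrite /defined_at -toP_mulrn => /(_ f0 g0); exact.
- move=> S T hS hT; have [rf rg _ _ H] := hg (ptt p T).
  apply: (ae2 (ae_tr S (fraction_neq0 rg)) (fraction_neq0 rg)) => X g1 g0.
  have := H (ptt p S) (toP X) (toP_on X).
  by rewrite /defined_at -[val _]/(sval _) sval_ptt // -toPD => /(_ g0 g1).
Qed.

Let eE S T : e S T = ept (tpt S) (tpt T). Proof. by rewrite /ept !tptK. Qed.

Lemma pairing_add S S' T : e (S + S') T = e S T * e S' T.
Proof.
have [f [g [h1 h2 h3 h4]]] := weil_functions.
by rewrite !eE tpt_add (weil_add p_gt1 tors_ker_fin h1 h3 h4) ?tpt_tor.
Qed.

Lemma pairing_exp S T : e S T ^+ p = 1.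
Proof.
have [f [g [h1 h2 h3 h4]]] := weil_functions.
by rewrite !eE (weil_exp p_gt1 tors_ker_fin h1 h3 h4) ?tpt_tor.
Qed.

Lemma pairing_antisym S T : e S T * e T S = 1.
Proof.
have [f [g [h1 h2 h3 h4]]] := weil_functions.
by rewrite !eE (weil_antisym p_gt1 tors_ker_fin h1 h2 h3 h4) ?tpt_tor.
Qed.

Lemma pairing_alt T : e T T = 1.
Proof.
have [f [g [h1 h2 h3 h4]]] := weil_functions.
by rewrite !eE (weil_alt p_odd p_gt1 tors_ker_fin h1 h2 h3 h4) ?tpt_tor.
Qed.

Lemma pairing_generators : P != 0 /\ e Q P != 1.
Proof.
have [f [g [h1 h2 h3 h4]]] := weil_functions.
have [|P0 eQP] := weil_generators p_odd p_gt1 tors_ker_fin h1 h2 h3 h4 (tpt_tor P) (tpt_tor Q).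
  move=> U hU; have [a [b e1]] := generateE (ptt p U); exists a, b.
  by rewrite -!tpt_mulrn -tpt_add -e1 pttK.
rewrite eE; split=> //; by apply: contraNneq P0 => ->; rewrite tpt_zero.
Qed.

End WeilPairing.

(** * Powers for the twisted product *)

Section StarPower.
Variables (F : closedFieldType) (E : ell F) (p : nat).
Hypotheses (p_prime : prime p) (p_odd : odd p).
Local Notation W := (ell_eq E).
Local Notation tors := (tors_of E p).
Implicit Types (S T U : tors).
Variables (P Q : tors).
Hypothesis gen : generate (P : torsion W p) Q.
Variable e : torsion W p -> torsion W p -> F.
Hypothesis he : is_weil_pairing e.
Variables (rho : torsion W p -> torsion W p -> F) (gamma : torsion W p -> F).
Hypothesis gamma_unit : Rbar_unit gamma.
Hypothesis gamma0 : gamma (tors0 W p) = 1.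
Hypothesis gamma_rho : forall T1 T2, partial gamma T1 T2 = rho T1 T2.

Let p_gt1 : (1 < p)%N. Proof. exact: prime_gt1. Qed.
Let p_gt0 : (0 < p)%N. Proof. exact: prime_gt0. Qed.

Lemma tors_addK S T : S + T - S = T. Proof. by rewrite addrAC subrr add0r. Qed.
Lemma tors_subK S T : S + (T - S) = T. Proof. by rewrite addrCA subrr addr0. Qed.

Lemma star_seq (f g : torsion W p -> F) T :
  star e rho f g T = \sum_(U <- tors_seq P Q) eps e U (T - U) * rho U (T - U) * f U * g (T - U).
Proof.
pose r := [seq (U : torsion W p, T - U : torsion W p) | U <- tors_seq P Q].
have ur : uniq r by rewrite map_inj_uniq ?undup_uniq // => U U' [].
rewrite /star (_ : [set U | _]%classic = [set` r]%classic).
  by rewrite -fsbig_seq // big_map.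
apply/seteqP; split => -[U U'] /=; rewrite ?inE.
  move=> eT; apply/mapP; exists U; first exact: (mem_tors_seq p_gt1 gen).
  by rewrite -eT; congr (_, _); exact: (esym (tors_addK U U')).
by move=> /mapP [V _ [-> ->]]; exact: (tors_subK V T).
Qed.

Lemma star_Delta (g : torsion W p -> F) T :
  star e rho (Delta P Q) g T = \sum_(i < p)
    eps e (Q + P *+ i) (T - (Q + P *+ i)) * rho (Q + P *+ i) (T - (Q + P *+ i)) * g (T - (Q + P *+ i)).
Proof.
rewrite star_seq.
transitivity (\sum_(U <- tors_seq P Q) \sum_(i < p) (if U == Q + P *+ i then
    eps e U (T - U) * rho U (T - U) * g (T - U) else 0)).
  apply: eq_bigr => U _; rewrite /Delta mulr_sumr mulr_suml; apply: eq_bigr => i _.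
  rewrite /delta mulnt_mulrn -[addt _ _]/(Q + P *+ i).
  by case: eqP => _; rewrite ?mulr1 // mulr0 mul0r.
rewrite exchange_big /=; apply: eq_bigr => i _.
rewrite (bigD1_seq (Q + P *+ i)) /= ?undup_uniq ?(mem_tors_seq p_gt1 gen) //= eqxx.
by rewrite big1 ?addr0 // => U /negPf ->.
Qed.

Let z := eps e Q P.

Lemma eps_add S S' T : eps e (S + S') T = eps e S T * eps e S' T.
Proof. by rewrite /eps (pairing_add p_gt1 gen he) exprMn. Qed.

Lemma eps_antisym S T : eps e S T * eps e T S = 1.
Proof. by rewrite /eps -exprMn (pairing_antisym p_gt1 gen he) expr1n. Qed.

Lemma eps_neq0 S T : eps e S T != 0.
Proof. by apply: contra_eq_neq (eps_antisym S T) => ->; rewrite mul0r eq_sym oner_neq0. Qed.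

Lemma eps_inv S T : eps e S T = (eps e T S)^-1.
Proof. by apply: (mulIf (eps_neq0 T S)); rewrite eps_antisym mulVf ?eps_neq0. Qed.

Lemma eps_alt T : eps e T T = 1.
Proof. by rewrite /eps (pairing_alt p_odd p_gt1 gen he) expr1n. Qed.

Lemma eps_0l T : eps e (0 : tors) T = 1.
Proof. by apply: (mulIf (eps_neq0 0 T)); rewrite -eps_add addr0 mul1r. Qed.

Lemma eps_mulrn S T (n : nat) : eps e (S *+ n) T = eps e S T ^+ n.
Proof. by elim: n => [|n IH]; rewrite ?mulr0n ?eps_0l // mulrS eps_add IH exprS. Qed.

(** By alternation only the cross terms eps(Q,P)^s and eps(P,Q)^(n i) survive. *)
Lemma eps_line (i n s : nat) :
  eps e (Q + P *+ i) (Q *+ n + P *+ s) = z ^ (s%:Z - (n * i)%N%:Z).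
Proof.
have z0 : z != 0 := eps_neq0 Q P.
rewrite eps_add eps_mulrn !(eps_inv _ (Q *+ n + _)) !eps_add !eps_mulrn.
rewrite !eps_alt !expr1n mul1r mulr1 (eps_inv P Q) -/z expfzDr //.
by rewrite !exprVn invrK -exprnN exprM.
Qed.

(* The exponent is the sum of ii_m - ii_l over the pairs l < m. *)
Definition weight n (ii : {ffun 'I_n -> 'I_p}) : int :=
  \sum_(l < n) (2 * l%:Z + 1 - n%:Z) * (ii l)%:Z.
Definition total n (ii : {ffun 'I_n -> 'I_p}) : nat := (\sum_(l < n) ii l)%N.
Definition gprod n (ii : {ffun 'I_n -> 'I_p}) : F := \prod_(l < n) gamma (Q + P *+ ii l).

Definition fcons n (i : 'I_p) (ii : {ffun 'I_n -> 'I_p}) : {ffun 'I_n.+1 -> 'I_p} :=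
  [ffun l => if unlift ord0 l is Some k then ii k else i].

Lemma fcons0 n i (ii : {ffun 'I_n -> 'I_p}) : fcons i ii ord0 = i.
Proof. by rewrite ffunE unlift_none. Qed.

Lemma fconsS n i (ii : {ffun 'I_n -> 'I_p}) l : fcons i ii (lift ord0 l) = ii l.
Proof. by rewrite ffunE liftK. Qed.

Lemma total_cons n i (ii : {ffun 'I_n -> 'I_p}) : total (fcons i ii) = (i + total ii)%N.
Proof.
by rewrite /total big_ord_recl fcons0; congr addn; apply: eq_bigr => l _; rewrite fconsS.
Qed.

Lemma gprod_cons n i (ii : {ffun 'I_n -> 'I_p}) :
  gprod (fcons i ii) = gamma (Q + P *+ i) * gprod ii.
Proof.
by rewrite /gprod big_ord_recl fcons0; congr (_ * _); apply: eq_bigr => l _; rewrite fconsS.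
Qed.

(** An index i put in front of n others enters n new differences ii_l - i. *)
Lemma weight_cons n i (ii : {ffun 'I_n -> 'I_p}) :
  weight (fcons i ii) = (total ii)%:Z - (n * i)%N%:Z + weight ii.
Proof.
rewrite /weight big_ord_recl fcons0 /total (big_morph Posz PoszD (erefl _)).
have -> : \sum_(l < n) (2 * (lift ord0 l : 'I_n.+1)%:Z + 1 - n.+1%:Z) * (fcons i ii (lift ord0 l))%:Z
    = \sum_(l < n) (ii l)%:Z + \sum_(l < n) (2 * l%:Z + 1 - n%:Z) * (ii l)%:Z.
  rewrite -big_split; apply: eq_bigr => l _.
  by rewrite fconsS lift0 (intS n) (intS l) /=; ring.
by rewrite (intS n) PoszM /=; ring.
Qed.

Lemma sum_fcons n (G : {ffun 'I_n.+1 -> 'I_p} -> F) :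
  \sum_ii G ii = \sum_(i < p) \sum_(ii : {ffun 'I_n -> 'I_p}) G (fcons i ii).
Proof.
rewrite pair_big /=.
rewrite (reindex (fun u : 'I_p * {ffun 'I_n -> 'I_p} => fcons u.1 u.2)) //=.
exists (fun ii : {ffun 'I_n.+1 -> 'I_p} => (ii ord0, [ffun l => ii (lift ord0 l)])).
  move=> [i ii] _ /=; rewrite fcons0; congr (_, _); apply/ffunP => l; by rewrite ffunE fconsS.
move=> ii _ /=; apply/ffunP => l; rewrite ffunE; case: unliftP => [k ->|-> //].
by rewrite ffunE.
Qed.

(** rho(T1,T2) gamma(T1+T2) = gamma(T1) gamma(T2), so multiplying by gamma removes rho from the
    product; each further factor Delta puts one index in front. *)
Lemma star_iter n T : iter n (star e rho (Delta P Q)) (delta (tors0 W p)) T * gamma T =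
  \sum_(ii : {ffun 'I_n -> 'I_p}) (T == Q *+ n + P *+ total ii)%:R * (z ^ weight ii * gprod ii).
Proof.
elim: n T => [|n IH] T.
  rewrite (big_pred1 [ffun l : 'I_0 => Ordinal p_gt0]) => [|ii]; last first.
    by apply/esym/eqP/ffunP; case.
  rewrite /total /weight /gprod !big_ord0 mulr0n addr0 expr0z !mulr1 /delta /=.
  rewrite -[(T == _ :> torsion W p)]/(T == 0 :> tors).
  by case: eqP => [->|_]; [rewrite mul1r; exact: gamma0|rewrite mul0r].
rewrite iterS star_Delta sum_fcons mulr_suml; apply: eq_bigr => i _.
set a := Q + P *+ i.
have rhoE : rho a (T - a) = gamma a * gamma (T - a) / gamma T.
  by rewrite -gamma_rho /partial addt_add tors_subK.
have gT : gamma T != 0 by exact: gamma_unit.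
transitivity (eps e a (T - a) * gamma a *
   (iter n (star e rho (Delta P Q)) (delta (tors0 W p)) (T - a) * gamma (T - a))).
  by rewrite rhoE; field.
rewrite IH mulr_sumr; apply: eq_bigr => ii _.
have condE : (T == Q *+ n.+1 + P *+ total (fcons i ii)) = (T - a == Q *+ n + P *+ total ii).
  by rewrite subr_eq total_cons /a mulrSr mulrnDr [P *+ i + _]addrC addrACA.
rewrite condE; case: eqP => [->|_]; last by rewrite !mul0r mulr0.
rewrite !mul1r eps_line weight_cons gprod_cons [z ^ (_ + weight _)]expfzDr; last exact: eps_neq0.
ring.
Qed.

(** The innermost factor of [star_pow] is Delta itself, whereas [star_iter] starts from delta_O; the
    two agree because delta_O is a right unit for Delta. *)
Lemma star_powE (n : nat) T : (0 < n)%N ->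
  star_pow e rho (Delta P Q) n T = iter n (star e rho (Delta P Q)) (delta (tors0 W p)) T.
Proof.
case: n => // n _.
rewrite /star_pow iteropS iterSr; congr (iter n _ _ T); apply: funext => U.
have gU : gamma U != 0 by exact: gamma_unit.
apply: (mulIf gU); have := star_iter 1 U; rewrite /= => ->.
rewrite sum_fcons mulr_suml; apply: eq_bigr => i _.
rewrite (big_pred1 [ffun l : 'I_0 => Ordinal p_gt0]) => [|ii]; last first.
  by apply/esym/eqP/ffunP; case.
rewrite weight_cons total_cons gprod_cons /total /weight /gprod !big_ord0.
have -> : z ^ (0%Z - (0 * i)%N%:Z + 0) = 1 by [].
rewrite addn0 mulr1n !mul1r mulr1 /delta mulnt_mulrn addt_add.
rewrite -[(U == _ :> torsion W p)]/(U == Q + P *+ i :> tors).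
by case: eqP => [->|_] /=; rewrite ?mul1r ?mul0r.
Qed.

Let zeta := e Q P.

(** The order divides the prime p, and nondegeneracy excludes order 1. *)
Lemma zeta_prim : p.-primitive_root zeta.
Proof.
have h : zeta ^+ p = 1 := pairing_exp p_gt1 gen he Q P.
have [m mp] := prim_order_exists p_gt0 h; move: p_prime => /primeP [_ /[apply]].
case/orP => /eqP e1; last by rewrite -{1}e1.
have := prim_expr_order mp; rewrite e1 expr1 => z1.
by have [_] := pairing_generators p_odd p_gt1 gen he; rewrite -/zeta z1 eqxx.
Qed.

Lemma eps_sqr : z ^+ 2 = zeta.
Proof.
rewrite /z /eps -exprM; have -> : (p.+1./2 * 2 = p + 1)%N by move: p_odd; lia.
by rewrite exprD (pairing_exp p_gt1 gen he) mul1r expr1.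
Qed.

Lemma eps_exp : z ^+ p = 1.
Proof. by rewrite /z /eps exprAC (pairing_exp p_gt1 gen he) expr1n. Qed.

Lemma pairing_mulP (s : nat) : e (P *+ s) Q = zeta ^- s.
Proof.
have h (n : nat) : e (P *+ n) Q * zeta ^+ n = 1.
  elim: n => [|n IH]; last first.
    rewrite mulrS (pairing_add p_gt1 gen he) exprS mulrACA IH mulr1.
    exact: (pairing_antisym p_gt1 gen he).
  have x0 : e (0 : tors) Q != 0.
    apply: contra_eq_neq (pairing_antisym p_gt1 gen he (0 : tors) Q) => ->.
    by rewrite mul0r eq_sym oner_neq0.
  rewrite mulr1; apply: (mulIf x0).
  by rewrite -(pairing_add p_gt1 gen he) mulr0n addr0 mul1r.
have zn : zeta ^+ s != 0.
  by apply: contra_eq_neq (h s) => ->; rewrite mulr0 eq_sym oner_neq0.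
by apply: (mulIf zn); rewrite h mulVf.
Qed.

Lemma mulP_eq0 (s : nat) : (P *+ s == 0) = (p %| s)%N.
Proof.
apply/eqP/idP => [h|/dvdnP [m ->]]; last by rewrite mulnC mulrnA tors_exponent mul0rn.
have := pairing_mulP s; rewrite h -(mulr0n P) pairing_mulP expr0 invr1 => e1.
by rewrite (prim_order_dvd zeta_prim) -invr_eq1 -e1.
Qed.

(** * Cyclic shifts of the index tuples *)

Definition shift (ii : {ffun 'I_p -> 'I_p}) : {ffun 'I_p -> 'I_p} := [ffun l => ii (ordS l)].

Lemma shift_bij : bijective shift.
Proof.
exists (fun ii : {ffun 'I_p -> 'I_p} => [ffun l => ii (ord_pred l)]) => ii;
  by apply/ffunP => l; rewrite !ffunE ?ord_predK ?ordSK.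
Qed.

Lemma total_shift ii : total (shift ii) = total ii.
Proof.
rewrite /total [RHS](reindex (@ordS p)) /=; last exact/onW_bij/ordS_bij.
by apply: eq_bigr => l _; rewrite ffunE.
Qed.

Lemma gprod_shift ii : gprod (shift ii) = gprod ii.
Proof.
rewrite /gprod [RHS](reindex (@ordS p)) /=; last exact/onW_bij/ordS_bij.
by apply: eq_bigr => l _; rewrite ffunE.
Qed.

Lemma weight_shift ii : exists k : nat,
  weight (shift ii) = weight ii - (2 * total ii)%N%:Z + (p * k)%N%:Z.
Proof.
(* This is 2 i_0: every coefficient 2l + 1 - p drops by 2, except that index 0 wraps around to p - 1
   and gains 2p. It is written as a sum so that the equation can be checked term by term. *)
exists (2 * \sum_(l < p) (nat_of_ord l == 0) * ii l)%N.
have -> : weight (shift ii) = \sum_(l < p) (2 * (ord_pred l)%:Z + 1 - p%:Z) * (ii l)%:Z.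
  rewrite /weight [LHS](reindex (@ord_pred p)) /=; last exact/onW_bij/ord_pred_bij.
  by apply: eq_bigr => l _; rewrite ffunE ord_predK.
rewrite /weight /total !PoszM !(big_morph Posz PoszD (erefl _)) !mulr_sumr -sumrB -big_split /=.
apply: eq_bigr => l _.
have -> : ((l + p).-1 %% p)%N = (l + p * (nat_of_ord l == 0) - 1)%N.
  case: l => [[|l] hl] /=; first by rewrite add0n muln1 add0n subn1 modn_small // prednK.
  by rewrite addSn /= modnDr modn_small ?(ltnW hl) // muln0 addn0 subn1.
case: eqP => e0; rewrite ?e0; nia.
Qed.

(* A cyclic shift of the indices multiplies every term with sum [T] by
   e(T, Q), which is not 1. *)
Lemma sum_shift T : T != 0 ->
  \sum_(ii : {ffun 'I_p -> 'I_p}) (T == Q *+ p + P *+ total ii)%:R * (z ^ weight ii * gprod ii) = 0.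
Proof.
move=> T0; rewrite tors_exponent; set G := (X in \sum_ii X ii = 0).
(* Since pQ = O, only multiples of P arise as sums of the points Q + i_l P. *)
have [[jj jE]|ne] := pselect (exists ii : {ffun 'I_p -> 'I_p}, T = P *+ total ii); last first.
  by apply: big1 => ii _; rewrite /G; case: eqP => [h|_]; [case: ne; exists ii; rewrite h add0r|rewrite mul0r].
have hne : zeta ^- total jj != 1.
  rewrite invr_eq1 -(prim_order_dvd zeta_prim) -mulP_eq0 -jE //.
have h : \sum_ii G ii = zeta ^- total jj * \sum_ii G ii.
  rewrite {1}(reindex shift) /=; last exact/onW_bij/shift_bij.
  rewrite mulr_sumr; apply: eq_bigr => ii _; rewrite /G total_shift gprod_shift.
  case: eqP => [hT|_]; last by rewrite !mul0r mulr0.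
  have [k ->] := weight_shift ii.
  have zz : zeta ^- total jj = zeta ^- total ii.
    by rewrite -!pairing_mulP -jE hT add0r.
  rewrite zz !expfzDr ?eps_neq0 // -exprnP exprM eps_exp expr1n mulr1 -exprnN exprM eps_sqr; ring.
apply/eqP; apply: contraT => S0.
by move: hne; rewrite -(inj_eq (mulIf S0)) -h mul1r eqxx.
Qed.

Lemma star_pow_Delta T : star_pow e rho (Delta P Q) p T =
  (\sum_(ii : {ffun 'I_p -> 'I_p} | (p %| \sum_(l < p) ii l)%N)
     e Q P ^+ (\sum_(l < p) l.+1 * ii l)%N *
     \prod_(l < p) gamma (addt (Q : torsion W p) (mulnt (ii l) P)))
  * delta (tors0 W p) T.
Proof.
have gT : gamma T != 0 by exact: gamma_unit.
apply: (mulIf gT); rewrite star_powE // star_iter.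
have [->|T0] := eqVneq T 0; last first.
  rewrite sum_shift // /delta.
  by rewrite -[(T == _ :> torsion W p)]/(T == 0 :> tors) (negPf T0) mulr0 mul0r.
rewrite /delta eqxx mulr1 -[gamma _]/(gamma (tors0 W p)) gamma0 mulr1 [RHS]big_mkcond /=.
apply: eq_bigr => ii _; rewrite tors_exponent add0r eq_sym mulP_eq0.
rewrite -[(\sum_(l < p) ii l)%N]/(total ii).
case: (boolP (p %| total ii)%N) => hd; last by rewrite mul0r.
rewrite mul1r; congr (_ * _).
  (* 2l + 1 - p = 2(l + 1) - (p + 1), with indices counted from 1 on the right. As p divides the
     total and z^p = 1, the second part disappears, and z^2 = e(Q,P) yields the exponent of the
     theorem. *)
  have -> : weight ii = (2 * (\sum_(l < p) l.+1 * ii l))%N%:Z - ((p + 1) * total ii)%N%:Z.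
    rewrite /weight /total !PoszM !(big_morph Posz PoszD (erefl _)) !mulr_sumr -sumrB /=.
    apply: eq_bigr => l _; rewrite PoszM (intS l) PoszD; ring.
  rewrite expfzDr ?eps_neq0 // -exprnP exprM eps_sqr -exprnN.
  have /dvdnP [m ->] := hd.
  have -> : ((p + 1) * (m * p) = p * ((p + 1) * m))%N by rewrite mulnA mulnC.
  by rewrite exprM eps_exp expr1n invr1 mulr1.
by apply: eq_bigr => l _; rewrite mulnt_mulrn.
Qed.

End StarPower.

Lemma map_discriminant (F L : fieldType) (s : {rmorphism F -> L}) (E : weierstrass F) :
  discriminant (map_weierstrass s E) = s (discriminant E).
Proof. by rewrite /discriminant /=; ring. Qed.

Theorem theorem3p8
  (k : fieldExtType rat) (E0 : weierstrass k) (hE : elliptic E0)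
  (p : nat) (p_prime : prime p) (p_odd : odd p)
  (v : k -> int) (hv : discrete_valuation v)
  (kv : fieldType) (i : {rmorphism k -> kv}) (vh : kv -> int)
  (hkv : is_completion v i vh)
  (K : fieldExtType kv)
  (Kbar : closedFieldType) (j : {rmorphism K -> Kbar})
  (hj : is_algebraic_closure j)
  (E : weierstrass Kbar) (defE : E = base_change i j E0)
  (e : torsion E p -> torsion E p -> Kbar) (he : is_weil_pairing e)
  (P Q : torsion E p) (hP : rational_point j (val P)) (hPQ : generate P Q)
  (c : (galois_group j -> torsion E p) -> Prop) (hc : H1_class c)
  (alpha : torsion E p -> Kbar) (halpha : R_unit j alpha)
  (rho : torsion E p -> torsion E p -> Kbar) (hrho : RR_unit j rho)
  (gamma : torsion E p -> Kbar) (hgamma : Rbar_unit gamma)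
  (hcomp : compatible e c alpha rho gamma) :
  forall T : torsion E p,
    star_pow e rho (Delta P Q) p T =
    (\sum_(ii : {ffun 'I_p -> 'I_p} | (p %| \sum_(l < p) ii l)%N)
       e Q P ^+ (\sum_(l < p) l.+1 * ii l)%N *
       \prod_(l < p) gamma (addt Q (mulnt (ii l) P)))
    * delta (tors0 E p) T.
Proof.
(* Through this embedding Kbar inherits characteristic 0 and the discriminant stays nonzero. *)
pose s : {rmorphism k -> Kbar} := j \o (in_alg K \o i).
have ch : [pchar Kbar] =i pred0.
  by move=> q; rewrite (fmorph_pchar s) pchar_lalg pchar_num.
have ellE : elliptic E.
  by rewrite defE /elliptic (map_discriminant s) fmorph_eq0.
pose EE := Ell ch ellE.
have [xi _ [_ gamma0 _ gamma_rho]] := hcomp.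
exact: (@star_pow_Delta Kbar EE p p_prime p_odd P Q hPQ e he rho gamma hgamma gamma0 gamma_rho).
Qed.
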